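(* Let $(\rho,u,n,v)$ be any global classical solution on $\mathbb{T}^3\times\mathbb{R}_+$ of \[ \begin{aligned} &\partial_t\rho+\nabla\cdot(\rho u)=0,\\ &\partial_t(\rho u)+\nabla\cdot(\rho u\otimes u)+\nabla\rho=-\rho(u-v),\\ &\partial_t n+\nabla\cdot(nv)=0,\\ &\partial_t(nv)+\nabla\cdot(nv\otimes v)+\nabla p(n)+Lv=\rho(u-v), \end{aligned} \] with initial data $(\rho,u,n,v)|_{t=0}=(\rho_0,u_0,n_0,v_0)$. Suppose that the following conditions hold: (i) $\rho\in[0,\bar\rho]$, $n\in[0,\bar n]$, and $\rho_c(0),n_c(0)\in(0,\infty)$, for some $\bar\rho,\bar n>0$; (ii) $u,v\in L^\infty(\mathbb{T}^3\times\mathbb{R}_+)$; (iii) the initial energy \[ \widetilde E_0:=\int_{\mathbb{T}^3}\rho_0|u_0|^2dx+\int_{\mathbb{T}^3}(\rho_0-\rho_c(0))^2dx+\int_{\mathbb{T}^3}n_0|v_0|^2dx+\int_{\mathbb{T}^3}(n_0-n_c(0))^2dx \] is sufficiently small. Then \[ \mathcal{L}(t)\lesssim \mathcal{L}_0\,e^{-Ct},\qquad t\ge0, \] where $\mathcal{L}_0:=\mathcal{L}(0)$ and $C$ is a positive constant independent of $t$.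
   Context: Here $p(n)=n^\gamma$ with $\gamma>1$, and $Lv=-\mu\Delta v-(\mu+\lambda)\nabla(\nabla\cdot v)$ with $\mu>0$ and $\lambda+2\mu>0$. $\mathbb{T}^3$ is the three-dimensional periodic domain, normalized to have volume $1$. The averaged quantities are \[ m_c(t)=\frac{\int_{\mathbb{T}^3}\rho u\,dx}{\int_{\mathbb{T}^3}\rho\,dx},\quad j_c(t)=\frac{\int_{\mathbb{T}^3}nv\,dx}{\int_{\mathbb{T}^3}n\,dx},\quad \rho_c(t)=\int_{\mathbb{T}^3}\rho\,dx,\quad n_c(t)=\int_{\mathbb{T}^3}n\,dx, \] and the Lyapunov function is \[ \mathcal{L}(t)=\int_{\mathbb{T}^3}\rho|u-m_c|^2dx+\int_{\mathbb{T}^3}(\rho-\rho_c)^2dx+\int_{\mathbb{T}^3}n|v-j_c|^2dx+|m_c-j_c|^2+\int_{\mathbb{T}^3}(n-n_c)^2dx . \] The notation $f\lesssim g$ means that there exists a positive constant $C>0$ such that $f\le Cg$. *)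

(* Defs.v *)
From HB Require Import structures.
From mathcomp Require Import all_boot all_order all_algebra.
From mathcomp Require Import all_classical all_reals all_analysis.

Set Implicit Arguments.
Unset Strict Implicit.
Unset Printing Implicit Defensive.

Import Order.TTheory GRing.Theory Num.Theory.
Import numFieldNormedType.Exports.

Local Open Scope classical_set_scope.
Local Open Scope ring_scope.

(* A function on the torus T^3 = R^3 / Z^3 is a Z^3-periodic function on R^3,
   and its integral over T^3 is its integral over the unit cube, so that T^3
   has volume 1.  A point of R^3 is the triple ((x_0, x_1), x_2). *)
Notation point3 R := (R * R * R)%type.
(* A pair (t, x). *)
Notation spacetime R := (R * point3 R)%type.

(* The canonical sigma-finite structure of m1 \x m2 in the library is shadowed by
   the one for finite measures; the products used below get their own. *)
Lemma product_sigma_finite d1 d2 (T1 : measurableType d1) (T2 : measurableType d2)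
    (R : realType) (m1 : {sigma_finite_measure set T1 -> \bar R})
    (m2 : {sigma_finite_measure set T2 -> \bar R}) :
  sigma_finite setT (m1 \x m2)%E.
Proof.
have /sigma_finiteP[F [TF ndF Foo]] := sigma_finiteT m1.
have /sigma_finiteP[G [TG ndG Goo]] := sigma_finiteT m2.
exists (fun n => F n `*` G n).
  rewrite -setXTT TF TG predeqE => -[x y]; split.
    move=> [/= [n _ Fnx] [k _ Gky]]; exists (maxn n k) => //; split.
    - by move: x Fnx; exact/subsetPset/ndF/leq_maxl.
    - by move: y Gky; exact/subsetPset/ndG/leq_maxr.
  by move=> [n _ []/= ? ?]; split; exists n.
move=> k; have [? ?] := Foo k; have [? ?] := Goo k.
split; first exact: measurableX.
by rewrite product_measure1E// lte_mul_pinfty// ge0_fin_numE.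
Qed.

Section lebesgue.
Context (R : realType).
Let mR := measurableTypeR R.
Definition lebesgue2 : set (mR * mR) -> \bar R :=
  (@lebesgue_measure R \x @lebesgue_measure R)%E.
HB.instance Definition _ := Measure.on lebesgue2.
HB.instance Definition _ := Measure_isSigmaFinite.Build _ _ _ lebesgue2
  (product_sigma_finite (@lebesgue_measure R) (@lebesgue_measure R)).
Definition lebesgue3 : set (mR * mR * mR) -> \bar R :=
  (lebesgue2 \x @lebesgue_measure R)%E.
HB.instance Definition _ := Measure.on lebesgue3.
HB.instance Definition _ := Measure_isSigmaFinite.Build _ _ _ lebesgue3
  (product_sigma_finite lebesgue2 (@lebesgue_measure R)).
Definition lebesgue4 : set (mR * (mR * mR * mR)) -> \bar R :=
  (@lebesgue_measure R \x lebesgue3)%E.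
HB.instance Definition _ := Measure.on lebesgue4.
HB.instance Definition _ := Measure_isSigmaFinite.Build _ _ _ lebesgue4
  (product_sigma_finite (@lebesgue_measure R) lebesgue3).
End lebesgue.

Definition cube (R : realType) : set (point3 R) :=
  `[0, 1] `*` `[0, 1] `*` `[0, 1].

Definition cylinder (R : realType) : set (spacetime R) :=
  `[0, +oo[ `*` @cube R.

Definition torus_int (R : realType) (f : point3 R -> R) : R :=
  \int[@lebesgue3 R]_(x in @cube R) f x.

Definition unit_vec (R : realType) (i : 'I_3) : point3 R :=
  ((i == 0%N :> nat)%:R, (i == 1%N :> nat)%:R, (i == 2%N :> nat)%:R).

(* The matrix norm of the library on 'rV is the sup norm, hence this one. *)
Definition sqnorm (R : realType) (a : 'rV[R]_3) : R := \sum_i a 0 i ^+ 2.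

Section differential_operators.
Context (R : realType).
Implicit Types (f : spacetime R -> R) (w : spacetime R -> 'rV[R]_3).

Definition dt f (z : spacetime R) : R := 'D_((1, 0) : spacetime R) f z.

Definition dx (i : 'I_3) f (z : spacetime R) : R :=
  'D_((0, unit_vec R i) : spacetime R) f z.

Definition divx w (z : spacetime R) : R :=
  \sum_j dx j (fun y => w y 0 j) z.

Definition laplx f (z : spacetime R) : R := \sum_j dx j (dx j f) z.

(* i-th component of L v *)
Definition lame (mu lambda : R) w (i : 'I_3) (z : spacetime R) : R :=
  - mu * laplx (fun y => w y 0 i) z - (mu + lambda) * dx i (divx w) z.

End differential_operators.

Section regularity.
Context (R : realType).
Implicit Types f : spacetime R -> R.

Definition periodic f : Prop :=
  forall t x i, 0 <= t -> f (t, x + unit_vec R i) = f (t, x).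

(* continuity up to the initial time *)
Definition cont_closed f : Prop :=
  {within [set z : spacetime R | 0 <= z.1], continuous f}.

Definition cont_open f : Prop :=
  forall z : spacetime R, 0 < z.1 -> {for z, continuous f}.

Definition C1x f : Prop :=
  forall i, (forall z : spacetime R, 0 < z.1 ->
               derivable f z ((0, unit_vec R i) : spacetime R)) /\
            cont_open (dx i f).

Definition C1t f : Prop :=
  (forall z : spacetime R, 0 < z.1 ->
     derivable f z ((1, 0) : spacetime R)) /\ cont_open (dt f).

(* C^0 on [0, oo) x T^3 and C^1 on (0, oo) x T^3 *)
Definition classical1 f : Prop :=
  [/\ periodic f, cont_closed f, C1t f & C1x f].

(* moreover C^2 in x on (0, oo) x T^3 *)
Definition classical2 f : Prop :=
  classical1 f /\ forall i, C1x (dx i f).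

End regularity.

(* The equations are required at positive times, where the time derivative is
   two-sided; the initial data are attained by continuity.  The values of the
   unknowns at negative times play no role. *)
Record global_classical_solution (R : realType) (gamma mu lambda : R)
    (rho : spacetime R -> R) (u : spacetime R -> 'rV[R]_3)
    (n : spacetime R -> R) (v : spacetime R -> 'rV[R]_3) : Prop := {
  regular_rho : classical1 rho;
  regular_u : forall i, classical1 (fun z => u z 0 i);
  regular_n : classical1 n;
  regular_v : forall i, classical2 (fun z => v z 0 i);
  euler_mass : forall z, 0 < z.1 ->
    dt rho z + divx (fun y => rho y *: u y) z = 0;
  euler_momentum : forall z i, 0 < z.1 ->
    dt (fun y => rho y * u y 0 i) z
    + divx (fun y => (rho y * u y 0 i) *: u y) z
    + dx i rho z
    = - (rho z * (u z 0 i - v z 0 i));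
  ns_mass : forall z, 0 < z.1 ->
    dt n z + divx (fun y => n y *: v y) z = 0;
  ns_momentum : forall z i, 0 < z.1 ->
    dt (fun y => n y * v y 0 i) z
    + divx (fun y => (n y * v y 0 i) *: v y) z
    + dx i (fun y => n y `^ gamma) z
    + lame mu lambda v i z
    = rho z * (u z 0 i - v z 0 i)
}.

Definition initial_data (R : realType)
    (rho : spacetime R -> R) (u : spacetime R -> 'rV[R]_3)
    (n : spacetime R -> R) (v : spacetime R -> 'rV[R]_3)
    (rho0 : point3 R -> R) (u0 : point3 R -> 'rV[R]_3)
    (n0 : point3 R -> R) (v0 : point3 R -> 'rV[R]_3) : Prop :=
  forall x, [/\ rho (0, x) = rho0 x, u (0, x) = u0 x,
                n (0, x) = n0 x & v (0, x) = v0 x].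

(* The L^oo(T^3 x R_+) norm of |w|, for the Euclidean norm |.|. *)
Definition Linfty_norm (R : realType) (w : spacetime R -> 'rV[R]_3) : \bar R :=
  let euclid (z : spacetime R) : \bar R := (Num.sqrt (sqnorm (w z)))%:E in
  ('N[@lebesgue4 R]_+oo [euclid \_ (@cylinder R)])%E.

(* rho_c and n_c *)
Definition density_mean (R : realType) (rho : spacetime R -> R) (t : R) : R :=
  torus_int (fun x => rho (t, x)).

(* m_c and j_c *)
Definition mean_velocity (R : realType) (rho : spacetime R -> R)
    (u : spacetime R -> 'rV[R]_3) (t : R) : 'rV[R]_3 :=
  \row_i (torus_int (fun x => rho (t, x) * u (t, x) 0 i)
          / torus_int (fun x => rho (t, x))).

Definition lyapunov (R : realType)
    (rho : spacetime R -> R) (u : spacetime R -> 'rV[R]_3)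
    (n : spacetime R -> R) (v : spacetime R -> 'rV[R]_3) (t : R) : R :=
  let m_c := mean_velocity rho u t in
  let j_c := mean_velocity n v t in
  torus_int (fun x => rho (t, x) * sqnorm (u (t, x) - m_c))
  + torus_int (fun x => (rho (t, x) - density_mean rho t) ^+ 2)
  + torus_int (fun x => n (t, x) * sqnorm (v (t, x) - j_c))
  + sqnorm (m_c - j_c)
  + torus_int (fun x => (n (t, x) - density_mean n t) ^+ 2).

Definition initial_energy (R : realType)
    (rho0 : point3 R -> R) (u0 : point3 R -> 'rV[R]_3)
    (n0 : point3 R -> R) (v0 : point3 R -> 'rV[R]_3) : R :=
  torus_int (fun x => rho0 x * sqnorm (u0 x))
  + torus_int (fun x => (rho0 x - torus_int rho0) ^+ 2)
  + torus_int (fun x => n0 x * sqnorm (v0 x))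
  + torus_int (fun x => (n0 x - torus_int n0) ^+ 2).

(* Main.v *)
Require Import Defs.
From HB Require Import structures.
From mathcomp Require Import all_boot all_order all_algebra.
From mathcomp Require Import all_classical all_reals all_analysis.
From mathcomp Require Import ring lra zify.
Import Order.TTheory GRing.Theory Num.Theory.
Import numFieldNormedType.Exports.
Local Open Scope ring_scope.
Set Implicit Arguments.
Unset Strict Implicit.
Unset Printing Implicit Defensive.
Local Open Scope classical_set_scope.

(** The Lyapunov function decays because the total energy dissipates the velocity
    fluctuations, and a small correction of the energy dissipates the density
    fluctuations as well.

    Energy.  Subtract from the total energy its least value for the given masses
    and total momentum ([relative_energy]).  Since both densities are bounded and
    the pressure laws are strictly monotone, the result is equivalent to the
    Lyapunov function, uniformly down to vacuum ([relative_energy_bounds]).  It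
    loses the friction [\int rho |u - v|^2] and at least
    [min mu (la + 2 mu) \int |grad v|^2], because [\int (div v)^2] is at most
    [\int |grad v|^2] ([div_le_grad], [viscous_dissipation]).  By Poincare's
    inequality these two terms control the whole velocity part: [v] is close to its
    mean, and friction ties [u] to [v] ([velocity_part_le]).  Nothing in them
    controls the densities.

    Corrector.  For a fluid with density [r], velocity [w], mean velocity [m] and
    pressure [p], the time derivative of [\int r (w - m) . grad Lap^-1 (r - r_c)]
    is [- \int p (r - r_c)] up to terms bounded by the dissipation, and
    [\int p (r - r_c)] is at least a multiple of [\int (r - r_c)^2].  Adding a small
    multiple of this functional for both phases gives a functional equivalent to
    the Lyapunov function and losing a multiple of itself ([combine_estimates],
    [functional_decay]).

    The inverse Laplacian is avoided by working with Fejer means over finitely many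
    Fourier modes.  For each mode the evolution of the coefficients is an ordinary
    differential equation, obtained by testing the equations with sines and cosines,
    and the estimate is finite algebra ([corrector_mode_bound]).  Positivity of the
    Fejer weights allows the estimates of the modes to be averaged, Bessel's
    inequality bounds the quadratic terms by integrals ([fejer_bessel]), and only
    the pressure term needs a limit: Korovkin's argument ([fejer_approx]) shows that
    its Fejer mean converges uniformly on bounded times ([fejer_uniform]).  The same
    means prove Poincare's inequality and [div_le_grad].

    The solution is differentiable only at positive times, and the entropy
    [rho ln rho] is singular at vacuum, so it is replaced by
    [(rho + d^2) ln (rho + d^2)].  Both the truncation and the shift leave errors
    that are arbitrarily small on a time interval [tau, T] with [0 < tau].  Hence
    for every [eta] there is a functional [Y], comparable to the Lyapunov function
    with fixed constants, with [Y' <= - c Y + eta] on that interval; Gronwall's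
    inequality, [eta -> 0] and then [tau -> 0] give the theorem
    ([exponential_decay]). *)

(** * Measurability of continuous functions on products *)

Section caratheodory.
Context {d} {T : measurableType d} {R : realType}.

(** Rounding the continuous variable down to a grid of step [1/(m+1)] turns [f] into
    a countable union of measurable pieces; the grid functions converge to [f]
    pointwise.  This is how continuous functions on a product become measurable
    for the product sigma-algebra. *)
Lemma caratheodory_measurable (f : T * measurableTypeR R -> R) :
  (forall y, measurable_fun setT (fun x => f (x, y))) ->
  (forall x (y : R), {for y, continuous (fun y : R => f (x, y))}) ->
  measurable_fun setT f.
Proof.
move=> mf cf.
(* [y_ m (fl m y)] is the largest multiple of [1 / (m + 1)] that is at most [y]. *)
pose y_ (m : nat) (k : int) : R := k%:~R / m.+1%:R.
pose fl (m : nat) (y : R) : int := Num.floor (y * m.+1%:R).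
apply: (@measurable_realfun.measurable_fun_cvg _ _ _ _ (fun m z => f (z.1, y_ m (fl m z.2)))).
  move=> m _ A mA; rewrite setTI.
  have -> : (fun z : T * measurableTypeR R => f (z.1, y_ m (fl m z.2))) @^-1` A =
      \bigcup_(k in [set: int]) (((fun x => f (x, y_ m k)) @^-1` A)
          `*` `[k%:~R / m.+1%:R, (k + 1)%:~R / m.+1%:R[).
    have m0 : 0 < m.+1%:R :> R by rewrite ltr0n.
    apply/seteqP; split => -[x y] /=.
      move=> Axy; exists (fl m y) => //; split => //=.
      by rewrite in_itv/= ler_pdivrMr// ltr_pdivlMr// floor_itv.
    move=> [k _ [/= Axk]]; rewrite in_itv/= ler_pdivrMr// ltr_pdivlMr// => kyk.
    by rewrite (_ : fl m y = k)//; apply: floor_def.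
  apply: countable_bigcupT_measurable; first exact: countableP.
  move=> k; apply: measurableX; last exact: measurable_itv.
  by rewrite -[X in measurable X]setTI; exact: mf.
move=> [x y] _ /=.
apply: (@cvg_comp _ _ _ (fun m => y_ m (fl m y) : R) (fun y : R => f (x, y)) _ _ _ _ (cf x y)).
apply/cvgrPdist_le => e e0; near=> m.
rewrite /y_ /fl; set k := Num.floor _.
have m0 : 0 < m.+1%:R :> R by rewrite ltr0n.
have /andP[] := floor_itv (y * m.+1%:R); rewrite -/k -ler_pdivrMr// -ltr_pdivlMr// intrD mulrDl mul1r => h1 h2.
rewrite ger0_norm ?subr_ge0//.
apply: (@le_trans _ _ m.+1%:R^-1); first by rewrite lerBlDl ltW.
exact/ltW/(near (near_infty_natSinv_lt (PosNum e0)) m).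
Unshelve. all: by end_near. Qed.

End caratheodory.

(** * Integrals over the torus *)

Section cube.
Context {R : realType}.
Let mR := measurableTypeR R.
Implicit Types f g : point3 R -> R.

Lemma continuous_pairl (X Y Z : topologicalType) (f : X * Y -> Z) (y : Y) :
  continuous f -> continuous (fun x => f (x, y)).
Proof.
move=> cf x; apply: (@cvg_comp _ _ _ (fun x => (x, y)) f _ _ _ _ (cf (x, y))).
by apply: cvg_pair; [exact: cvg_id|exact: cvg_cst].
Qed.

Lemma continuous_pairr (X Y Z : topologicalType) (f : X * Y -> Z) (x : X) :
  continuous f -> continuous (fun y => f (x, y)).
Proof.
move=> cf y; apply: (@cvg_comp _ _ _ (fun y => (x, y)) f _ _ _ _ (cf (x, y))).
by apply: cvg_pair; [exact: cvg_cst|exact: cvg_id].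
Qed.

Lemma continuous_measurable2 (f : R * R -> R) :
  continuous f -> measurable_fun setT (f : mR * mR -> R).
Proof.
move=> cf; apply: caratheodory_measurable => [y|x y].
  by apply: measurable_realfun.continuous_measurable_fun; exact: continuous_pairl.
exact: continuous_pairr.
Qed.

Lemma continuous_measurable3 f :
  continuous f -> measurable_fun setT (f : mR * mR * mR -> R).
Proof.
move=> cf; apply: caratheodory_measurable => [y|x y].
  by apply: continuous_measurable2; exact: continuous_pairl.
exact: continuous_pairr.
Qed.

Lemma cube_compact : compact (@cube R).
Proof. by do 2?apply: compact_setX => //; exact: segment_compact. Qed.

Lemma square_measurable :
  measurable (`[0, 1] `*` `[0, 1] : set (mR * mR)).
Proof. by apply: measurableX; exact: measurable_itv. Qed.

Lemma cube_measurable : measurable (@cube R : set (mR * mR * mR)).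
Proof. by apply: measurableX; [exact: square_measurable|exact: measurable_itv]. Qed.

Lemma lebesgue2_square : @lebesgue2 R (`[0, 1] `*` `[0, 1]) = 1%E.
Proof.
rewrite /lebesgue2 product_measure1E; [|exact: measurable_itv|exact: measurable_itv].
by rewrite /= lebesgue_measure_itv/= lte_fin ltr01 oppr0 adde0 mule1.
Qed.

Lemma lebesgue3_cube : @lebesgue3 R (@cube R) = 1%E.
Proof.
rewrite /lebesgue3 product_measure1E; [|exact: square_measurable|exact: measurable_itv].
rewrite -[RHS]mule1; congr (_ * _)%E; first exact: lebesgue2_square.
by rewrite /= lebesgue_measure_itv/= lte_fin ltr01 oppr0 adde0.
Qed.

Lemma compact_bounded_fun (T : topologicalType) (A : set T) (f : T -> R) :
  compact A -> {within A, continuous f} -> [bounded f x | x in A].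
Proof.
move=> cA cf; have := compact_bounded (continuous_compact cf cA).
move=> [M [Mr h]]; exists M; split => // x Mx y Ay /=.
by apply: (h x Mx); exists y.
Qed.

Lemma integrable_square (f : R * R -> R) : continuous f ->
  (@lebesgue2 R).-integrable (`[0, 1] `*` `[0, 1] : set (mR * mR)) (EFin \o f).
Proof.
move=> cf; apply: measurable_bounded_integrable.
- exact: square_measurable.
- by rewrite (le_lt_trans _ (ltry 1))// -lebesgue2_square.
- by apply: measurable_funTS; exact: continuous_measurable2.
- apply: (@compact_bounded_fun (R * R)%type).
    by apply: compact_setX; exact: segment_compact.
  exact: continuous_subspaceT.
Qed.

Lemma integrable_cube f : continuous f ->
  (@lebesgue3 R).-integrable (@cube R) (EFin \o f).
Proof.
move=> cf; apply: measurable_bounded_integrable.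
- exact: cube_measurable.
- by rewrite (le_lt_trans _ (ltry 1))// -lebesgue3_cube.
- by apply: measurable_funTS; exact: continuous_measurable3.
- apply: (@compact_bounded_fun (point3 R)); first exact: cube_compact.
  exact: continuous_subspaceT.
Qed.

Lemma torus_intD f g : continuous f -> continuous g ->
  torus_int (fun x => f x + g x) = torus_int f + torus_int g.
Proof.
by move=> cf cg; apply: RintegralD;
  [exact: cube_measurable|exact: integrable_cube|exact: integrable_cube].
Qed.

Lemma torus_intZ (a : R) f : continuous f ->
  torus_int (fun x => a * f x) = a * torus_int f.
Proof.
by move=> cf; apply: RintegralZl; [exact: cube_measurable|exact: integrable_cube].
Qed.

Lemma torus_int_cst (a : R) : torus_int (fun=> a) = a.
Proof.
rewrite /torus_int Rintegral_cst; last exact: cube_measurable.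
by rewrite [X in fine X](lebesgue3_cube) /= mulr1.
Qed.

Lemma le_torus_int f g : continuous f -> continuous g ->
  (forall x, cube x -> f x <= g x) -> torus_int f <= torus_int g.
Proof.
move=> cf cg fg; apply: le_Rintegral;
  [exact: cube_measurable|exact: integrable_cube|exact: integrable_cube|exact: fg].
Qed.

Lemma eq_torus_int f g : (forall x, cube x -> f x = g x) -> torus_int f = torus_int g.
Proof. by move=> fg; apply: eq_Rintegral => x; rewrite inE => /fg. Qed.

End cube.

(** * Integrals of derivatives vanish *)

Section fubini_zero.
Context {d1 d2} {T1 : measurableType d1} {T2 : measurableType d2} {R : realType}.
Context {m1 : {sigma_finite_measure set T1 -> \bar R}}.
Context {m2 : {sigma_finite_measure set T2 -> \bar R}}.
Context (D1 : set T1) (D2 : set T2) (g : T1 * T2 -> \bar R).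
Hypotheses (mD1 : measurable D1) (mD2 : measurable D2).
Hypothesis ig : (m1 \x m2)%E.-integrable (D1 `*` D2) g.

Let ig' : (m1 \x m2)%E.-integrable setT (g \_ (D1 `*` D2)).
Proof. by apply/(integrable_mkcond _ (measurableX mD1 mD2)). Qed.

(** Fubini's theorem: an integral vanishes when its inner integrals do. *)
Lemma integral_fiber2_eq0 :
  (forall x, D1 x -> \int[m2]_(y in D2) g (x, y) = 0)%E ->
  (\int[m1 \x m2]_(z in D1 `*` D2) g z = 0)%E.
Proof.
move=> h; rewrite integral_mkcond -integral12_prod_meas1//.
apply: integral0_eq => x _; rewrite /fubini_F.
have [Dx|nDx] := pselect (D1 x); last first.
  apply: integral0_eq => y _; rewrite patchE ifF//.
  by apply/negbTE; rewrite notin_setE => -[].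
rewrite -(h x Dx) [RHS]integral_mkcond; apply: eq_integral => y _.
rewrite !patchE; have [/set_mem Dy|/negP nDy] := boolP (y \in D2).
  by rewrite ifT//; exact/mem_set.
by rewrite ifF//; apply/negbTE/negP => /set_mem[/= _ h']; apply: nDy; exact/mem_set.
Qed.

Lemma integral_fiber1_eq0 :
  (forall y, D2 y -> \int[m1]_(x in D1) g (x, y) = 0)%E ->
  (\int[m1 \x m2]_(z in D1 `*` D2) g z = 0)%E.
Proof.
move=> h; rewrite integral_mkcond -integral21_prod_meas1//.
apply: integral0_eq => y _; rewrite /fubini_G.
have [Dy|nDy] := pselect (D2 y); last first.
  apply: integral0_eq => x _; rewrite patchE ifF//.
  by apply/negbTE; rewrite notin_setE => -[].
rewrite -(h y Dy) [RHS]integral_mkcond; apply: eq_integral => x _.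
rewrite !patchE; have [/set_mem Dx|/negP nDx] := boolP (x \in D1).
  by rewrite ifT//; exact/mem_set.
by rewrite ifF//; apply/negbTE/negP => /set_mem[/= h' _]; apply: nDx; exact/mem_set.
Qed.

End fubini_zero.

Section integral_of_derivative.
Context {R : realType}.

Lemma integral01_derive_periodic (F g : R -> R) :
  (forall x : R, is_derive x 1 F (g x)) -> continuous g -> F 1 = F 0 ->
  (\int[@lebesgue_measure R]_(x in `[0%R, 1%R]) (g x)%:E = 0)%E.
Proof.
move=> dF cg F10.
have cF : continuous F.
  by move=> x; apply: differentiable_continuous; apply/derivable1_diffP; apply: ex_derive.
rewrite (@continuous_FTC2 _ g F) ?F10 ?ltr01 ?subee//.
- exact: continuous_subspaceT.
- split=> [x _||].
  + exact: ex_derive.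
  + by apply: cvg_at_right_filter; exact: cF.
  + by apply: cvg_at_left_filter; exact: cF.
- by move=> x _; rewrite derive1E derive_val.
Qed.

Lemma is_derive_line (V : normedModType R) (f : V -> R) (x v : V) (h : R -> V) (s df : R) :
  (forall e, h (e + s) = e *: v + x) ->
  is_derive x v f df -> is_derive s 1 (f \o h) df.
Proof.
move=> hs [dv <-].
have E : (fun e : R => e^-1 *: (f (h (e *: 1 + s)) - f (h s))) =
         (fun e : R => e^-1 *: (f (e *: v + x) - f x)).
  have hs0 : h s = x by have := hs 0; rewrite add0r scale0r add0r.
  by apply/funext => e; rewrite hs0 -hs [in LHS]/GRing.scale/= mulr1.
by split; rewrite /derivable /derive /comp /= E.
Qed.

(** Integration by parts on the torus has no boundary term: along each axis the
    fundamental theorem of calculus gives a difference of equal values. *)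
Lemma torus_int_derive_eq0 (f g : point3 R -> R) (i : 'I_3) :
  (forall x : point3 R, is_derive x (unit_vec R i) f (g x)) -> continuous g ->
  (forall x, f (x + unit_vec R i) = f x) ->
  torus_int g = 0.
Proof.
move=> df cg pf; rewrite /torus_int/Rintegral.
rewrite [X in fine X](_ : _ = 0%E)//.
have mI : measurable (`[0, 1] : set (measurableTypeR R)) by exact: measurable_itv.
have ig := integrable_cube cg.
case: i df pf => -[|[|[|//]]] ilt df pf.
- apply: integral_fiber1_eq0 => //; first exact: square_measurable.
  move=> z z01; apply: integral_fiber1_eq0 => //=.
    by apply: integrable_square; exact: continuous_pairl.
  move=> y y01.
  apply: (@integral01_derive_periodic (fun x => f ((x, y), z))).
  + move=> x; apply: (@is_derive_line _ f ((x, y), z) _ _ _ _ _ (df _)) => e.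
    by congr ((_, _), _) => /=; rewrite /GRing.scale/= ?mulr1 ?mulr0 ?add0r.
  + by apply: (continuous_pairl (f := fun xy => g (xy, z))); exact: continuous_pairl.
  + rewrite -[RHS]pf; congr (f ((_, _), _)) => /=; by rewrite ?addr0 ?add0r.
- apply: integral_fiber1_eq0 => //; first exact: square_measurable.
  move=> z z01; apply: integral_fiber2_eq0 => //=.
    by apply: integrable_square; exact: continuous_pairl.
  move=> x x01.
  apply: (@integral01_derive_periodic (fun y => f ((x, y), z))).
  + move=> y; apply: (@is_derive_line _ f ((x, y), z) _ _ _ _ _ (df _)) => e.
    by congr ((_, _), _) => /=; rewrite /GRing.scale/= ?mulr1 ?mulr0 ?add0r.
  + by apply: (continuous_pairr (f := fun xy => g (xy, z))); exact: continuous_pairl.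
  + rewrite -[RHS]pf; congr (f ((_, _), _)) => /=; by rewrite ?addr0 ?add0r.
- apply: integral_fiber2_eq0 => //; first exact: square_measurable.
  move=> [x y] xy01.
  apply: (@integral01_derive_periodic (fun z => f ((x, y), z))).
  + move=> z; apply: (@is_derive_line _ f ((x, y), z) _ _ _ _ _ (df _)) => e.
    by congr ((_, _), _) => /=; rewrite /GRing.scale/= ?mulr1 ?mulr0 ?add0r.
  + exact: continuous_pairr.
  + rewrite -[RHS]pf; congr (f ((_, _), _)) => /=; by rewrite ?addr0 ?add0r.
Qed.

End integral_of_derivative.

(** * Directional derivatives *)

Section directional.
Context {R : realType}.

(** The derivative of [f] at [x] along [v] only sees the line through [x]. *)
Lemma is_derive_lineP (V : normedModType R) (f : V -> R) (x v : V) (df : R) :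
  is_derive x v f df <-> is_derive (0 : R) 1 (fun s : R => f (s *: v + x)) df.
Proof.
have E : (fun e : R => e^-1 *: (f ((e *: (1 : R) + 0 : R) *: v + x) - f (0 *: v + x))) =
         (fun e : R => e^-1 *: (f (e *: v + x) - f x)).
  apply/funext => e; have e1 : e *: (1 : R) = e by rewrite /GRing.scale/= mulr1.
  by rewrite scale0r add0r addr0 e1.
by split => -[dv Dv]; split; move: dv Dv; rewrite /derivable /derive /comp /= E.
Qed.

(** The domain is an arbitrary normed space, so the chain rule is applied on the
    line through [x]. *)
Lemma is_derive_compR (V : normedModType R) (f : V -> R) (phi : R -> R) (x v : V)
    (df dphi : R) :
  is_derive x v f df -> is_derive (f x) 1 phi dphi ->
  is_derive x v (phi \o f) (dphi * df).
Proof.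
move=> /is_derive_lineP h dp; apply/is_derive_lineP.
apply: (@is_derive1_comp _ phi (fun s => f (s *: v + x))).
by rewrite scale0r add0r.
Qed.

Lemma is_derive_prod (V : normedModType R) (f g : V -> R) (x v : V) (df dg : R) :
  is_derive x v f df -> is_derive x v g dg ->
  is_derive x v (fun y => f y * g y) (f x * dg + g x * df).
Proof. by move=> hf hg; exact: is_deriveM. Qed.

Lemma is_derive_add (V : normedModType R) (f g : V -> R) (x v : V) (df dg : R) :
  is_derive x v f df -> is_derive x v g dg ->
  is_derive x v (fun y => f y + g y) (df + dg).
Proof. by move=> hf hg; exact: is_deriveD. Qed.

Lemma is_derive_sub (V : normedModType R) (f g : V -> R) (x v : V) (df dg : R) :
  is_derive x v f df -> is_derive x v g dg ->
  is_derive x v (fun y => f y - g y) (df - dg).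
Proof. by move=> hf hg; exact: is_deriveB. Qed.

Lemma is_derive_scal (V : normedModType R) (a : R) (f : V -> R) (x v : V) (df : R) :
  is_derive x v f df -> is_derive x v (fun y => a * f y) (a * df).
Proof. by move=> hf; exact: is_deriveZ. Qed.

Lemma is_derive_const (V : normedModType R) (a : R) (x v : V) :
  is_derive x v (fun=> a) 0.
Proof. exact: is_derive_cst. Qed.

Lemma deriveE_is (V : normedModType R) (f : V -> R) (x v : V) (df : R) :
  is_derive x v f df -> 'D_v f x = df.
Proof. by case. Qed.

End directional.

(** * Continuity in spacetime and uniformity in space *)

Section continuity_algebra.
Context {R : realType} {T : topologicalType}.
Implicit Types (f g : T -> R) (z : T).

Lemma cont_cst (a : R) z : continuous_at z (fun _ : T => a).
Proof. exact: cvg_cst. Qed.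

Lemma cont_add f g z : continuous_at z f -> continuous_at z g ->
  continuous_at z (fun x => f x + g x).
Proof. by move=> cf cg; exact: cvgD. Qed.

Lemma cont_sub f g z : continuous_at z f -> continuous_at z g ->
  continuous_at z (fun x => f x - g x).
Proof. by move=> cf cg; exact: cvgB. Qed.

Lemma cont_opp f z : continuous_at z f -> continuous_at z (fun x => - f x).
Proof. by move=> cf; exact: cvgN. Qed.

Lemma cont_mul f g z : continuous_at z f -> continuous_at z g ->
  continuous_at z (fun x => f x * g x).
Proof. by move=> cf cg; exact: cvgM. Qed.

Lemma cont_exp f n z : continuous_at z f -> continuous_at z (fun x => f x ^+ n).
Proof.
move=> cf; elim: n => [|n ih]; first exact: cont_cst.
by under [X in continuous_at _ X]eq_fun do rewrite exprS; exact: cont_mul.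
Qed.

Lemma cont_sum (I : Type) (r : seq I) (P : pred I) (f : I -> T -> R) z :
  (forall i, continuous_at z (f i)) ->
  continuous_at z (fun x => \sum_(i <- r | P i) f i x).
Proof.
move=> cf; elim: r => [|i r ih].
  by under [X in continuous_at _ X]eq_fun do rewrite big_nil; exact: cont_cst.
under [X in continuous_at _ X]eq_fun do rewrite big_cons.
by case: (P i) => //; exact: cont_add.
Qed.

Lemma cont_comp f (phi : R -> R) z : continuous_at z f ->
  continuous_at (f z) phi -> continuous_at z (fun x => phi (f x)).
Proof. exact: continuous_comp. Qed.

End continuity_algebra.

Lemma cvg_pairT (T : Type) (U V : topologicalType) (F : set_system T) {FF : Filter F}
    (f : T -> U) (g : T -> V) (a : U) (b : V) :
  f y @[y --> F] --> a -> g y @[y --> F] --> b -> (f y, g y) @[y --> F] --> (a, b).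
Proof. by move=> ha hb; exact: cvg_pair. Qed.

Section slices.
Context {R : realType}.
Implicit Types f g : spacetime R -> R.

Definition tint f (t : R) : R := torus_int (fun x => f (t, x)).

Lemma slice_continuous f t : cont_open f -> 0 < t -> continuous (fun x => f (t, x)).
Proof.
move=> cf t0 x; apply: (@cvg_comp _ _ _ (fun x => (t, x)) f _ _ _ _ (cf (t, x) t0)).
by apply: cvg_pairT; [exact: cvg_cst|exact: cvg_id].
Qed.

Lemma cont_closed_cvg f (t : R) (x : point3 R) : cont_closed f -> 0 <= t ->
  f y @[y --> within (fun z : spacetime R => 0 <= z.1) (nbhs ((t, x) : spacetime R))] --> f (t, x).
Proof. by move=> /subspace_continuousP cf t0; exact: cf. Qed.

Lemma slice_continuous_closed f t :
  cont_closed f -> 0 <= t -> continuous (fun x => f (t, x)).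
Proof.
move=> cf t0 x.
apply: (@cvg_comp _ _ _ (fun x => (t, x)) f _ _ _ _ (@cont_closed_cvg f t x cf t0)).
move=> A; rewrite /within /nbhs /= => -[[B1 B2] [/= B1t B2x] BA].
apply: filterS (B2x) => y B2y; apply: (BA (t, y)) => //; split => //=.
exact: nbhs_singleton.
Qed.

Lemma closed_open f : cont_closed f -> cont_open f.
Proof.
move=> cf z z0; have := @cont_closed_cvg f z.1 z.2 cf (ltW z0).
rewrite -surjective_pairing => h A /h; rewrite /within /nbhs/= => hA.
have : \forall y \near z, 0 <= y.1.
  have : (fun y : spacetime R => y.1) y @[y --> z] --> z.1 by exact: cvg_fst.
  move=> /(_ [set x | 0 <= x]); apply.
  by apply: filterS (lt_nbhsr z0) => x /ltW.
by apply: filterS2 hA => y /[swap] y0; exact.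
Qed.

(** Continuity at each point of the slice, made uniform by compactness of the
    cube.  The filter [F] will be the right neighbourhood of the initial time. *)
Lemma uniform_slice (F : set_system R) f (t : R) : Filter F ->
  (forall x : point3 R, f (p.2, p.1) @[p --> filter_prod (nbhs x) F] --> f (t, x)) ->
  continuous (fun x => f (t, x)) ->
  forall e, 0 < e -> \forall s \near F, forall x, cube x -> `|f (s, x) - f (t, x)| < e.
Proof.
move=> FF cf ct e e0.
have e20 : 0 < e / 2 by rewrite divr_gt0.
have /compact_near_coveringP := @cube_compact R.
move=> /(_ _ F (fun s x => `|f (s, x) - f (t, x)| < e) FF); apply => x _.
have /cvgrPdist_lt /(_ _ e20) h1 := cf x.
have /cvgrPdist_lt /(_ _ e20) h2 := ct x.
have h2' : \forall p \near filter_prod (nbhs x) F, `|f (t, x) - f (t, p.1)| < e / 2.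
  by exists ([set y | `|f (t, x) - f (t, y)| < e / 2], setT);
    [split => //; exact: filterT|case=> y s [/= ]].
apply: filterS2 h1 h2' => -[y s] /= a b.
rewrite [ltRHS](splitr e) (le_lt_trans _ (ltrD a b))//.
rewrite (_ : f (s, y) - f (t, y) = - (f (t, x) - f (s, y)) + (f (t, x) - f (t, y))).
  by rewrite (le_trans (ler_normD _ _))// normrN.
by ring.
Qed.

Lemma uniform_slice_closed f (e : R) : cont_closed f -> 0 < e ->
  \forall s \near (0 : R)^'+, forall x, cube x -> `|f (s, x) - f (0, x)| < e.
Proof.
move=> cf e0; apply: (@uniform_slice (0 : R)^'+ f 0 _ _ _ e e0) => [x|];
  last exact: slice_continuous_closed.
apply: (@cvg_comp _ _ _ (fun p : point3 R * R => (p.2, p.1)) f _ _ _ _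
  (@cont_closed_cvg f 0 x cf (lexx 0))).
move=> A [[B1 B2] [/= B1t B2x] BA].
exists (B2, (fun s => B1 s /\ 0 < s)).
  split => //=; change (\forall s \near (0 : R), 0 < s -> B1 s /\ 0 < s).
  by apply: filterS B1t => s B1s s0; split.
move=> [y s] /= [B2y [B1s s0]]; apply: (BA (s, y)) => //=.
exact: ltW.
Qed.

(** Uniform convergence on the cube passes to the integral. *)
Lemma cvg_tint (F : set_system R) f (t : R) : ProperFilter F ->
  (\forall s \near F, continuous (fun x => f (s, x))) ->
  continuous (fun x => f (t, x)) ->
  (forall e, 0 < e -> \forall s \near F, forall x, cube x -> `|f (s, x) - f (t, x)| < e) ->
  tint f s @[s --> F] --> tint f t.
Proof.
move=> FF cs ct h; apply/cvgrPdist_le => e e0.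
apply: filterS2 cs (h e e0) => s css hs.
rewrite ler_norml; apply/andP; split.
  rewrite lerBrDl -lerBrDr opprK.
  rewrite -[X in _ + X](torus_int_cst e) -torus_intD//; last by move=> ?; exact: cont_cst.
  apply: le_torus_int => //.
    by move=> x; apply: cont_add; [exact: ct|exact: cont_cst].
  by move=> x /hs; rewrite ltr_norml => /andP[_ /ltW]; rewrite lerBlDl.
rewrite lerBlDl -[X in _ + X](torus_int_cst e) -torus_intD//; last by move=> ?; exact: cont_cst.
apply: le_torus_int => //.
  by move=> x; apply: cont_add; [exact: css|exact: cont_cst].
by move=> x /hs; rewrite ltr_norml => /andP[/ltW + _]; rewrite lerNl opprB lerBlDl.
Qed.

Lemma cvg_tint0 f : cont_closed f -> tint f s @[s --> 0^'+] --> tint f 0.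
Proof.
move=> cf; apply: cvg_tint.
- near=> s; apply: slice_continuous_closed => //.
- exact: slice_continuous_closed.
- by move=> e; exact: uniform_slice_closed.
Unshelve. all: by end_near. Qed.

End slices.

(** * Balance laws integrated over the torus *)

Section conservation.
Context {R : realType}.
Implicit Types f g : spacetime R -> R.

(** Derivatives of the unknowns are controlled only away from the initial time; on
    a slab [a <= t <= b] with [0 < a] compactness bounds them. *)
Lemma bounded_slab f (a b : R) : cont_open f -> 0 < a ->
  exists2 B : R, 0 <= B & forall t x, a <= t <= b -> cube x -> `|f (t, x)| <= B.
Proof.
move=> cf a0.
have cK : compact (`[a, b] `*` @cube R : set (spacetime R)).
  by apply: compact_setX; [exact: segment_compact|exact: cube_compact].
have cfK : {within (`[a, b] `*` @cube R : set (spacetime R)), continuous f}.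
  apply: continuous_in_subspaceT => -[t x] /set_mem[/= + _].
  by rewrite in_itv/= => /andP[/(lt_le_trans a0) t0 _]; exact: cf.
have [M [Mr hM]] := compact_bounded_fun cK cfK.
exists (Num.max M 0 + 1) => [|t x tab cx]; first by rewrite addr_ge0// le_max lexx orbT.
apply: (hM (Num.max M 0 + 1)); last by split.
by rewrite (@le_lt_trans _ _ (Num.max M 0)) ?le_max ?lexx// ltrDl.
Qed.

Lemma is_derive_time f (t : R) (x : point3 R) df :
  is_derive ((t, x) : spacetime R) ((1, 0) : spacetime R) f df ->
  is_derive t 1 (fun s => f (s, x)) df.
Proof.
apply: is_derive_line => e; congr (_, _); first by rewrite /= /GRing.scale/= mulr1.
by rewrite /= scaler0 add0r.
Qed.

Lemma is_derive_tint f (t : R) : cont_open f -> C1t f -> 0 < t ->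
  is_derive t 1 (tint f) (tint (dt f) t).
Proof.
move=> cf [df cdf] t0.
pose F (s : R) (x : measurableTypeR R * measurableTypeR R * measurableTypeR R) := f (s, x).
have t20 : 0 < t / 2 by rewrite divr_gt0.
have It : (`]t / 2, t * 2[ : set R) t by rewrite /= ?in_itv/=; apply/andP; split; lra.
have [B B0 hB] := @bounded_slab (dt f) (t / 2) (t * 2) cdf t20.
have pos s : (`]t / 2, t * 2[ : set R) s -> 0 < s.
  by rewrite /= ?in_itv/= => /andP[+ _]; exact: lt_trans.
have dF s x : (`]t / 2, t * 2[ : set R) s -> is_derive s 1 (F ^~ x) (dt f (s, x)).
  by move=> /pos s0; apply: is_derive_time; apply/derivableP/df.
have intF s : (`]t / 2, t * 2[ : set R) s -> (@lebesgue3 R).-integrable (@cube R) (EFin \o F s).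
  by move=> /pos s0; apply: integrable_cube; exact: slice_continuous.
have derF s x : (`]t / 2, t * 2[ : set R) s -> cube x -> derivable (F ^~ x) s 1.
  by move=> sI _; have [] := dF s x sI.
have E s x : (`]t / 2, t * 2[ : set R) s -> partial1of2 F s x = dt f (s, x).
  by move=> sI; rewrite partial1of2E; exact: (deriveE_is (dF s x sI)).
have GB s x : (`]t / 2, t * 2[ : set R) s -> cube x -> `|partial1of2 F s x| <= B.
  move=> sI cx; rewrite E//; apply: hB => //.
  by move: sI; rewrite /= ?in_itv/= => /andP[/ltW-> /ltW->].
have iB : (@lebesgue3 R).-integrable (@cube R) (EFin \o (fun=> B)).
  by apply: integrable_cube => x; exact: cont_cst.
have D := @derivable_under_integral R _ _ (@lebesgue3 R) F (@cube R)
  cube_measurable t _ _ It intF derF (fun=> B) (fun=> B0) iB GB.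
have V := @differentiation_under_integral R _ _ (@lebesgue3 R) F (@cube R)
  cube_measurable t _ _ It intF derF (fun=> B) (fun=> B0) iB GB.
split; first exact: D.
rewrite -derive1E [LHS]V; apply: eq_torus_int => x cx.
exact: E.
Qed.

(** Periodicity at positive times, which survives differentiation in space. *)
Definition periodic_open f := forall t x i, 0 < t -> f (t, x + unit_vec R i) = f (t, x).

Definition C1dir (v : spacetime R) f :=
  (forall z : spacetime R, 0 < z.1 -> derivable f z v) /\ cont_open ('D_v f).

Lemma is_derive_space f (t : R) (x : point3 R) (i : 'I_3) df :
  is_derive ((t, x) : spacetime R) ((0, unit_vec R i) : spacetime R) f df ->
  is_derive x (unit_vec R i) (fun y => f (t, y)) df.
Proof.
move=> /is_derive_lineP h; apply/is_derive_lineP; move: h.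
rewrite (_ : (fun s : R => f (s *: ((0, unit_vec R i) : spacetime R) + (t, x))) =
  (fun s : R => f (t, s *: (unit_vec R i : point3 R) + x)))//.
by apply/funext => s; congr f; congr (_, _); rewrite /= scaler0 add0r.
Qed.

Lemma tint_dx_eq0 f i t : periodic_open f -> C1dir (0, unit_vec R i) f -> 0 < t ->
  tint (dx i f) t = 0.
Proof.
move=> pf [df cdf] t0.
apply: (@torus_int_derive_eq0 _ (fun x => f (t, x)) _ i).
- by move=> x; apply: is_derive_space; apply/derivableP/df.
- exact: slice_continuous.
- by move=> x; exact: pf.
Qed.

Lemma tintD f g t : cont_open f -> cont_open g -> 0 < t ->
  tint (fun z => f z + g z) t = tint f t + tint g t.
Proof. by move=> cf cg t0; apply: torus_intD; exact: slice_continuous. Qed.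

Lemma tint_sum (I : Type) (r : seq I) (f : I -> spacetime R -> R) t :
  (forall i, cont_open (f i)) -> 0 < t ->
  tint (fun z => \sum_(i <- r) f i z) t = \sum_(i <- r) tint (f i) t.
Proof.
move=> cf t0; elim: r => [|i r ih].
  rewrite big_nil /tint; under [X in torus_int X]eq_fun do rewrite big_nil.
  exact: torus_int_cst.
rewrite big_cons -ih /tint; under [X in torus_int X]eq_fun do rewrite big_cons.
rewrite torus_intD//; first exact: slice_continuous.
apply: (@slice_continuous _ (fun z => \sum_(i <- r) f i z)) => // z z0.
by apply: cont_sum => j; exact: cf.
Qed.

(** A pointwise balance law integrates over the torus, where fluxes cancel. *)
Lemma balance_law (e s : spacetime R -> R) (X : 'I_3 -> spacetime R -> R) (t : R) :
  cont_open e -> C1t e ->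
  (forall j, periodic_open (X j)) -> (forall j, C1dir (0, unit_vec R j) (X j)) ->
  (forall z, 0 < z.1 -> dt e z + \sum_j dx j (X j) z = s z) ->
  0 < t -> is_derive t 1 (tint e) (tint s t).
Proof.
move=> ce de pX dX eq t0.
rewrite (_ : tint s t = tint (dt e) t); first exact: is_derive_tint.
have cX j : cont_open (dx j (X j)) by case: (dX j).
transitivity (tint (fun z => dt e z + \sum_j dx j (X j) z) t).
  by apply: eq_torus_int => x _; rewrite eq.
rewrite tintD//; last first.
- by move=> z z0; apply: cont_sum => j; exact: cX.
- by case: de.
rewrite tint_sum// big1 ?addr0// => j _.
exact: tint_dx_eq0.
Qed.

End conservation.

(** * Trigonometric modes *)

Section modes.
Context {R : realType}.
Implicit Types (k l : 'I_3 -> int) (x y : point3 R).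

Lemma twopi_gt0 : 0 < 2 * pi :> R.
Proof. by rewrite mulr_gt0 ?pi_gt0. Qed.

Definition crd x (j : 'I_3) : R :=
  if j == 0%N :> nat then x.1.1 else if j == 1%N :> nat then x.1.2 else x.2.

Definition phase k x : R := 2 * pi * \sum_j (k j)%:~R * crd x j.

Definition cosm k x : R := cos (phase k x).
Definition sinm k x : R := sin (phase k x).

Lemma crdD x y j : crd (x + y) j = crd x j + crd y j.
Proof. by rewrite /crd; case: ifP => // _; case: ifP. Qed.

Lemma crdN x j : crd (- x) j = - crd x j.
Proof. by rewrite /crd; case: ifP => // _; case: ifP. Qed.

Lemma crdZ (s : R) x j : crd (s *: x) j = s * crd x j.
Proof. by rewrite /crd; case: ifP => // _; case: ifP. Qed.

Lemma crd_unit (i j : 'I_3) : crd (unit_vec R i) j = (i == j)%:R.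
Proof. by case: i => -[|[|[|//]]] ?; case: j => -[|[|[|//]]] ?. Qed.

Lemma crd_cont j : continuous (fun x => crd x j).
Proof.
have c1 (U V : topologicalType) : continuous (fun z : U * V => z.1) by move=> ?; exact: cvg_fst.
have c2 (U V : topologicalType) : continuous (fun z : U * V => z.2) by move=> ?; exact: cvg_snd.
move=> x; rewrite /crd; case: (j == 0%N :> nat).
  exact: (continuous_comp (c1 (R * R)%type R x) (c1 R R x.1)).
by case: (j == 1%N :> nat); [exact: (continuous_comp (c1 (R * R)%type R x) (c2 R R x.1))|exact: c2].
Qed.

Lemma phaseD k x y : phase k (x + y) = phase k x + phase k y.
Proof.
rewrite /phase -mulrDr -big_split/=; congr (_ * _).
by apply: eq_bigr => j _; rewrite crdD mulrDr.
Qed.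

Lemma phaseN k x : phase k (- x) = - phase k x.
Proof.
rewrite /phase -mulrN -sumrN; congr (_ * _).
by apply: eq_bigr => j _; rewrite crdN mulrN.
Qed.

Lemma phaseB k x y : phase k (x - y) = phase k x - phase k y.
Proof. by rewrite phaseD phaseN. Qed.

Lemma phaseZ k (s : R) x : phase k (s *: x) = s * phase k x.
Proof.
rewrite /phase [RHS]mulrCA; congr (_ * _); rewrite mulr_sumr.
by apply: eq_bigr => j _; rewrite crdZ mulrCA.
Qed.

Lemma phase_modeD k l x : phase (fun j => k j + l j) x = phase k x + phase l x.
Proof.
rewrite /phase -mulrDr -big_split/=; congr (_ * _).
by apply: eq_bigr => j _; rewrite intrD mulrDl.
Qed.

Lemma phase_modeB k l x : phase (fun j => k j - l j) x = phase k x - phase l x.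
Proof.
rewrite /phase -mulrBr -sumrB; congr (_ * _).
by apply: eq_bigr => j _; rewrite intrD intrN mulrBl.
Qed.

Lemma phase_unit k i : phase k (unit_vec R i) = 2 * pi * (k i)%:~R.
Proof.
rewrite /phase (bigD1 i)//= crd_unit eqxx mulr1 big1 ?addr0// => j ji.
by rewrite crd_unit eq_sym (negbTE ji) mulr0.
Qed.

Lemma phase_cont k : continuous (phase k).
Proof.
move=> x; apply: (@cont_mul _ _ (fun=> 2 * pi) (fun x => \sum_j (k j)%:~R * crd x j)).
  exact: cont_cst.
by apply: cont_sum => j; apply: cont_mul; [exact: cont_cst|exact: crd_cont].
Qed.

Lemma cosm_cont k : continuous (cosm k).
Proof. by move=> x; apply: cont_comp; [exact: phase_cont|exact: continuous_cos]. Qed.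

Lemma sinm_cont k : continuous (sinm k).
Proof. by move=> x; apply: cont_comp; [exact: phase_cont|exact: continuous_sin]. Qed.

Lemma sin_cosD2piz (m : int) (s : R) :
  cos (s + 2 * pi * m%:~R) = cos s /\ sin (s + 2 * pi * m%:~R) = sin s.
Proof.
have nat_case (n : nat) (u : R) :
    cos (u + 2 * pi * n%:R) = cos u /\ sin (u + 2 * pi * n%:R) = sin u.
  elim: n => [|n [ihc ihs]]; first by rewrite mulr0 addr0.
  have -> : u + 2 * pi * n.+1%:R = u + 2 * pi * n%:R + pi *+ 2.
    by rewrite -natr1 -mulr_natl; ring.
  by rewrite cosD2pi sinD2pi.
case: m => n; first exact: nat_case.
have [h1 h2] := nat_case n.+1 (s + 2 * pi * (Negz n)%:~R).
rewrite -h1 -h2 NegzE intrN (_ : s + _ + _ = s)//.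
by rewrite -[n.+1%:R]/((n.+1 : int)%:~R); ring.
Qed.

Lemma cosm_periodic k x i : cosm k (x + unit_vec R i) = cosm k x.
Proof. by rewrite /cosm phaseD phase_unit; case: (sin_cosD2piz (k i) (phase k x)). Qed.

Lemma sinm_periodic k x i : sinm k (x + unit_vec R i) = sinm k x.
Proof. by rewrite /sinm phaseD phase_unit; case: (sin_cosD2piz (k i) (phase k x)). Qed.

Lemma is_derive_phase k x i :
  is_derive x (unit_vec R i) (phase k) (2 * pi * (k i)%:~R).
Proof.
apply/is_derive_lineP.
rewrite (_ : (fun s : R => _) = (fun s : R => s * (2 * pi * (k i)%:~R) + phase k x)); last first.
  by apply/funext => s; rewrite phaseD phaseZ phase_unit.
have h : is_derive (0 : R) 1 (fun s : R => s * (2 * pi * (k i)%:~R) + phase k x)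
    (0 * 0 + 2 * pi * (k i)%:~R * 1 + 0).
  exact: (is_derive_add (is_derive_prod (is_derive_id _ _) (@is_derive_const _ _ _ _ _))
    (@is_derive_const _ _ _ _ _)).
by apply: (is_derive_eq h); rewrite mul0r add0r mulr1 addr0.
Qed.

Lemma is_derive_cosm k x i :
  is_derive x (unit_vec R i) (cosm k) (- (2 * pi * (k i)%:~R * sinm k x)).
Proof.
apply: is_derive_eq; first exact: (is_derive_compR (is_derive_phase k x i) (is_derive_cos _)).
by rewrite mulNr mulrC.
Qed.

Lemma is_derive_sinm k x i :
  is_derive x (unit_vec R i) (sinm k) (2 * pi * (k i)%:~R * cosm k x).
Proof.
apply: is_derive_eq; first exact: (is_derive_compR (is_derive_phase k x i) (is_derive_sin _)).
by rewrite mulrC.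
Qed.

Definition mode0 k : bool := [forall j, k j == 0].

Lemma cosm_mode0 k x : mode0 k -> cosm k x = 1.
Proof.
by move=> /forallP k0; rewrite /cosm /phase big1 ?mulr0 ?cos0// => j _;
  rewrite (eqP (k0 j)) mul0r.
Qed.

Lemma sinm_mode0 k x : mode0 k -> sinm k x = 0.
Proof.
by move=> /forallP k0; rewrite /sinm /phase big1 ?mulr0 ?sin0// => j _;
  rewrite (eqP (k0 j)) mul0r.
Qed.

Lemma torus_int_cosm k : torus_int (cosm k) = (mode0 k)%:R.
Proof.
have [k0|/forallPn[j kj0]] := boolP (mode0 k).
  by rewrite -[RHS](torus_int_cst 1); apply: eq_torus_int => x _; exact: cosm_mode0.
have c0 : 2 * pi * (k j)%:~R != 0 :> R.
  by apply: mulf_neq0; [exact: lt0r_neq0 twopi_gt0|rewrite intr_eq0].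
apply: (@torus_int_derive_eq0 _ (fun x => (2 * pi * (k j)%:~R)^-1 * sinm k x) _ j).
- move=> x; apply: is_derive_eq; first exact: is_derive_scal (is_derive_sinm k x j).
  by rewrite mulKf.
- exact: cosm_cont.
- by move=> x; rewrite sinm_periodic.
Qed.

Lemma torus_int_sinm k : torus_int (sinm k) = 0.
Proof.
have [k0|/forallPn[j kj0]] := boolP (mode0 k).
  by rewrite -[RHS](torus_int_cst 0); apply: eq_torus_int => x _; exact: sinm_mode0.
have c0 : - (2 * pi * (k j)%:~R) != 0 :> R.
  by rewrite oppr_eq0; apply: mulf_neq0; [exact: lt0r_neq0 twopi_gt0|rewrite intr_eq0].
apply: (@torus_int_derive_eq0 _ (fun x => (- (2 * pi * (k j)%:~R))^-1 * cosm k x) _ j).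
- move=> x; apply: is_derive_eq; first exact: is_derive_scal (is_derive_cosm k x j).
  by rewrite -[X in _ * X]mulNr mulKf.
- exact: sinm_cont.
- by move=> x; rewrite cosm_periodic.
Qed.

Lemma cosm_sub k l x :
  cosm k x * cosm l x + sinm k x * sinm l x = cosm (fun j => k j - l j) x.
Proof. by rewrite /cosm /sinm phase_modeB cosB. Qed.

Lemma sinm_sub k l x :
  sinm k x * cosm l x - cosm k x * sinm l x = sinm (fun j => k j - l j) x.
Proof. by rewrite /cosm /sinm phase_modeB sinB. Qed.

End modes.

(** * Fourier coefficients and Bessel's inequality *)

Section fourier.
Context {R : realType}.
Implicit Types (f g : point3 R -> R) (k l : 'I_3 -> int).

Hint Resolve cosm_cont sinm_cont : core.

Lemma torus_int_sum (I : Type) (r : seq I) (f : I -> point3 R -> R) :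
  (forall i, continuous (f i)) ->
  torus_int (fun x => \sum_(i <- r) f i x) = \sum_(i <- r) torus_int (f i).
Proof.
move=> cf; elim: r => [|i r ih].
  rewrite big_nil; under [X in torus_int X]eq_fun do rewrite big_nil.
  exact: torus_int_cst.
rewrite big_cons -ih; under [X in torus_int X]eq_fun do rewrite big_cons.
rewrite torus_intD// => x; by apply: cont_sum => j; exact: cf.
Qed.

Lemma torus_intB f g : continuous f -> continuous g ->
  torus_int (fun x => f x - g x) = torus_int f - torus_int g.
Proof.
move=> cf cg; rewrite -[in RHS]mulN1r -(torus_intZ (-1) cg) -torus_intD//.
  by apply: eq_torus_int => x _; rewrite mulN1r.
by move=> x; apply: cont_mul; [exact: cont_cst|exact: cg].
Qed.

Lemma torus_int_ge0 f : (forall x, cube x -> 0 <= f x) -> 0 <= torus_int f.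
Proof. by move=> f0; rewrite /torus_int /Rintegral fine_ge0// integral_ge0// => x /f0; rewrite lee_fin. Qed.

Definition fcos k f := torus_int (fun x => f x * cosm k x).
Definition fsin k f := torus_int (fun x => f x * sinm k x).

(** The real part of the product of the Fourier coefficient of [f] with the
    conjugate of that of [g]. *)
Definition fprod f g k := fcos k f * fcos k g + fsin k f * fsin k g.

Lemma fcos_mode0 k f : mode0 k -> fcos k f = torus_int f.
Proof. by move=> k0; apply: eq_torus_int => x _; rewrite cosm_mode0// mulr1. Qed.

Lemma fsin_mode0 k f : mode0 k -> fsin k f = 0.
Proof.
move=> k0; rewrite -[RHS](torus_int_cst 0); apply: eq_torus_int => x _.
by rewrite sinm_mode0// mulr0.
Qed.

Lemma fcosB k f g : continuous f -> continuous g ->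
  fcos k (fun x => f x - g x) = fcos k f - fcos k g.
Proof.
move=> cf cg; rewrite /fcos -torus_intB.
- by apply: eq_torus_int => x _; rewrite mulrBl.
- by move=> x; apply: cont_mul; [exact: cf|exact: cosm_cont].
- by move=> x; apply: cont_mul; [exact: cg|exact: cosm_cont].
Qed.

Lemma fsinB k f g : continuous f -> continuous g ->
  fsin k (fun x => f x - g x) = fsin k f - fsin k g.
Proof.
move=> cf cg; rewrite /fsin -torus_intB.
- by apply: eq_torus_int => x _; rewrite mulrBl.
- by move=> x; apply: cont_mul; [exact: cf|exact: sinm_cont].
- by move=> x; apply: cont_mul; [exact: cg|exact: sinm_cont].
Qed.

Lemma fcos_cst k (a : R) : fcos k (fun=> a) = a * (mode0 k)%:R.
Proof. by rewrite /fcos torus_intZ ?torus_int_cosm//; exact: cosm_cont. Qed.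

Lemma fsin_cst k (a : R) : fsin k (fun=> a) = 0.
Proof. by rewrite /fsin torus_intZ ?torus_int_sinm ?mulr0//; exact: sinm_cont. Qed.

(** Expand the square of the distance from [f] to its projection on the modes
    [kappa a]: [P] and [Q] are the real and imaginary parts of the projection, and
    orthonormality of the modes makes the quadratic and the cross term equal. *)
Lemma bessel_inequality (A : finType) (kappa : A -> 'I_3 -> int) f :
  continuous f ->
  (forall a b, mode0 (fun j => kappa a j - kappa b j) = (a == b)) ->
  \sum_a fprod f f (kappa a) <= torus_int (fun x => f x ^+ 2).
Proof.
move=> cf inj.
pose al a := fcos (kappa a) f; pose be a := fsin (kappa a) f.
pose P x := \sum_a (al a * cosm (kappa a) x + be a * sinm (kappa a) x).
pose Q x := \sum_a (al a * sinm (kappa a) x - be a * cosm (kappa a) x).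
pose X1 x := \sum_a (al a * (f x * cosm (kappa a) x) + be a * (f x * sinm (kappa a) x)).
pose U a b x := (al a * al b + be a * be b) * cosm (fun j => kappa a j - kappa b j) x
  + (be a * al b - al a * be b) * sinm (fun j => kappa a j - kappa b j) x.
pose X2 x := \sum_a \sum_b U a b x.
have PQ x : P x ^+ 2 + Q x ^+ 2 = X2 x.
  rewrite !expr2 /P /Q !big_distrlr -big_split/=; apply: eq_bigr => a _.
  rewrite -big_split/=; apply: eq_bigr => b _.
  by rewrite /U -cosm_sub -sinm_sub; ring.
have fP x : f x * P x = X1 x.
  by rewrite /P mulr_sumr; apply: eq_bigr => a _; ring.
have cU a b : continuous (U a b).
  by move=> x; apply: cont_add; apply: cont_mul; solve [exact: cont_cst|exact: cosm_cont|exact: sinm_cont].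
have cX2 : continuous X2.
  by move=> x; apply: cont_sum => a; apply: cont_sum => b; exact: cU.
have cfc k : continuous (fun x => f x * cosm k x).
  by move=> x; apply: cont_mul; [exact: cf|exact: cosm_cont].
have cfs k : continuous (fun x => f x * sinm k x).
  by move=> x; apply: cont_mul; [exact: cf|exact: sinm_cont].
have cX1 : continuous X1.
  move=> x; apply: cont_sum => a; apply: cont_add; apply: cont_mul;
    solve [exact: cont_cst|exact: cfc|exact: cfs].
have cf2 : continuous (fun x => f x ^+ 2) by move=> x; apply: cont_exp; exact: cf.
have IX1 : torus_int X1 = \sum_a fprod f f (kappa a).
  rewrite torus_int_sum; last first.
    move=> a x; apply: cont_add; apply: cont_mul; solve [exact: cont_cst|exact: cfc|exact: cfs].
  apply: eq_bigr => a _; rewrite torus_intD ?torus_intZ//.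
    by move=> x; apply: cont_mul; [exact: cont_cst|exact: cfc].
  by move=> x; apply: cont_mul; [exact: cont_cst|exact: cfs].
have IX2 : torus_int X2 = \sum_a fprod f f (kappa a).
  rewrite torus_int_sum; last by move=> a x; apply: cont_sum => b; exact: cU.
  apply: eq_bigr => a _; rewrite torus_int_sum//.
  rewrite (bigD1 a)//= big1 ?addr0 => [|b ba].
    rewrite torus_intD ?torus_intZ ?torus_int_cosm ?torus_int_sinm ?inj ?eqxx.
      - by rewrite mulr1 mulr0 addr0.
      - exact: sinm_cont.
      - exact: cosm_cont.
      - by move=> x; apply: cont_mul; [exact: cont_cst|exact: cosm_cont].
      - by move=> x; apply: cont_mul; [exact: cont_cst|exact: sinm_cont].
  rewrite torus_intD ?torus_intZ ?torus_int_cosm ?torus_int_sinm ?inj.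
    - by rewrite eq_sym (negbTE ba) !mulr0 addr0.
    - exact: sinm_cont.
    - exact: cosm_cont.
    - by move=> x; apply: cont_mul; [exact: cont_cst|exact: cosm_cont].
    - by move=> x; apply: cont_mul; [exact: cont_cst|exact: sinm_cont].
have : 0 <= torus_int (fun x => f x ^+ 2 + (X2 x - 2 * X1 x)).
  apply: torus_int_ge0 => x _; rewrite -PQ -fP.
  rewrite (_ : _ + _ = (f x - P x) ^+ 2 + Q x ^+ 2); last by ring.
  by rewrite addr_ge0// sqr_ge0.
have c2X1 : continuous (fun x => 2 * X1 x).
  by move=> x; apply: cont_mul; [exact: cont_cst|exact: cX1].
rewrite torus_intD//; last by move=> x; apply: cont_sub; [exact: cX2|exact: c2X1].
rewrite torus_intB// torus_intZ// IX1 IX2; lra.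
Qed.

End fourier.

(** * Fejer means *)

Section fejer.
Context {R : realType}.
Implicit Types (f g : point3 R -> R) (k l : 'I_3 -> int) (phi psi : ('I_3 -> int) -> R).

Definition mode_diff N (a b : {ffun 'I_3 -> 'I_N.+1}) : 'I_3 -> int :=
  fun j => (a j : int) - (b j : int).

(** The Fejer mean of a function of the modes.  The weight
    [\prod_j (1 - |k_j|/(N+1))] of [k] is written as the proportion of pairs of
    vectors below [N+1] with difference [k]: positivity of the kernel and Bessel's
    inequality are then immediate. *)
Definition fejer N phi : R :=
  (N.+1%:R ^+ 3)^-1 *
  \sum_(b : {ffun 'I_3 -> 'I_N.+1}) \sum_(a : {ffun 'I_3 -> 'I_N.+1}) phi (mode_diff a b).

Lemma fejer_weight_ge0 N : 0 <= (N.+1%:R ^+ 3)^-1 :> R.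
Proof. by rewrite invr_ge0 exprn_ge0. Qed.

Lemma fejer_weight_neq0 N : N.+1%:R ^+ 3 != 0 :> R.
Proof. by rewrite expf_neq0// pnatr_eq0. Qed.

Lemma le_fejer N phi psi : (forall k, phi k <= psi k) -> fejer N phi <= fejer N psi.
Proof.
move=> h; apply: ler_wpM2l; first exact: fejer_weight_ge0.
by apply: ler_sum => b _; apply: ler_sum => a _.
Qed.

Lemma eq_fejer N phi psi : (forall k, phi k = psi k) -> fejer N phi = fejer N psi.
Proof. by move=> h; congr fejer; apply/funext. Qed.

Lemma fejerD N phi psi : fejer N (fun k => phi k + psi k) = fejer N phi + fejer N psi.
Proof.
rewrite /fejer -mulrDr -big_split/=; congr (_ * _); apply: eq_bigr => b _.
by rewrite -big_split.
Qed.

Lemma fejerZ N (c : R) phi : fejer N (fun k => c * phi k) = c * fejer N phi.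
Proof.
rewrite /fejer mulrCA; congr (_ * _); rewrite mulr_sumr; apply: eq_bigr => b _.
by rewrite mulr_sumr.
Qed.

Lemma fejer_sum (I : Type) N (r : seq I) (phi : I -> ('I_3 -> int) -> R) :
  fejer N (fun k => \sum_(i <- r) phi i k) = \sum_(i <- r) fejer N (phi i).
Proof.
elim: r => [|i r ih].
  rewrite big_nil /fejer big1 ?mulr0// => b _; rewrite big1// => a _.
  by rewrite big_nil.
by rewrite big_cons -ih -fejerD; apply: eq_fejer => k; rewrite big_cons.
Qed.

Lemma mode0_diff N (a b : {ffun 'I_3 -> 'I_N.+1}) : mode0 (mode_diff a b) = (a == b).
Proof.
apply/forallP/eqP => [h|-> j]; last by rewrite /mode_diff subrr.
by apply/ffunP => j; apply/val_inj; have := h j; rewrite /mode_diff subr_eq0 => /eqP[].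
Qed.

(** For fixed [b] the modes [a - b] are distinct, so Bessel's inequality applies to
    each of the inner sums. *)
Lemma fejer_bessel N f : continuous f ->
  fejer N (fprod f f) <= torus_int (fun x => f x ^+ 2).
Proof.
move=> cf; rewrite /fejer ler_pdivrMl; last by rewrite exprn_gt0.
have -> : N.+1%:R ^+ 3 * torus_int (fun x => f x ^+ 2) =
    \sum_(b : {ffun 'I_3 -> 'I_N.+1}) torus_int (fun x => f x ^+ 2).
  by rewrite sumr_const card_ffun !card_ord -[RHS]mulr_natl natrX.
apply: ler_sum => b _; apply: bessel_inequality => // a a'.
rewrite -mode0_diff; congr mode0; apply/funext => j.
by rewrite /mode_diff; ring.
Qed.

Lemma fejer_mode0 N phi : fejer N (fun k => (mode0 k)%:R * phi k) = phi (fun=> 0).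
Proof.
rewrite /fejer (_ : \sum_b _ = N.+1%:R ^+ 3 * phi (fun=> 0)) ?mulKf ?fejer_weight_neq0//.
have -> : N.+1%:R ^+ 3 * phi (fun=> 0) =
    \sum_(b : {ffun 'I_3 -> 'I_N.+1}) phi (fun=> 0).
  by rewrite sumr_const card_ffun !card_ord -[RHS]mulr_natl natrX.
apply: eq_bigr => b _; rewrite (bigD1 b)//= big1 ?addr0 => [|a ab].
  rewrite mode0_diff eqxx mul1r; congr phi; apply/funext => j.
  by rewrite /mode_diff subrr.
by rewrite mode0_diff (negbTE ab) mul0r.
Qed.

Definition unit_mode (i : 'I_3) : 'I_3 -> int := fun j => (i == j)%:R.

(** Along the axis [i], [N] of the [N+1] values of [b] have a neighbour [a] at
    distance [s]; along the other axes all [N+1] diagonal pairs count. *)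
Lemma fejer_unit_mode N i (s : int) : s = 1 \/ s = -1 ->
  fejer N (fun k => (mode0 (fun j => k j - s * unit_mode i j))%:R) = 1 - N.+1%:R^-1.
Proof.
move=> s1.
have E k : (mode0 (fun j => k j - s * unit_mode i j))%:R =
    \prod_j (k j == s * unit_mode i j)%:R :> R.
  rewrite /mode0; case: forallP => [h|/existsNP[j /negP h]].
    by rewrite big1// => j _; rewrite -subr_eq0 h.
  by rewrite (bigD1 j)//= -subr_eq0 (negbTE h) mul0r.
pose F j (b a : 'I_N.+1) : R := ((a : int) - (b : int) == s * unit_mode i j)%:R.
have -> : fejer N (fun k => (mode0 (fun j => k j - s * unit_mode i j))%:R) =
    (N.+1%:R ^+ 3)^-1 * \prod_j \sum_b \sum_a F j b a.
  rewrite /fejer; congr (_ * _).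
  rewrite bigA_distr_bigA /=; apply: eq_bigr => b _.
  by rewrite bigA_distr_bigA /=; apply: eq_bigr => a _; rewrite E.
have F0 j : j != i -> \sum_b \sum_a F j b a = N.+1%:R.
  move=> ji; have ij : (i == j) = false by rewrite eq_sym (negbTE ji).
  transitivity (\sum_(b : 'I_N.+1) (1 : R)); last by rewrite sumr_const card_ord.
  apply: eq_bigr => b _; rewrite (bigD1 b)//= big1 ?addr0 => [|a ab].
    by rewrite /F /unit_mode ij mulr0 subrr eqxx.
  rewrite /F /unit_mode ij mulr0 subr_eq0.
  by case: eqP => // -[] /val_inj/eqP; rewrite (negbTE ab).
have Fi : \sum_b \sum_a F i b a = N%:R.
  have Fi1 : \sum_(b : 'I_N.+1) \sum_(a : 'I_N.+1) ((a : int) - (b : int) == 1)%:R = N%:R :> R.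
    rewrite big_ord_recr/= [X in _ + X]big1 ?addr0 => [|a _]; last first.
      by have := ltn_ord a; case: eqP => //; lia.
    transitivity (\sum_(b < N) (1 : R)); last by rewrite sumr_const card_ord.
    apply: eq_bigr => b _.
    rewrite (bigD1 (lift ord0 b))//= big1 ?addr0 => [|a ab].
      by case: eqP => //; rewrite /bump/=; lia.
    case: eqP => // h; exfalso; move/eqP: ab; apply; apply/val_inj => /=.
    by move: h; rewrite /bump/=; lia.
  rewrite /F /unit_mode eqxx mulr1; case: s1 => ->; first exact: Fi1.
  rewrite exchange_big/= -[RHS]Fi1; apply: eq_bigr => b _; apply: eq_bigr => a _.
  by congr (_%:R); rewrite -eqr_opp opprB opprK.
rewrite (bigD1 i)//= Fi (eq_bigr (fun=> N.+1%:R)) => [|j ji]; last exact: F0.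
rewrite prodr_const (_ : #|_| = 2); last first.
  by rewrite cardC1 card_ord.
have N0 : N.+1%:R != 0 :> R by rewrite pnatr_eq0.
by move: N0; rewrite -natr1 => N0; field.
Qed.

End fejer.

(** * The Fejer kernel as an approximate identity *)

Section fejer_approximation.
Context {R : realType}.
Implicit Types (f g : point3 R -> R) (k l : 'I_3 -> int) (x y : point3 R).

Lemma torus_int_fejer N (Phi : ('I_3 -> int) -> point3 R -> R) :
  (forall k, continuous (Phi k)) ->
  torus_int (fun x => fejer N (Phi ^~ x)) = fejer N (fun k => torus_int (Phi k)).
Proof.
move=> cP; rewrite /fejer torus_intZ; last first.
  by move=> x; apply: cont_sum => b; apply: cont_sum => a; exact: cP.
congr (_ * _); rewrite torus_int_sum; last first.
  by move=> b x; apply: cont_sum => a; exact: cP.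
by apply: eq_bigr => b _; rewrite torus_int_sum.
Qed.

Lemma cont_fejer N (Phi : ('I_3 -> int) -> point3 R -> R) x :
  (forall k, continuous_at x (Phi k)) -> continuous_at x (fun y => fejer N (Phi ^~ y)).
Proof.
move=> cP; apply: cont_mul; first exact: cont_cst.
by apply: cont_sum => b; apply: cont_sum => a; exact: cP.
Qed.

Lemma cosm_expand k x y : cosm k (x - y) = cosm k x * cosm k y + sinm k x * sinm k y.
Proof. by rewrite /cosm /sinm phaseB cosB. Qed.

Lemma cont_cosm_shift k x : continuous (fun y => cosm k (x - y)).
Proof.
move=> y; rewrite (_ : (fun y => cosm k (x - y)) =
  (fun y => cosm k x * cosm k y + sinm k x * sinm k y)).
  apply: cont_add; apply: cont_mul; try exact: cont_cst.
    exact: cosm_cont.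
  exact: sinm_cont.
by apply/funext => z; exact: cosm_expand.
Qed.

Lemma torus_int_cosm_shift k x : torus_int (fun y => cosm k (x - y)) = (mode0 k)%:R.
Proof.
under [X in torus_int X]eq_fun do rewrite cosm_expand.
rewrite torus_intD ?torus_intZ ?torus_int_cosm ?torus_int_sinm ?mulr0 ?addr0.
- by have [k0|_] := boolP (mode0 k); rewrite ?mulr0// mulr1 cosm_mode0.
- exact: sinm_cont.
- exact: cosm_cont.
- by move=> y; apply: cont_mul; [exact: cont_cst|exact: cosm_cont].
- by move=> y; apply: cont_mul; [exact: cont_cst|exact: sinm_cont].
Qed.

Definition fejer_kernel N x := fejer N (fun k => cosm k x).

(** The kernel is the squared modulus of a sum of modes. *)
Lemma fejer_kernel_ge0 N x : 0 <= fejer_kernel N x.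
Proof.
pose e (a : {ffun 'I_3 -> 'I_N.+1}) : 'I_3 -> int := fun j => (a j : int).
rewrite /fejer_kernel /fejer mulr_ge0 ?fejer_weight_ge0//.
rewrite (_ : \sum_b _ = (\sum_a cosm (e a) x) ^+ 2 + (\sum_a sinm (e a) x) ^+ 2).
  by rewrite addr_ge0// sqr_ge0.
rewrite !expr2 !big_distrlr -big_split/=; apply: eq_bigr => b _.
rewrite -big_split/=; apply: eq_bigr => a _.
by rewrite [X in X + _]mulrC [X in _ + X]mulrC cosm_sub.
Qed.

Lemma cont_kernel_shift N x : continuous (fun y => fejer_kernel N (x - y)).
Proof. by move=> y; apply: cont_fejer => k; exact: cont_cosm_shift. Qed.

Lemma torus_int_kernel N x : torus_int (fun y => fejer_kernel N (x - y)) = 1.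
Proof.
rewrite torus_int_fejer => [|k]; last exact: cont_cosm_shift.
rewrite -[RHS](fejer_mode0 N (fun=> 1)); apply: eq_fejer => k.
by rewrite torus_int_cosm_shift mulr1.
Qed.

Lemma torus_int_kernel_moment N x i :
  torus_int (fun y => fejer_kernel N (x - y) * (1 - cosm (unit_mode i) (x - y))) =
  N.+1%:R^-1.
Proof.
pose p k j := k j - 1 * unit_mode i j; pose m k j := k j - (- 1) * unit_mode i j.
have E z k : cosm k z * cosm (unit_mode i) z = 2^-1 * (cosm (p k) z + cosm (m k) z).
  have -> : p k = fun j => k j - unit_mode i j by apply/funext => j; rewrite /p mul1r.
  have -> : m k = fun j => k j + unit_mode i j by apply/funext => j; rewrite /m mulN1r opprK.
  by rewrite /cosm phase_modeB phase_modeD cosB cosD; field.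
under [X in torus_int X]eq_fun do rewrite mulrBr mulr1.
rewrite torus_intB; last 2 first.
- exact: cont_kernel_shift.
- move=> y; apply: cont_mul; [exact: cont_kernel_shift|exact: cont_cosm_shift].
rewrite torus_int_kernel.
rewrite (_ : torus_int _ = 1 - N.+1%:R^-1); first by ring.
transitivity (torus_int (fun y => fejer N (fun k =>
    2^-1 * (cosm (p k) (x - y) + cosm (m k) (x - y))))).
  apply: eq_torus_int => y _; rewrite mulrC /fejer_kernel -fejerZ.
  by apply: eq_fejer => k; rewrite mulrC E.
rewrite torus_int_fejer; last first.
  move=> k y; apply: cont_mul; first exact: cont_cst.
  by apply: cont_add; exact: cont_cosm_shift.
transitivity (fejer N (fun k => 2^-1 * ((mode0 (p k))%:R + (mode0 (m k))%:R) : R)).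
  apply: eq_fejer => k; rewrite torus_intZ ?torus_intD ?torus_int_cosm_shift//;
    try exact: cont_cosm_shift.
  by move=> y; apply: cont_add; exact: cont_cosm_shift.
rewrite fejerZ fejerD !fejer_unit_mode; [by field|by right|by left].
Qed.

(** Korovkin's argument: a positive kernel is an approximate identity as soon as
    its first Fourier coefficients tend to one. *)
Lemma fejer_approx N f g (e A B : R) : continuous f -> continuous g -> 0 <= A ->
  (forall x y, cube x -> cube y ->
     `|g y - g x| <= e + A * \sum_i (1 - cosm (unit_mode i) (x - y))) ->
  (forall x, cube x -> `|f x| <= B) ->
  `|fejer N (fprod f g) - torus_int (fun x => f x * g x)| <= B * (e + A * (3 / N.+1%:R)).
Proof.
move=> cf cg A0 gA fB.
pose K x := fejer N (fun k => cosm k x * fcos k g + sinm k x * fsin k g).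
have cgc k : continuous (fun y => g y * cosm k y).
  by move=> y; apply: cont_mul; [exact: cg|exact: cosm_cont].
have cgs k : continuous (fun y => g y * sinm k y).
  by move=> y; apply: cont_mul; [exact: cg|exact: sinm_cont].
have cK : continuous K.
  move=> x; apply: cont_fejer => k; apply: cont_add; apply: cont_mul; try exact: cont_cst.
    exact: cosm_cont.
  exact: sinm_cont.
have KE x : K x = torus_int (fun y => g y * fejer_kernel N (x - y)).
  transitivity (torus_int (fun y => fejer N (fun k =>
      cosm k x * (g y * cosm k y) + sinm k x * (g y * sinm k y)))).
    rewrite torus_int_fejer.
      apply: eq_fejer => k; rewrite torus_intD ?torus_intZ//.
        by move=> y; apply: cont_mul; [exact: cont_cst|exact: cgc].
      by move=> y; apply: cont_mul; [exact: cont_cst|exact: cgs].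
    move=> k y; apply: cont_add; apply: cont_mul; try exact: cont_cst.
      exact: cgc.
    exact: cgs.
  apply: eq_torus_int => y _; rewrite -fejerZ; apply: eq_fejer => k.
  by rewrite cosm_expand; ring.
have Kg x : cube x -> `|K x - g x| <= e + A * (3 / N.+1%:R).
  move=> cx.
  have ck := @cont_kernel_shift N x.
  have -> : K x - g x = torus_int (fun y => (g y - g x) * fejer_kernel N (x - y)).
    under [X in _ = torus_int X]eq_fun do rewrite mulrBl.
    rewrite torus_intB; last 2 first.
    - by move=> y; apply: cont_mul; [exact: cg|exact: ck].
    - by move=> y; apply: cont_mul; [exact: cont_cst|exact: ck].
    by rewrite torus_intZ// torus_int_kernel mulr1 -KE.
  pose M y := fejer_kernel N (x - y) * (e + A * \sum_i (1 - cosm (unit_mode i) (x - y))).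
  have cS i : continuous (fun y => fejer_kernel N (x - y) * (1 - cosm (unit_mode i) (x - y))).
    move=> y; apply: cont_mul; first exact: ck.
    by apply: cont_sub; [exact: cont_cst|exact: cont_cosm_shift].
  have cM : continuous M.
    move=> y; apply: cont_mul; first exact: ck.
    apply: cont_add; first exact: cont_cst.
    apply: cont_mul; first exact: cont_cst.
    apply: cont_sum => i.
    by apply: cont_sub; [exact: cont_cst|exact: cont_cosm_shift].
  have MI : torus_int M = e + A * (3 / N.+1%:R).
    transitivity (torus_int (fun y => e * fejer_kernel N (x - y) + A *
        \sum_i fejer_kernel N (x - y) * (1 - cosm (unit_mode i) (x - y)))).
      by apply: eq_torus_int => y _; rewrite -mulr_sumr /M; ring.
    rewrite torus_intD; last 2 first.
    - by move=> y; apply: cont_mul; [exact: cont_cst|exact: ck].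
    - move=> y; apply: cont_mul; [exact: cont_cst|apply: cont_sum => i; exact: cS].
    rewrite (torus_intZ e ck) (torus_intZ A); last by move=> y; apply: cont_sum => i; exact: cS.
    rewrite torus_int_kernel mulr1 torus_int_sum//; congr (_ + _ * _).
    rewrite (eq_bigr (fun=> N.+1%:R^-1)) => [|i _]; last exact: torus_int_kernel_moment.
    by rewrite sumr_const card_ord -[LHS]mulr_natl.
  have cI : continuous (fun y => (g y - g x) * fejer_kernel N (x - y)).
    move=> y; apply: cont_mul; last exact: ck.
    by apply: cont_sub; [exact: cg|exact: cont_cst].
  rewrite -MI ler_norml; apply/andP; split.
    rewrite -mulN1r -torus_intZ//; apply: le_torus_int => //.
      by move=> y; apply: cont_mul; [exact: cont_cst|exact: cM].
    move=> y cy; rewrite mulN1r /M mulrC -mulNr ler_wpM2r ?fejer_kernel_ge0//.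
    by have := gA x y cx cy; rewrite ler_norml => /andP[].
  apply: le_torus_int => // y cy; rewrite /M mulrC ler_wpM2l ?fejer_kernel_ge0//.
  by have := gA x y cx cy; rewrite ler_norml => /andP[].
have cfc k : continuous (fun y => f y * cosm k y).
  by move=> y; apply: cont_mul; [exact: cf|exact: cosm_cont].
have cfs k : continuous (fun y => f y * sinm k y).
  by move=> y; apply: cont_mul; [exact: cf|exact: sinm_cont].
have -> : fejer N (fprod f g) = torus_int (fun x => f x * K x).
  transitivity (torus_int (fun x => fejer N (fun k =>
      fcos k g * (f x * cosm k x) + fsin k g * (f x * sinm k x)))).
    rewrite torus_int_fejer.
      apply: eq_fejer => k; rewrite torus_intD ?torus_intZ//.
      - by rewrite /fprod [X in X + _]mulrC [X in _ + X]mulrC.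
      - by move=> y; apply: cont_mul; [exact: cont_cst|exact: cfc].
      - by move=> y; apply: cont_mul; [exact: cont_cst|exact: cfs].
    move=> k y; apply: cont_add; apply: cont_mul; try exact: cont_cst.
      exact: cfc.
    exact: cfs.
  apply: eq_torus_int => y _; rewrite -fejerZ; apply: eq_fejer => k; ring.
rewrite -torus_intB; last 2 first.
- by move=> x; apply: cont_mul; [exact: cf|exact: cK].
- by move=> x; apply: cont_mul; [exact: cf|exact: cg].
set c := e + _; have cI : continuous (fun x => f x * K x - f x * g x).
  by move=> x; apply: cont_sub; apply: cont_mul; solve [exact: cf|exact: cK|exact: cg].
have cc a : continuous (fun _ : point3 R => a : R) by move=> x; exact: cont_cst.
have pt x : cube x -> `|f x * K x - f x * g x| <= B * c.
  by move=> cx; rewrite -mulrBr normrM ler_pM// ?fB// ?Kg.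
rewrite ler_norml; apply/andP; split.
  rewrite -[X in X <= _]torus_int_cst; apply: le_torus_int => // x /pt.
  by rewrite ler_norml => /andP[].
rewrite -[X in _ <= X]torus_int_cst; apply: le_torus_int => // x /pt.
by rewrite ler_norml => /andP[].
Qed.

End fejer_approximation.

(** * Fourier coefficients of derivatives *)

Section spectral_inequalities.
Context {R : realType}.
Implicit Types (f g : point3 R -> R) (k : 'I_3 -> int).

Definition periodic3 f := forall x i, f (x + unit_vec R i) = f x.

Lemma fcos_derive k f g i : continuous f -> continuous g -> periodic3 f ->
  (forall x : point3 R, is_derive x (unit_vec R i) f (g x)) ->
  fcos k g = 2 * pi * (k i)%:~R * fsin k f.
Proof.
move=> cf cg pf df; set c := 2 * pi * _.
have cgc : continuous (fun x => g x * cosm k x).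
  by move=> x; apply: cont_mul; [exact: cg|exact: cosm_cont].
have cfs : continuous (fun x => f x * sinm k x).
  by move=> x; apply: cont_mul; [exact: cf|exact: sinm_cont].
apply/eqP; rewrite -subr_eq0 /fcos /fsin -torus_intZ// -torus_intB//; last first.
  by move=> x; apply: cont_mul; [exact: cont_cst|exact: cfs].
apply/eqP/(@torus_int_derive_eq0 _ (fun x => f x * cosm k x) _ i).
- move=> x; apply: (is_derive_eq (is_derive_prod (df x) (is_derive_cosm k x i))).
  by rewrite -/c; ring.
- by move=> x; apply: cont_sub; [exact: cgc|apply: cont_mul; [exact: cont_cst|exact: cfs]].
- by move=> x; rewrite pf cosm_periodic.
Qed.

Lemma fsin_derive k f g i : continuous f -> continuous g -> periodic3 f ->
  (forall x : point3 R, is_derive x (unit_vec R i) f (g x)) ->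
  fsin k g = - (2 * pi * (k i)%:~R * fcos k f).
Proof.
move=> cf cg pf df; set c := 2 * pi * _.
have cgc : continuous (fun x => g x * sinm k x).
  by move=> x; apply: cont_mul; [exact: cg|exact: sinm_cont].
have cfs : continuous (fun x => f x * cosm k x).
  by move=> x; apply: cont_mul; [exact: cf|exact: cosm_cont].
apply/eqP; rewrite -addr_eq0 /fcos /fsin -torus_intZ// -torus_intD//; last first.
  by move=> x; apply: cont_mul; [exact: cont_cst|exact: cfs].
apply/eqP/(@torus_int_derive_eq0 _ (fun x => f x * sinm k x) _ i).
- move=> x; apply: (is_derive_eq (is_derive_prod (df x) (is_derive_sinm k x i))).
  by rewrite -/c; ring.
- by move=> x; apply: cont_add; [exact: cgc|apply: cont_mul; [exact: cont_cst|exact: cfs]].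
- by move=> x; rewrite pf sinm_periodic.
Qed.

Lemma cos2pi_lt1 (s : R) : 0 < s < 1 -> cos (2 * pi * s) < 1.
Proof.
move=> /andP[s0 s1].
have -> : 2 * pi * s = (pi * s) *+ 2 by rewrite -[RHS]mulr_natl mulrA.
rewrite cos_mulr2n.
have h : 0 < sin (pi * s).
  apply: sin_gt0_pi; rewrite mulr_gt0 ?pi_gt0//= -[ltRHS]mulr1 ltr_pM2l ?pi_gt0//.
have := cos2Dsin2 (pi * s); have : 0 < sin (pi * s) ^+ 2 by rewrite exprn_gt0.
by rewrite mulr2n; lra.
Qed.

Lemma cosm_unit_modeE i (x : point3 R) : cosm (unit_mode i) x = cos (2 * pi * crd x i).
Proof.
rewrite /cosm /phase (bigD1 i)//= /unit_mode eqxx mul1r big1 ?addr0// => j ji.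
by rewrite eq_sym (negbTE ji) mul0r.
Qed.

Lemma cosm_le1 k (x : point3 R) : cosm k x <= 1.
Proof. exact: cos_le1. Qed.

Lemma cos2pi_eq1 (a b : R) : 0 <= a <= 1 -> 0 <= b <= 1 -> cos (2 * pi * (a - b)) = 1 ->
  [\/ a = b, a = b + 1 | b = a + 1].
Proof.
move=> /andP[a0 a1] /andP[b0 b1] h.
have [->|ab] := eqVneq a b; first by constructor 1.
have [lt|ge] := ltP a b.
  have : ~~ (0 < b - a < 1).
    apply/negP => /cos2pi_lt1; rewrite -opprB mulrN cosN h ltxx//.
  rewrite subr_gt0 lt/= -leNgt => ba; constructor 3; lra.
have {}ge : b < a by rewrite lt_neqAle eq_sym ab.
have : ~~ (0 < a - b < 1) by apply/negP => /cos2pi_lt1; rewrite h ltxx.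
rewrite subr_gt0 ge/= -leNgt => ba; constructor 2; lra.
Qed.

(** On the closed cube, points at zero trigonometric distance differ by a vector
    with entries in [{-1, 0, 1}]. *)
Lemma periodic_eq f (x y : point3 R) : periodic3 f -> cube x -> cube y ->
  (forall i, cosm (unit_mode i) (x - y) = 1) -> f x = f y.
Proof.
move=> pf; move: x y => [[x0 x1] x2] [[y0 y1] y2].
move=> [[/= hx0 hx1] hx2] [[/= hy0 hy1] hy2] h.
have step0 (a b c : R) : f ((a + 1, b), c) = f ((a, b), c).
  rewrite -[RHS](pf _ (Ordinal (isT : (0 < 3)%N))); congr (f ((_, _), _)) => /=; by rewrite addr0.
have step1 (a b c : R) : f ((a, b + 1), c) = f ((a, b), c).
  rewrite -[RHS](pf _ (Ordinal (isT : (1 < 3)%N))); congr (f ((_, _), _)) => /=; by rewrite addr0.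
have step2 (a b c : R) : f ((a, b), c + 1) = f ((a, b), c).
  rewrite -[RHS](pf _ (Ordinal (isT : (2 < 3)%N))); congr (f ((_, _), _)) => /=; by rewrite addr0.
have := h (Ordinal (isT : (0 < 3)%N)); have := h (Ordinal (isT : (1 < 3)%N)).
have := h (Ordinal (isT : (2 < 3)%N)); rewrite !cosm_unit_modeE !crdD !crdN /crd/=.
move=> /cos2pi_eq1 h2 /cos2pi_eq1 h1 /cos2pi_eq1 h0.
transitivity (f ((y0, x1), x2)).
  by have [||->|->|->] := h0; rewrite ?step0 -?in_itv.
transitivity (f ((y0, y1), x2)).
  by have [||->|->|->] := h1; rewrite ?step1 -?in_itv.
by have [||->|->|->] := h2; rewrite ?step2 -?in_itv.
Qed.

End spectral_inequalities.

(** * Uniform Fejer approximation and Poincare's inequality *)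

Section uniform_fejer.
Context {R : realType}.
Implicit Types (f g : spacetime R -> R).

(** Freezing time at its initial value extends a function continuous on the closed
    half-space to the whole space. *)
Lemma clamp_continuous f : cont_closed f ->
  continuous (fun z : spacetime R => f (Num.max z.1 0, z.2)).
Proof.
move=> cf z; have m0 (s : R) : 0 <= Num.max s 0 by rewrite le_max lexx orbT.
apply: (@cvg_comp _ _ _ (fun z : spacetime R => (Num.max z.1 0, z.2)) f _ _ _ _
  (@cont_closed_cvg _ f (Num.max z.1 0) z.2 cf (m0 z.1))).
have h : (Num.max y.1 0, y.2) @[y --> z] --> ((Num.max z.1 0, z.2) : spacetime R).
  apply: cvg_pairT; last exact: cvg_snd.
  apply: (@cvg_comp _ _ _ (fun z : spacetime R => z.1) (fun s : R => Num.max s 0) _ (nbhs z.1)).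
    exact: cvg_fst.
  exact: (@continuous_max _ _ (fun s : R => s) (fun=> 0) z.1 cvg_id (cvg_cst _)).
move=> B; rewrite {1}/nbhs/= /within/= => /h hB.
change (\forall y \near z, B (Num.max y.1 0, y.2)).
have hB' : \forall y \near z, 0 <= Num.max y.1 0 -> B (Num.max y.1 0, y.2) := hB.
by apply: filterS hB' => y; apply; exact: m0.
Qed.

(** A continuous periodic function has a modulus of continuity in terms of the
    trigonometric distance that vanishes exactly on the diagonal of the torus. *)
Lemma trigonometric_modulus f (T e : R) : cont_closed f -> Defs.periodic f -> 0 < e ->
  exists2 A : R, 0 <= A & forall t x y, 0 <= t <= T -> cube x -> cube y ->
    `|f (t, y) - f (t, x)| <= e + A * \sum_i (1 - cosm (unit_mode i) (x - y)).
Proof.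
move=> cf pf e0.
pose F (z : spacetime R) := f (Num.max z.1 0, z.2).
have cF : continuous F by exact: clamp_continuous.
pose X := (R * (point3 R * point3 R))%type.
pose K : set X := `[0, T] `*` (@cube R `*` @cube R).
have cK : compact K.
  apply: compact_setX; first exact: segment_compact.
  by apply: compact_setX; exact: cube_compact.
pose psi (p : X) := `|F (p.1, p.2.2) - F (p.1, p.2.1)|.
pose phi (p : X) := \sum_i (1 - cosm (unit_mode i) (p.2.1 - p.2.2)).
have c1 : continuous (fun p : X => p.1) by move=> ?; exact: cvg_fst.
have c2 : continuous (fun p : X => p.2) by move=> ?; exact: cvg_snd.
have c21 : continuous (fun p : X => p.2.1).
  by move=> p; apply: (continuous_comp (c2 p)); exact: cvg_fst.
have c22 : continuous (fun p : X => p.2.2).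
  by move=> p; apply: (continuous_comp (c2 p)); exact: cvg_snd.
have cFp (h : X -> point3 R) : continuous h -> continuous (fun p => F (p.1, h p)).
  move=> ch p; apply: (@cvg_comp _ _ _ (fun p => (p.1, h p)) F _ _ _ _ (cF (p.1, h p))).
  by apply: cvg_pairT; [exact: c1|exact: ch].
have cpsi : continuous psi.
  move=> p; apply: (@cont_comp _ _ (fun p => F (p.1, p.2.2) - F (p.1, p.2.1)) (fun a => `|a|)).
    by apply: cont_sub; apply: cFp.
  exact: norm_continuous.
have cphi : continuous phi.
  move=> p; apply: cont_sum => i; apply: cont_sub; first exact: cont_cst.
  rewrite (_ : (fun p : X => cosm (unit_mode i) (p.2.1 - p.2.2)) = fun p : X =>
    cosm (unit_mode i) p.2.1 * cosm (unit_mode i) p.2.2 +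
    sinm (unit_mode i) p.2.1 * sinm (unit_mode i) p.2.2); last first.
    by apply/funext => q; exact: cosm_expand.
  apply: cont_add; apply: cont_mul.
  - by apply: (continuous_comp (c21 p)); exact: cosm_cont.
  - by apply: (continuous_comp (c22 p)); exact: cosm_cont.
  - by apply: (continuous_comp (c21 p)); exact: sinm_cont.
  - by apply: (continuous_comp (c22 p)); exact: sinm_cont.
have phi0 p : 0 <= phi p.
  by apply: sumr_ge0 => i _; rewrite subr_ge0 cosm_le1.
(* Where the oscillation [psi] is at least [e], the distance [phi] has a positive
   minimum by periodicity, and [A] is the maximum of [psi] over that minimum. *)
pose K' := K `&` [set p | e <= psi p].
have cK' : compact K'.
  apply: compact_closedI => //.
  exact: (@preimage_closed _ _ psi [set s : R | e <= s] (fun p _ => cpsi p) (@closed_ge _ e)).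
have inK t x y : 0 <= t <= T -> cube x -> cube y -> K (t, (x, y)).
  by move=> tT cx cy; split => //=; rewrite in_itv.
have psiE t x y : 0 <= t <= T -> psi (t, (x, y)) = `|f (t, y) - f (t, x)|.
  by move=> /andP[t0 _]; rewrite /psi /F/= max_l.
have [K'0|] := eqVneq K' set0.
  exists 0 => // t x y tT cx cy; rewrite mul0r addr0 leNgt; apply/negP => lt.
  suff : K' (t, (x, y)) by rewrite K'0.
  by split; [exact: inK|rewrite /= psiE// ltW].
move=> /set0P K'0.
have [p0 /set_mem[Kp0 ep0] minp0] := compact_EVT_min K'0 cK' (continuous_subspaceT cphi).
have [p1 _ maxp1] := compact_EVT_max K'0 cK' (continuous_subspaceT cpsi).
have phip0 : 0 < phi p0.
  rewrite lt_neqAle phi0 andbT eq_sym; apply/eqP => p00.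
  have E i : cosm (unit_mode i) (p0.2.1 - p0.2.2) = 1.
    have := p00; rewrite /phi => /eqP; rewrite psumr_eq0 => [/allP/(_ i)|j _].
      by rewrite mem_index_enum => /(_ isT); rewrite subr_eq0 => /eqP.
    by rewrite subr_ge0 cosm_le1.
  case: Kp0 => /=; rewrite in_itv/= => tT [cx cy].
  move: ep0 => /=; case: p0 {minp0 p00} E tT cx cy => t [x y] /= E tT cx cy.
  rewrite psiE// (@periodic_eq _ (fun x => f (t, x)) x y) ?subrr ?normr0 ?leNgt ?e0//.
  by move=> z i; apply: pf; case/andP: tT.
have q0 : 0 <= psi p1 / phi p0 by rewrite divr_ge0 ?normr_ge0// ltW.
exists (psi p1 / phi p0) => //.
move=> t x y tT cx cy; rewrite -psiE//.
have [lt|ge] := ltP (psi (t, (x, y))) e.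
  by rewrite (le_trans (ltW lt))// lerDl mulr_ge0//; exact: phi0 (t, (x, y)).
have K'z : (t, (x, y)) \in K' by apply/mem_set; split => //; exact: inK.
rewrite (le_trans (maxp1 _ K'z))// -[leLHS](divfK (lt0r_neq0 phip0)).
by apply: (ler_wpDl (ltW e0)); rewrite ler_wpM2l//; exact: (minp0 _ K'z).
Qed.

(** The rate in [fejer_approx] depends on [g] only through its modulus of
    continuity, which is uniform on a compact time interval. *)
Lemma fejer_uniform f g (T B eta : R) : cont_closed f -> cont_closed g -> Defs.periodic g ->
  (forall t x, 0 <= t <= T -> cube x -> `|f (t, x)| <= B) -> 0 < eta ->
  exists N0, forall N, (N0 <= N)%N -> forall t, 0 <= t <= T ->
    `|fejer N (fprod (fun x => f (t, x)) (fun x => g (t, x))) -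
      torus_int (fun x => f (t, x) * g (t, x))| <= eta.
Proof.
move=> cf cg pg fB eta0.
pose B' := `|B| + 1; have B'0 : 0 < B' by rewrite ltr_wpDl.
have e0 : 0 < eta / (2 * B') by rewrite divr_gt0// mulr_gt0.
have [A A0 hA] := trigonometric_modulus T cg pg e0.
pose d := eta / (2 * B') / (3 * (A + 1)).
have d0 : 0 < d by rewrite divr_gt0// mulr_gt0// ltr_wpDl.
have [N0 _ hN0] := near_infty_natSinv_lt (PosNum d0).
exists N0 => N NN t tT; have t0 : 0 <= t by case/andP: tT.
have := @fejer_approx _ N (fun x => f (t, x)) (fun x => g (t, x)) (eta / (2 * B')) A B'
  (slice_continuous_closed cf t0) (slice_continuous_closed cg t0) A0.
move=> /(_ (fun x y cx cy => hA t x y tT cx cy)) h.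
apply: (le_trans (h _)) => [x cx|].
  by rewrite (le_trans (fB _ _ tT cx))// /B' (le_trans (ler_norm _))// lerDl.
have hd : A * (3 / N.+1%:R) <= eta / (2 * B').
  have /ltW := hN0 N NN; rewrite /= => hN.
  apply: (@le_trans _ _ ((A + 1) * (3 * d))).
    by apply: ler_pM; rewrite ?divr_ge0 ?lerDl ?ler_pM2l.
  by rewrite /d le_eqVlt; apply/orP; left; apply/eqP; field; rewrite !gt_eqF//= ltr_wpDl.
apply: (@le_trans _ _ (B' * (eta / (2 * B') + eta / (2 * B')))).
  by rewrite ler_pM2l// lerD2l.
by rewrite le_eqVlt; apply/orP; left; apply/eqP; field; rewrite gt_eqF.
Qed.

End uniform_fejer.

Section parseval_bounds.
Context {R : realType}.
Implicit Types (f g : point3 R -> R).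

Lemma cont_closed_space f : continuous f -> cont_closed (fun z => f z.2).
Proof.
move=> cf; apply: continuous_subspaceT => z.
by apply: (@continuous_comp _ _ _ snd f); [exact: cvg_snd|exact: cf].
Qed.

(** Half of Parseval's identity: bounds on all finite Fejer sums pass to the
    integral of the square. *)
Lemma torus_int_sqr_le f (B : R) : continuous f -> periodic3 f ->
  (forall N, fejer N (fprod f f) <= B) -> torus_int (fun x => f x ^+ 2) <= B.
Proof.
move=> cf pf h; apply/ler_addgt0Pr => e e0.
have cf' := cont_closed_space cf.
have [M [Mr hM]] := compact_bounded_fun (@cube_compact R) (continuous_subspaceT cf).
have pf' : Defs.periodic (fun z => f z.2) by move=> t x i t0 /=; exact: pf.
have fM (t : R) x : 0 <= t <= 0 -> cube x -> `|f (t, x).2| <= M + 1.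
  by move=> _ cx; apply: hM => //; rewrite ltrDl.
have [N0 hN] := fejer_uniform cf' cf' pf' fM e0.
have := hN N0 (leqnn _) 0; rewrite lexx => /(_ isT).
rewrite ler_norml => /andP[+ _] /=.
have -> : torus_int (fun x => f x * f x) = torus_int (fun x => f x ^+ 2).
  by apply: eq_torus_int => x _; rewrite expr2.
by have := h N0; lra.
Qed.

(** The spectral gap: a nonzero integer vector has length at least one. *)
Lemma sqr_phase_ge1 (k : 'I_3 -> int) : ~~ mode0 k ->
  1 <= (2 * pi) ^+ 2 * \sum_j (k j)%:~R ^+ 2 :> R.
Proof.
rewrite /mode0 => /forallPn[i ki].
have h1 : 1 <= (2 * pi) ^+ 2 :> R.
  rewrite exprn_ege1//; have := pi_ge2 R; lra.
have h2 : 1 <= \sum_j (k j)%:~R ^+ 2 :> R.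
  rewrite (bigD1 i)//= ler_wpDr ?sumr_ge0// => [j _|]; first exact: sqr_ge0.
  rewrite -rmorphXn/= -[1]/(1%:~R) ler_int.
  by move: ki; rewrite -sqrf_eq0; have := sqr_ge0 (k i); lia.
by apply: (le_trans h1); rewrite ler_peMr// sqr_ge0.
Qed.

(** Each nonzero mode of [w] is at most the corresponding mode of its gradient, by
    the spectral gap. *)
Lemma poincare (w : point3 R -> R) (dw : 'I_3 -> point3 R -> R) :
  continuous w -> (forall j, continuous (dw j)) -> periodic3 w ->
  (forall j (x : point3 R), is_derive x (unit_vec R j) w (dw j x)) ->
  torus_int (fun x => (w x - torus_int w) ^+ 2) <=
  \sum_j torus_int (fun x => dw j x ^+ 2).
Proof.
move=> cw cdw pw dwE; set a := torus_int w.
have ca : continuous (fun _ : point3 R => a) by move=> x; exact: cont_cst.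
apply: torus_int_sqr_le => [x|x i|N]; [exact: cont_sub|by rewrite pw|].
apply: (@le_trans _ _ (\sum_j fejer N (fprod (dw j) (dw j)))); last first.
  by apply: ler_sum => j _; exact: fejer_bessel.
rewrite -fejer_sum; apply: le_fejer => k.
rewrite /fprod fcosB// fsinB// fcos_cst fsin_cst subr0.
under eq_bigr => j _ do rewrite (fcos_derive k cw (cdw j) pw (dwE j))
  (fsin_derive k cw (cdw j) pw (dwE j)).
set C := fcos k w; set S := fsin k w.
rewrite (eq_bigr (fun j => (2 * pi) ^+ 2 * (k j)%:~R ^+ 2 * (C * C + S * S))) => [|j _];
  last by ring.
rewrite -mulr_suml -mulr_sumr.
have P0 : 0 <= C * C + S * S by rewrite addr_ge0// -expr2 sqr_ge0.
have [k0|k0] := boolP (mode0 k).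
  have -> : C = a by exact: fcos_mode0.
  have -> : S = 0 by exact: fsin_mode0.
  have K0 : 0 <= (2 * pi) ^+ 2 * \sum_j (k j)%:~R ^+ 2 :> R.
    by rewrite mulr_ge0 ?sqr_ge0// sumr_ge0// => j _; exact: sqr_ge0.
  by rewrite mulr1 subrr !mulr0 !addr0 mulr_ge0// -expr2 sqr_ge0.
by rewrite mulr0 subr0 ler_peMl// sqr_phase_ge1.
Qed.

(** The divergence is controlled by the gradient with constant one, because
    [(k . a)^2 <= |k|^2 |a|^2] on each mode. *)
Lemma div_le_grad (w : 'I_3 -> point3 R -> R) (dw : 'I_3 -> 'I_3 -> point3 R -> R) :
  (forall i, continuous (w i)) -> (forall i j, continuous (dw i j)) ->
  (forall i, periodic3 (w i)) -> (forall i j, periodic3 (dw i j)) ->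
  (forall i j (x : point3 R), is_derive x (unit_vec R j) (w i) (dw i j x)) ->
  torus_int (fun x => (\sum_i dw i i x) ^+ 2) <=
  \sum_i \sum_j torus_int (fun x => dw i j x ^+ 2).
Proof.
move=> cw cdw pw pdw dwE.
apply: torus_int_sqr_le => [x|x j|N].
- by apply: cont_sum => i; exact: cdw.
- by apply: eq_bigr => i _; exact: pdw.
apply: (@le_trans _ _ (\sum_i \sum_j fejer N (fprod (dw i j) (dw i j)))); last first.
  by apply: ler_sum => i _; apply: ler_sum => j _; exact: fejer_bessel.
under eq_bigr do rewrite -fejer_sum.
rewrite -fejer_sum; apply: le_fejer => k.
have fc : fcos k (fun x => \sum_i dw i i x) = 2 * pi * \sum_i (k i)%:~R * fsin k (w i).
  transitivity (\sum_i fcos k (dw i i)).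
    rewrite /fcos -torus_int_sum; first by apply: eq_torus_int => x _; rewrite mulr_suml.
    by move=> i x; apply: cont_mul; [exact: cdw|exact: cosm_cont].
  rewrite mulr_sumr; apply: eq_bigr => i _.
  by rewrite (fcos_derive k (cw i) (cdw i i) (pw i) (dwE i i)) mulrA.
have fs : fsin k (fun x => \sum_i dw i i x) = - (2 * pi * \sum_i (k i)%:~R * fcos k (w i)).
  transitivity (\sum_i fsin k (dw i i)).
    rewrite /fsin -torus_int_sum; first by apply: eq_torus_int => x _; rewrite mulr_suml.
    by move=> i x; apply: cont_mul; [exact: cdw|exact: sinm_cont].
  rewrite mulr_sumr -sumrN; apply: eq_bigr => i _.
  by rewrite (fsin_derive k (cw i) (cdw i i) (pw i) (dwE i i)) mulrA.
rewrite /fprod fc fs.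
have cs (a b : 'I_3 -> R) :
    (\sum_i a i * b i) ^+ 2 <= \sum_i \sum_j (a j * b i) ^+ 2.
  rewrite !big_ord_recl !big_ord0/= !addr0.
  move: (a _) (a _) (a _) (b _) (b _) (b _) => a0 a1 a2 b0 b1 b2.
  have := sqr_ge0 (a0 * b1 - a1 * b0); have := sqr_ge0 (a0 * b2 - a2 * b0).
  have := sqr_ge0 (a1 * b2 - a2 * b1); lra.
have h1 := cs (fun i => (k i)%:~R) (fun i => fsin k (w i)).
have h2 := cs (fun i => (k i)%:~R) (fun i => fcos k (w i)).
apply: (@le_trans _ _ ((2 * pi) ^+ 2 * (\sum_i \sum_j ((k j)%:~R * fsin k (w i)) ^+ 2 +
      \sum_i \sum_j ((k j)%:~R * fcos k (w i)) ^+ 2))); last first.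
  rewrite le_eqVlt; apply/orP; left; apply/eqP.
  rewrite -big_split/= mulr_sumr; apply: eq_bigr => i _.
  rewrite -big_split/= mulr_sumr; apply: eq_bigr => j _.
  rewrite (fcos_derive k (cw i) (cdw i j) (pw i) (dwE i j)).
  by rewrite (fsin_derive k (cw i) (cdw i j) (pw i) (dwE i j)); ring.
have key (q a b c d : R) : a ^+ 2 <= b -> c ^+ 2 <= d ->
    q * a * (q * a) + - (q * c) * - (q * c) <= q ^+ 2 * (b + d).
  move=> ab cd; rewrite (_ : _ + _ = q ^+ 2 * (a ^+ 2 + c ^+ 2)); last by ring.
  by rewrite ler_wpM2l ?sqr_ge0// lerD.
exact: key h1 h2.
Qed.

End parseval_bounds.

(** * Power laws, entropy and Bregman divergences *)

Section clamped_power.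
Context {R : realType}.
Implicit Types a s : R.

(** The power function extended by zero to the negative half-line, where [powR]
    equals one.  With an exponent above one it is continuously differentiable on
    the whole line, so that vacuum needs no separate treatment. *)
Definition pospow a s := (Num.max s 0) `^ a.

Lemma pospowE a s : 0 <= s -> pospow a s = s `^ a.
Proof. by move=> s0; rewrite /pospow max_l. Qed.

Lemma pospow_le0 a s : 0 < a -> s <= 0 -> pospow a s = 0.
Proof. by move=> a0 s0; rewrite /pospow max_r// powR0// gt_eqF. Qed.

Lemma pospow_ge0 a s : 0 <= pospow a s.
Proof. exact: powR_ge0. Qed.

Lemma near_pospow a s : 0 < s -> \forall x \near s, x `^ a = pospow a x.
Proof.
by move=> s0; near=> x; rewrite pospowE// ltW//; near: x; exact: lt_nbhsr.
Unshelve. all: by end_near. Qed.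

Lemma pospow_continuous a : 0 < a -> continuous (pospow a).
Proof.
move=> a0 s; have [s0|s0|->] := ltgtP s 0.
- have : continuous_at s (fun=> 0 : R) by exact: cont_cst.
  rewrite /continuous_at pospow_le0 ?ltW//; apply: cvg_trans; apply: near_eq_cvg.
  by near=> x; rewrite pospow_le0// ltW//; near: x; exact: lt_nbhsl.
- have : continuous_at s (fun x => x `^ a).
    apply: differentiable_continuous; apply/derivable1_diffP.
    by have [] := is_derive1_powR a s0.
  rewrite /continuous_at pospowE ?ltW//; apply: cvg_trans; apply: near_eq_cvg.
  by near=> x; rewrite pospowE// ltW//; near: x; exact: lt_nbhsr.
- rewrite /continuous_at pospow_le0//; apply/cvgrPdist_lt => e e0.
  have r0 : 0 < e `^ a^-1 by rewrite powR_gt0.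
  near=> x.
  rewrite sub0r normrN ger0_norm ?pospow_ge0//.
  have [x0|x0] := leP x 0; first by rewrite pospow_le0.
  have xr : x < e `^ a^-1.
    by near: x; exact: lt_nbhsl r0.
  rewrite pospowE ?ltW//.
  have := gt0_ltr_powR a0; move=> /(_ x (e `^ a^-1)).
  by rewrite !nnegrE !ltW// -powRrM mulVf ?gt_eqF// powRr1 ?ltW//; apply.
Unshelve. all: by end_near. Qed.

Lemma is_derive_pospow a s : 1 < a -> is_derive s 1 (pospow a) (a * pospow (a - 1) s).
Proof.
move=> a1; have a0 : 0 < a by rewrite (lt_trans _ a1).
have b0 : 0 < a - 1 by rewrite subr_gt0.
have [s0|s0|->] := ltgtP s 0.
- rewrite (pospow_le0 b0) ?ltW// mulr0.
  have e : \forall x \near s, 0 = pospow a x.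
    by near=> x; rewrite pospow_le0// ltW//; near: x; exact: lt_nbhsl.
  exact: (near_eq_is_derive e (@is_derive_const _ _ 0 s 1)).
- rewrite [pospow (a - 1) s]pospowE ?ltW//.
  exact: (near_eq_is_derive (near_pospow a s0) (is_derive1_powR a s0)).
- rewrite (pospow_le0 b0)// mulr0; apply/is_derive1_caratheodory.
  exists (pospow (a - 1)); split; last by rewrite pospow_le0.
  + move=> z; rewrite (@pospow_le0 a 0)// !subr0.
    have [z0|z0] := leP z 0; first by rewrite !pospow_le0// mul0r.
    by rewrite !pospowE ?ltW// mulrC mulr_powRB1// ltW.
  + exact: pospow_continuous.
Unshelve. all: by end_near. Qed.

End clamped_power.

Section scalar_inequalities.
Context {R : realType}.

Lemma ln_le_sub1 (x : R) : 0 < x -> ln x <= x - 1.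
Proof.
move=> x0; have := @le_ln1Dx R (x - 1).
rewrite (_ : 1 + (x - 1) = x); last by ring.
by apply; lra.
Qed.

Lemma ln_ge_1subV (x : R) : 0 < x -> 1 - x^-1 <= ln x.
Proof.
move=> x0; have := @ln_le_sub1 x^-1; rewrite invr_gt0 lnV ?posrE// => /(_ x0); lra.
Qed.

(** The mean value theorem on either side of [c], where [F] has its minimum. *)
Lemma ge0_of_derive_sign (F F' : R -> R) (a b c s : R) :
  (forall x, a <= x <= b -> is_derive x 1 F (F' x)) ->
  (forall x, a <= x <= b -> 0 <= F' x * (x - c)) ->
  a <= c <= b -> a <= s <= b -> F c = 0 -> 0 <= F s.
Proof.
move=> dF F's /andP[ac cb] /andP[as' sb] Fc0.
have cF x y : a <= x -> y <= b -> {within `[x, y], continuous F}.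
  move=> ax yb; apply: derivable_within_continuous => z; rewrite in_itv/= => /andP[xz zy].
  by have [] := dF z; rewrite ?(le_trans ax)// (le_trans zy).
have [cs|sc|<-] := ltgtP c s; last by rewrite Fc0.
- have dI x : x \in `]c, s[%R -> is_derive x 1 F (F' x).
    rewrite in_itv/= => /andP[cx xs]; apply: dF.
    by rewrite (le_trans ac (ltW cx)) (le_trans (ltW xs) sb).
  have [x] := MVT cs dI (cF c s ac sb).
  rewrite in_itv/= => /andP[cx xs]; rewrite Fc0 subr0 => ->.
  have := F's x; rewrite (le_trans ac (ltW cx)) (le_trans (ltW xs) sb) => /(_ isT).
  by rewrite pmulr_lge0 ?subr_gt0// => h; rewrite mulr_ge0// subr_ge0 ltW.
- have dI x : x \in `]s, c[%R -> is_derive x 1 F (F' x).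
    rewrite in_itv/= => /andP[cx xs]; apply: dF.
    by rewrite (le_trans as' (ltW cx)) (le_trans (ltW xs) cb).
  have [x] := MVT sc dI (cF s c as' cb).
  rewrite in_itv/= => /andP[sx xc]; rewrite Fc0 sub0r => e.
  have := F's x; rewrite (le_trans as' (ltW sx)) (le_trans (ltW xc) cb) => /(_ isT).
  rewrite nmulr_lge0 ?subr_lt0// => h; rewrite -oppr_le0 e.
  by rewrite mulr_le0_ge0// subr_ge0 ltW.
Qed.

Lemma is_derive_quadratic (c q x : R) :
  is_derive x 1 (fun y : R => q * (y - c) ^+ 2) (2 * q * (x - c)).
Proof.
have h : is_derive x 1 (fun y : R => y - c) 1.
  by apply: (is_derive_eq (is_derive_sub (is_derive_id _ _) (@is_derive_const _ _ c x _)));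
    rewrite subr0.
have h2 := is_derive_scal q (is_derive_prod h h).
rewrite (_ : (fun y : R => _) = fun y => q * ((y - c) * (y - c))).
  by apply: (is_derive_eq h2); ring.
by apply/funext => y; rewrite expr2.
Qed.

Section bregman.
Variables (g g' : R -> R) (a b c : R).
Hypothesis dg : forall x, a <= x <= b -> is_derive x 1 g (g' x).
Hypothesis cab : a <= c <= b.

Let B x := g x - g c - g' c * (x - c).

Let dB x : a <= x <= b -> is_derive x 1 B (g' x - g' c).
Proof.
move=> xab.
have h : is_derive x 1 (fun y : R => y - c) 1.
  by apply: (is_derive_eq (is_derive_sub (is_derive_id _ _) (@is_derive_const _ _ c x _)));
    rewrite subr0.
apply: (is_derive_eq (is_derive_sub (is_derive_sub (dg xab)
  (@is_derive_const _ _ (g c) x _)) (is_derive_scal (g' c) h))).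
by rewrite subr0 mulr1.
Qed.

Let Bc : B c = 0. Proof. by rewrite /B !subrr mulr0 subrr. Qed.

(** Bregman divergences inherit the monotonicity bounds of the derivative. *)
Lemma bregman_ge (q s : R) :
  (forall x, a <= x <= b -> q * (x - c) ^+ 2 <= (g' x - g' c) * (x - c)) ->
  a <= s <= b -> q / 2 * (s - c) ^+ 2 <= g s - g c - g' c * (s - c).
Proof.
move=> hg sab; rewrite -subr_ge0.
pose F x := B x - q / 2 * (x - c) ^+ 2; change (0 <= F s).
apply: (@ge0_of_derive_sign F (fun x => g' x - g' c - 2 * (q / 2) * (x - c)) a b c s _ _ cab sab).
- by move=> x xab; exact: (is_derive_sub (dB xab) (is_derive_quadratic c (q / 2) x)).
- by move=> x /hg h; lra.
- by rewrite /F Bc subrr expr0n/= mulr0 subrr.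
Qed.

Lemma bregman_le (q s : R) :
  (forall x, a <= x <= b -> (g' x - g' c) * (x - c) <= q * (x - c) ^+ 2) ->
  a <= s <= b -> g s - g c - g' c * (s - c) <= q / 2 * (s - c) ^+ 2.
Proof.
move=> hg sab; rewrite -subr_ge0.
pose F x := q / 2 * (x - c) ^+ 2 - B x; change (0 <= F s).
apply: (@ge0_of_derive_sign F (fun x => 2 * (q / 2) * (x - c) - (g' x - g' c)) a b c s _ _ cab sab).
- by move=> x xab; exact: (is_derive_sub (is_derive_quadratic c (q / 2) x) (dB xab)).
- by move=> x /hg h; lra.
- by rewrite /F Bc subrr expr0n/= mulr0 subrr.
Qed.

End bregman.

(** Below the point [1] and above it the slope is read off from the tangents of
    [exp] and [ln]; near [0], where the derivative of [x^a] may blow up, the distance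
    to [1] is at least [1/2] and the trivial bound suffices. *)
Lemma powR_slope1 (a X : R) : 0 < a -> 1 <= X ->
  exists q Q : R, [/\ 0 < q, 0 < Q & forall x, 0 <= x <= X ->
    q * (x - 1) ^+ 2 <= (x `^ a - 1) * (x - 1) <= Q * (x - 1) ^+ 2].
Proof.
move=> a0 X1; have X0 : 0 < X by rewrite (lt_le_trans _ X1).
have Xa0 : 0 < X `^ a by rewrite powR_gt0.
(* [q] is below the slopes [a / X] of the case [1 <= x] and [a / (1 + a)] of the
   case [x < 1]; the first summand of [Q] covers [1 <= x], the second [1/2 <= x < 1]
   and the third [x < 1/2]. *)
pose q := a / ((1 + a) * X); have q0 : 0 < q.
  by rewrite divr_gt0// mulr_gt0// addr_gt0.
have qX : q <= a / X.
  rewrite /q ler_pM2l// lef_pV2 ?posrE ?mulr_gt0 ?addr_gt0//.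
  by rewrite mulrDl mul1r lerDl mulr_ge0// ltW.
have qa : q <= a / (1 + a).
  rewrite /q ler_pM2l// lef_pV2 ?posrE ?mulr_gt0 ?addr_gt0//.
  by rewrite ler_peMr// addr_ge0// ltW.
have q1 : q <= 1.
  by rewrite (le_trans qa)// ler_pdivrMr ?addr_gt0// mul1r lerDr.
pose Q := X `^ a * a + 2 * a + 2; have Q0 : 0 < Q.
  by rewrite !addr_gt0// mulr_gt0.
have QX : X `^ a * a <= Q by rewrite /Q -addrA lerDl addr_ge0// mulr_ge0// ltW.
have Q2 : 2 <= Q by rewrite lerDr addr_ge0// mulr_ge0// ltW.
exists q, Q; split => // x /andP[x0 xX].
have [->|xn0] := eqVneq x 0.
  rewrite powR0 ?gt_eqF// !sub0r sqrrN expr1n !mulr1 mulrNN mulr1; lra.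
have {x0 xn0} x0 : 0 < x by rewrite lt_def xn0.
have xaE : x `^ a = expR (a * ln x) by rewrite /powR gt_eqF.
have lnu := ln_le_sub1 x0; have lnl := ln_ge_1subV x0.
have el (y : R) : 1 + y <= expR y by exact: expR_ge1Dx.
have eu (y : R) : expR y - 1 <= y * expR y.
  have := el (- y); rewrite expRN => h.
  have e0 := expR_gt0 y.
  have : (1 - y) * expR y <= (expR y)^-1 * expR y by rewrite ler_wpM2r// ltW.
  by rewrite mulVf ?gt_eqF// => h2; lra.
have [x1|x1] := leP 1 x.
  have d0 : 0 <= x - 1 by rewrite subr_ge0.
  have ln0 : 0 <= ln x by exact: ln_ge0.
  have low : q * (x - 1) <= x `^ a - 1.
    have h1 : a * ln x <= x `^ a - 1 by rewrite xaE lerBrDl el.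
    apply: le_trans h1; apply: (@le_trans _ _ (a / X * (x - 1))).
      by rewrite ler_wpM2r.
    rewrite -mulrA ler_pM2l//; apply: le_trans lnl.
    have -> : 1 - x^-1 = x^-1 * (x - 1) by field; rewrite gt_eqF.
    by rewrite ler_wpM2r// lef_pV2 ?posrE.
  have up : x `^ a - 1 <= Q * (x - 1).
    apply: (@le_trans _ _ (a * ln x * x `^ a)); first by rewrite xaE eu.
    apply: (@le_trans _ _ (a * (x - 1) * X `^ a)).
      apply: ler_pM; rewrite ?powR_ge0 ?mulr_ge0 ?(ltW a0)//.
        by rewrite ler_pM2l.
      by apply: ge0_ler_powR; rewrite ?nnegrE ?(ltW a0) ?(ltW x0) ?(ltW X0).
    by rewrite mulrAC [a * _]mulrC ler_wpM2r.
  by rewrite expr2 !mulrA !ler_wpM2r.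
have d0 : 0 < 1 - x by rewrite subr_gt0.
have ln0 : ln x <= 0 by apply: ln_le0; exact: ltW.
have low : q * (1 - x) <= 1 - x `^ a.
  have y0 : 0 <= a * (1 - x) by rewrite mulr_ge0// ltW.
  have h : x `^ a <= (1 + a * (1 - x))^-1.
    rewrite xaE -[leLHS]invrK lef_pV2 ?posrE ?invr_gt0 ?expR_gt0//; last first.
      by rewrite ltr_wpDr.
    rewrite -expRN; apply: le_trans (el _); rewrite lerD2l -mulrN ler_pM2l//; lra.
  apply: (@le_trans _ _ (1 - (1 + a * (1 - x))^-1)); last by rewrite lerD2l lerN2.
  have y1 : 0 < 1 + a * (1 - x) by rewrite ltr_wpDr.
  have -> : 1 - (1 + a * (1 - x))^-1 = a / (1 + a * (1 - x)) * (1 - x).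
    by field; rewrite gt_eqF.
  apply: ler_wpM2r; first exact: ltW.
  rewrite (le_trans qa)// ler_pM2l// lef_pV2 ?posrE ?y1 ?addr_gt0//.
  by rewrite lerD2l ler_piMr ?(ltW a0)// gerBl ltW.
have up : 1 - x `^ a <= Q * (1 - x).
  have [x2|x2] := leP (2^-1) x.
    have h1 : 1 - x `^ a <= - (a * ln x) by rewrite xaE; have := el (a * ln x); lra.
    apply: (le_trans h1); rewrite -mulrN.
    apply: (@le_trans _ _ (a * (2 * (1 - x)))).
      rewrite ler_pM2l//; apply: (@le_trans _ _ (x^-1 - 1)); first lra.
      have -> : x^-1 - 1 = x^-1 * (1 - x) by field; rewrite gt_eqF.
      apply: ler_wpM2r; first exact: ltW.
      rewrite -[leRHS]invrK lef_pV2 ?posrE ?invr_gt0//.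
    rewrite mulrA; apply: ler_wpM2r; first exact: ltW.
    by have := mulr_gt0 Xa0 a0; rewrite /Q; lra.
  apply: (@le_trans _ _ 1); first by rewrite gerBl powR_ge0.
  apply: (@le_trans _ _ (2 * (1 - x))); first lra.
  by rewrite ler_wpM2r// ltW.
have E1 : (x `^ a - 1) * (x - 1) = (1 - x `^ a) * (1 - x) by ring.
have E2 : (x - 1) ^+ 2 = (1 - x) * (1 - x) by ring.
by rewrite E1 E2 !mulrA !ler_wpM2r// ltW.
Qed.

(** The pressure is monotone with slopes bounded above and below on the range of
    the density, vacuum included; this follows from the point [1] by scaling. *)
Lemma powR_slope (a c M : R) : 0 < a -> 0 < c -> c <= M ->
  exists q Q : R, [/\ 0 < q, 0 < Q & forall s, 0 <= s <= M ->
    q * (s - c) ^+ 2 <= (pospow a s - pospow a c) * (s - c) <= Q * (s - c) ^+ 2].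
Proof.
move=> a0 c0 cM; have cn0 : c != 0 by rewrite gt_eqF.
have [|q [Q [q0 Q0 h]]] := @powR_slope1 a (M / c) a0; first by rewrite ler_pdivlMr// mul1r.
have k0 : 0 < c `^ a / c by rewrite divr_gt0// powR_gt0.
exists (c `^ a / c * q), (c `^ a / c * Q); split; [exact: mulr_gt0|exact: mulr_gt0|].
move=> s /andP[s0 sM].
have sE : s = c * (s / c) by rewrite mulrC divfK.
have := h (s / c); rewrite divr_ge0 ?(ltW c0)//= ler_pM2r ?invr_gt0// sM => /(_ isT).
set x := s / c => /andP[h1 h2].
have -> : (pospow a s - pospow a c) * (s - c) = c `^ a / c * (c ^+ 2 * ((x `^ a - 1) * (x - 1))).
  rewrite !pospowE ?(ltW c0)// [in LHS]sE -/x powRM ?(ltW c0)//.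
    by field; rewrite cn0.
  by rewrite /x divr_ge0// ltW.
have -> : s - c = c * (x - 1) by rewrite mulrBr mulr1 -sE.
have kc : 0 < c `^ a / c * c ^+ 2 by rewrite mulr_gt0// exprn_gt0.
have e z : c `^ a / c * z * (c * (x - 1)) ^+ 2 = c `^ a / c * c ^+ 2 * (z * (x - 1) ^+ 2) by ring.
by rewrite !e [X in _ <= X <= _]mulrA !(ler_pM2l kc) h1.
Qed.

Lemma entropy_slope (c M x : R) : 0 < c -> 0 < x -> c <= M -> x <= M ->
  M^-1 * (x - c) ^+ 2 <= (ln x - ln c) * (x - c).
Proof.
move=> c0 x0 cM xM; have M0 : 0 < M by exact: lt_le_trans cM.
rewrite -ln_div ?posrE//.
have [cx|xc] := leP c x.
  rewrite expr2 mulrA ler_wpM2r ?subr_ge0//.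
  have := @ln_ge_1subV (x / c); rewrite divr_gt0// => /(_ isT); apply: le_trans.
  have -> : 1 - (x / c)^-1 = x^-1 * (x - c) by field; rewrite !gt_eqF.
  by rewrite ler_wpM2r ?subr_ge0// lef_pV2 ?posrE.
have -> : (x - c) ^+ 2 = (c - x) * (c - x) by ring.
have -> : ln (x / c) * (x - c) = (- ln (x / c)) * (c - x) by ring.
have d0 : 0 <= c - x by rewrite subr_ge0 ltW.
rewrite mulrA ler_wpM2r//.
have := @ln_le_sub1 (x / c); rewrite divr_gt0// => /(_ isT) h.
apply: (@le_trans _ _ (c^-1 * (c - x))); first by rewrite ler_wpM2r// lef_pV2 ?posrE.
have -> : c^-1 * (c - x) = 1 - x / c by field; rewrite gt_eqF.
lra.
Qed.

(** The lower bound comes from the slope [M^-1] of [ln] on the range of densities,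
    the upper one from [ln y <= y - 1] at [y = s / c], which is finite at vacuum. *)
Lemma relative_entropy_bounds (c M s : R) : 0 < c -> 0 < s -> c <= M -> s <= M ->
  (2 * M)^-1 * (s - c) ^+ 2 <= s * ln s - c * ln c - (ln c + 1) * (s - c) <= c^-1 * (s - c) ^+ 2.
Proof.
move=> c0 s0 cM sM; have M0 : 0 < M by exact: lt_le_trans cM.
apply/andP; split; last first.
  have := @ln_le_sub1 (s / c); rewrite divr_gt0// => /(_ isT) h.
  have -> : s * ln s - c * ln c - (ln c + 1) * (s - c) = s * (ln s - ln c) - (s - c) by ring.
  rewrite -ln_div ?posrE//.
  apply: (@le_trans _ _ (s * (s / c - 1) - (s - c))); first by rewrite lerD2r ler_pM2l.
  by rewrite le_eqVlt; apply/orP; left; apply/eqP; field; rewrite gt_eqF.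
pose m := Num.min s c.
have m0 : 0 < m by rewrite lt_min s0 c0.
have dg x : m <= x <= M -> is_derive x 1 (fun x => x * ln x) (ln x + 1).
  move=> /andP[mx _]; have x0 : 0 < x by exact: lt_le_trans mx.
  apply: (is_derive_eq (is_derive_prod (is_derive_id _ _) (is_derive1_ln x0))).
  by rewrite mulr1 divff ?gt_eqF// addrC.
have sm : m <= s <= M by rewrite ge_min lexx/=.
have cm : m <= c <= M by rewrite ge_min lexx orbT/=.
have h x : m <= x <= M -> M^-1 * (x - c) ^+ 2 <= (ln x + 1 - (ln c + 1)) * (x - c).
  move=> /andP[mx xM]; have x0 : 0 < x by exact: lt_le_trans mx.
  by have := entropy_slope c0 x0 cM xM; lra.
rewrite (_ : (2 * M)^-1 = M^-1 / 2); last by rewrite invfM mulrC.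
exact: (bregman_ge dg cm h sm).
Qed.

(** The logarithm is weaker than any power: [ln (d^2) >= - 2 / d]. *)
Lemma small_log_bound (d M s : R) : 0 < d -> d <= 1 -> d ^+ 2 <= s -> s <= M -> 1 <= M ->
  `|d ^+ 2 * ln s| <= d * (M + 2).
Proof.
move=> d0 d1 ds sM M1; have d20 : 0 < d ^+ 2 by rewrite exprn_gt0.
have s0 : 0 < s by exact: lt_le_trans ds.
have d2d : d ^+ 2 <= d by rewrite expr2 ler_piMr// ltW.
have up : ln s <= M by have := ln_le_sub1 s0; lra.
have low : - (2 / d) <= ln s.
  have h : ln (d ^+ 2) <= ln s by rewrite ler_ln ?posrE.
  apply: le_trans h; rewrite lnXn// mulr2n.
  by have := ln_ge_1subV d0; lra.
rewrite ler_norml; apply/andP; split.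
  apply: (@le_trans _ _ (d ^+ 2 * - (2 / d))); last by rewrite ler_pM2l.
  have -> : d ^+ 2 * - (2 / d) = - (d * 2) by field; rewrite gt_eqF.
  by rewrite lerN2 ler_pM2l//; lra.
apply: (@le_trans _ _ (d ^+ 2 * M)); first by rewrite ler_pM2l.
apply: (@le_trans _ _ (d * M)); last by rewrite ler_pM2l//; lra.
by rewrite ler_wpM2r//; lra.
Qed.

End scalar_inequalities.

(** * Weak formulation of the equations of a fluid *)

Section spacetime_calculus.
Context {R : realType}.
Implicit Types (f g : spacetime R -> R) (v z : spacetime R).

Lemma cont_open_eq f g : (forall z, 0 < z.1 -> f z = g z) -> cont_open g -> cont_open f.
Proof.
move=> fg cg z z0; have h := cg z z0; rewrite /prop_for /continuous_at fg//.
apply: cvg_trans h; apply: near_eq_cvg.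
have : (fun y : spacetime R => y.1) y @[y --> z] --> z.1 by exact: cvg_fst.
move=> /(_ [set x | 0 < x] (lt_nbhsr z0)) h.
have pos : \forall y \near z, 0 < y.1 by exact: h.
by apply: filterS pos => y y0; rewrite fg.
Qed.

Lemma C1dir_intro v f (df : spacetime R -> R) :
  (forall z, 0 < z.1 -> is_derive z v f (df z)) -> cont_open df -> C1dir v f.
Proof.
move=> h c; split; first by move=> z /h[].
by apply: cont_open_eq c => z /h[].
Qed.

Lemma C1dir_is_derive v f z : C1dir v f -> 0 < z.1 -> is_derive z v f ('D_v f z).
Proof. by move=> [h _] z0; apply/derivableP/h. Qed.

Lemma C1dir_add v f g : C1dir v f -> C1dir v g -> C1dir v (fun z => f z + g z).
Proof.
move=> hf hg; apply: (@C1dir_intro _ _ (fun z => 'D_v f z + 'D_v g z)).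
  by move=> z z0; exact: (is_derive_add (C1dir_is_derive hf z0) (C1dir_is_derive hg z0)).
by move=> z z0; apply: cont_add; [exact: (hf.2 z)|exact: (hg.2 z)].
Qed.

Lemma C1dir_scal v (a : R) f : C1dir v f -> C1dir v (fun z => a * f z).
Proof.
move=> hf; apply: (@C1dir_intro _ _ (fun z => a * 'D_v f z)).
  by move=> z z0; exact: (is_derive_scal a (C1dir_is_derive hf z0)).
by move=> z z0; apply: cont_mul; [exact: cont_cst|exact: (hf.2 z)].
Qed.

Lemma C1dir_sub v f g : C1dir v f -> C1dir v g -> C1dir v (fun z => f z - g z).
Proof.
move=> hf hg; rewrite (_ : (fun z => _) = (fun z => f z + (- 1) * g z)).
  exact: (C1dir_add hf (C1dir_scal (- 1) hg)).
by apply/funext => z; rewrite mulN1r.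
Qed.

Lemma C1dir_cst v (a : R) : C1dir v (fun=> a).
Proof.
by apply: (@C1dir_intro _ _ (fun=> 0)) => z z0; exact: cont_cst.
Qed.

Lemma C1dir_mul v f g : cont_open f -> cont_open g -> C1dir v f -> C1dir v g ->
  C1dir v (fun z => f z * g z).
Proof.
move=> cf cg hf hg; apply: (@C1dir_intro _ _ (fun z => f z * 'D_v g z + g z * 'D_v f z)).
  by move=> z z0; exact: (is_derive_prod (C1dir_is_derive hf z0) (C1dir_is_derive hg z0)).
move=> z z0; apply: cont_add; apply: cont_mul;
  by [exact: (cf z)|exact: (cg z)|exact: (hf.2 z)|exact: (hg.2 z)].
Qed.

Lemma C1dir_comp v f (phi dphi : R -> R) : cont_open f -> C1dir v f ->
  (forall z, 0 < z.1 -> is_derive (f z) 1 phi (dphi (f z))) ->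
  (forall z, 0 < z.1 -> continuous_at (f z) dphi) ->
  C1dir v (fun z => phi (f z)).
Proof.
move=> cf hf hp cp; apply: (@C1dir_intro _ _ (fun z => dphi (f z) * 'D_v f z)).
  by move=> z z0; exact: (is_derive_compR (C1dir_is_derive hf z0) (hp z z0)).
move=> z z0; apply: cont_mul; last exact: (hf.2 z).
by apply: cont_comp; [exact: (cf z)|exact: cp].
Qed.

Lemma C1dir_sum v (I : Type) (r : seq I) (f : I -> spacetime R -> R) :
  (forall i, C1dir v (f i)) -> C1dir v (fun z => \sum_(i <- r) f i z).
Proof.
move=> h; elim: r => [|i r ih].
  rewrite (_ : (fun z => _) = fun=> 0); first exact: (C1dir_cst v 0).
  by apply/funext => z; rewrite big_nil.
rewrite (_ : (fun z => _) = fun z => f i z + \sum_(j <- r) f j z).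
  exact: (C1dir_add (h i) ih).
by apply/funext => z; rewrite big_cons.
Qed.

Record C1per f : Prop := {
  C1per_cont : cont_open f;
  C1per_per : periodic_open f;
  C1per_t : C1dir (1, 0) f;
  C1per_x : forall i, C1dir (0, unit_vec R i) f }.

Lemma C1per_cst (a : R) : C1per (fun=> a).
Proof.
split => // [z z0||i]; [exact: cont_cst|exact: (C1dir_cst (1, 0) a)|exact: (C1dir_cst (0, unit_vec R i) a)].
Qed.

Lemma C1per_add f g : C1per f -> C1per g -> C1per (fun z => f z + g z).
Proof.
move=> [cf pf tf xf] [cg pg tg xg]; split => [z z0|t x i t0||i].
- by apply: cont_add; [exact: cf|exact: cg].
- by rewrite pf// pg.
- exact: (C1dir_add tf tg).
- exact: (C1dir_add (xf i) (xg i)).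
Qed.

Lemma C1per_mul f g : C1per f -> C1per g -> C1per (fun z => f z * g z).
Proof.
move=> [cf pf tf xf] [cg pg tg xg]; split => [z z0|t x i t0||i].
- by apply: cont_mul; [exact: cf|exact: cg].
- by rewrite pf// pg.
- exact: (C1dir_mul cf cg tf tg).
- exact: (C1dir_mul cf cg (xf i) (xg i)).
Qed.

Lemma C1per_scal (a : R) f : C1per f -> C1per (fun z => a * f z).
Proof. by move=> hf; exact: (C1per_mul (C1per_cst a) hf). Qed.

Lemma C1per_sum (I : Type) (r : seq I) (f : I -> spacetime R -> R) :
  (forall i, C1per (f i)) -> C1per (fun z => \sum_(i <- r) f i z).
Proof.
move=> h; elim: r => [|i r ih].
  rewrite (_ : (fun z => _) = fun=> 0); first exact: (C1per_cst 0).
  by apply/funext => z; rewrite big_nil.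
rewrite (_ : (fun z => _) = fun z => f i z + \sum_(j <- r) f j z).
  exact: (C1per_add (h i) ih).
by apply/funext => z; rewrite big_cons.
Qed.

Lemma C1per_comp f (phi dphi : R -> R) : C1per f ->
  (forall z, 0 < z.1 -> is_derive (f z) 1 phi (dphi (f z))) ->
  (forall z, 0 < z.1 -> continuous_at (f z) dphi) ->
  C1per (fun z => phi (f z)).
Proof.
move=> [cf pf tf xf] hp cp; split => [z z0|t x i t0||i].
- apply: cont_comp; first exact: cf.
  by apply: differentiable_continuous; apply/derivable1_diffP; have [] := hp z z0.
- by rewrite pf.
- exact: (C1dir_comp cf tf hp cp).
- exact: (C1dir_comp cf (xf i) hp cp).
Qed.

(** Fourier modes enter the equations as test functions of this kind. *)
Lemma C1per_space (phi : point3 R -> R) (dphi : 'I_3 -> point3 R -> R) :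
  periodic3 phi -> continuous phi -> (forall i, continuous (dphi i)) ->
  (forall i (x : point3 R), is_derive x (unit_vec R i) phi (dphi i x)) ->
  [/\ C1per (fun z => phi z.2), forall z, dt (fun z => phi z.2) z = 0 &
      forall i z, dx i (fun z => phi z.2) z = dphi i z.2].
Proof.
move=> pp cp cdp dp.
have cs (h : point3 R -> R) : continuous h -> cont_open (fun z => h z.2).
  by move=> ch z _; apply: (@continuous_comp _ _ _ snd h); [exact: cvg_snd|exact: ch].
have dT (z : spacetime R) : is_derive z ((1, 0) : spacetime R) (fun z => phi z.2) 0.
  apply/is_derive_lineP.
  have -> : (fun s : R => phi (s *: ((1, 0) : spacetime R) + z).2) = fun=> phi z.2.
    by apply/funext => s; rewrite /= scaler0 add0r.
  exact: (@is_derive_const _ _ _ _ _).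
have dX i (z : spacetime R) :
    is_derive z ((0, unit_vec R i) : spacetime R) (fun z => phi z.2) (dphi i z.2).
  by apply/is_derive_lineP; have /is_derive_lineP := dp i z.2.
split; last 2 first.
- by move=> z; exact: (deriveE_is (dT z)).
- by move=> i z; exact: (deriveE_is (dX i z)).
split.
- exact: cs.
- by move=> t x i t0 /=; exact: pp.
- apply: (@C1dir_intro _ _ (fun=> 0) (fun z _ => dT z)) => z _.
  exact: cont_cst.
- by move=> i; exact: (C1dir_intro (fun z _ => dX i z) (cs _ (cdp i))).
Qed.

Lemma periodic_dx f i : periodic_open f -> periodic_open (dx i f).
Proof.
move=> pf t x j t0; pose v : spacetime R := (0, unit_vec R i).
have E : (fun s : R => s^-1 *: (f (s *: v + (t, x + unit_vec R j)) - f (t, x + unit_vec R j))) =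
         (fun s : R => s^-1 *: (f (s *: v + (t, x)) - f (t, x))).
  apply/funext => s.
  have -> : s *: v + (t, x + unit_vec R j) =
      (t, (s *: (unit_vec R i : point3 R) + x) + unit_vec R j).
    by congr (_, _); rewrite /= ?scaler0 ?add0r ?addrA.
  have -> : s *: v + (t, x) = (t, s *: (unit_vec R i : point3 R) + x).
    by congr (_, _); rewrite /= ?scaler0 ?add0r.
  by rewrite !pf.
by rewrite /dx /derive /comp /= E.
Qed.

Lemma dt_mul f g z : C1per f -> C1per g -> 0 < z.1 ->
  dt (fun z => f z * g z) z = f z * dt g z + g z * dt f z.
Proof.
move=> [_ _ hf _] [_ _ hg _] z0.
exact: (deriveE_is (is_derive_prod (C1dir_is_derive hf z0) (C1dir_is_derive hg z0))).
Qed.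

Lemma dx_mul i f g z : C1dir (0, unit_vec R i) f -> C1dir (0, unit_vec R i) g -> 0 < z.1 ->
  dx i (fun z => f z * g z) z = f z * dx i g z + g z * dx i f z.
Proof.
move=> hf hg z0.
exact: (deriveE_is (is_derive_prod (C1dir_is_derive hf z0) (C1dir_is_derive hg z0))).
Qed.

Lemma dx_add i f g z : C1dir (0, unit_vec R i) f -> C1dir (0, unit_vec R i) g -> 0 < z.1 ->
  dx i (fun z => f z + g z) z = dx i f z + dx i g z.
Proof.
move=> hf hg z0.
exact: (deriveE_is (is_derive_add (C1dir_is_derive hf z0) (C1dir_is_derive hg z0))).
Qed.

Lemma dx_sub i f g z : C1dir (0, unit_vec R i) f -> C1dir (0, unit_vec R i) g -> 0 < z.1 ->
  dx i (fun z => f z - g z) z = dx i f z - dx i g z.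
Proof.
move=> hf hg z0.
exact: (deriveE_is (is_derive_sub (C1dir_is_derive hf z0) (C1dir_is_derive hg z0))).
Qed.

Lemma dx_scal i (a : R) f z : C1dir (0, unit_vec R i) f -> 0 < z.1 ->
  dx i (fun z => a * f z) z = a * dx i f z.
Proof. by move=> hf z0; exact: (deriveE_is (is_derive_scal a (C1dir_is_derive hf z0))). Qed.

End spacetime_calculus.

Section fluid.
Context {R : realType}.

(** A compressible fluid with density [r], velocity [w], pressure [p], viscous
    stress [G] and body force [f]; both phases of the coupled system have this
    form. *)
Record fluid (r : spacetime R -> R) (w : 'I_3 -> spacetime R -> R) (p : spacetime R -> R)
    (G : 'I_3 -> 'I_3 -> spacetime R -> R) (f : 'I_3 -> spacetime R -> R) : Prop := {
  fl_r : C1per r;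
  fl_w : forall i, C1per (w i);
  fl_pc : cont_open p;
  fl_pp : periodic_open p;
  fl_px : forall i, C1dir (0, unit_vec R i) p;
  fl_Gc : forall i j, cont_open (G i j);
  fl_Gp : forall i j, periodic_open (G i j);
  fl_Gx : forall i j, C1dir (0, unit_vec R j) (G i j);
  fl_f : forall i, cont_open (f i);
  fl_mass : forall z, 0 < z.1 -> dt r z + \sum_j dx j (fun y => r y * w j y) z = 0;
  fl_mom : forall z i, 0 < z.1 ->
    dt (fun y => r y * w i y) z + \sum_j dx j (fun y => r y * w i y * w j y) z
    + dx i p z - \sum_j dx j (G i j) z = f i z }.

Variables (r : spacetime R -> R) (w : 'I_3 -> spacetime R -> R) (p : spacetime R -> R).
Variables (G : 'I_3 -> 'I_3 -> spacetime R -> R) (f : 'I_3 -> spacetime R -> R).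
Hypothesis fl : fluid r w p G f.
Variable phi : spacetime R -> R.
Hypothesis Cphi : C1per phi.
Hypothesis phit : forall z, dt phi z = 0.

Let Cr := fl_r fl.
Let Cw := fl_w fl.
Let Crw i : C1per (fun y => r y * w i y) := C1per_mul Cr (Cw i).
Let Crww i j : C1per (fun y => r y * w i y * w j y) := C1per_mul (Crw i) (Cw j).

Lemma fluid_mass_weak (t : R) : 0 < t ->
  is_derive t 1 (tint (fun z => r z * phi z))
    (tint (fun z => \sum_j r z * w j z * dx j phi z) t).
Proof.
move=> t0; apply: (@balance_law _ _ _ (fun j z => r z * w j z * phi z) _ _ _ _ _ _ t0).
- exact: (C1per_cont (C1per_mul Cr Cphi)).
- exact: (C1per_t (C1per_mul Cr Cphi)).
- by move=> j; exact: (C1per_per (C1per_mul (Crw j) Cphi)).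
- by move=> j; exact: (C1per_x (C1per_mul (Crw j) Cphi)).
move=> z z0; rewrite dt_mul// phit mulr0 add0r.
under eq_bigr => j _ do rewrite (dx_mul (C1per_x (Crw j) j) (C1per_x Cphi j) z0).
rewrite big_split/= -mulr_sumr addrCA -mulrDr (fl_mass fl z0) mulr0 addr0.
by [].
Qed.

Lemma fluid_momentum_weak i (t : R) : 0 < t ->
  is_derive t 1 (tint (fun z => r z * w i z * phi z))
    (tint (fun z => \sum_j (r z * w i z * w j z - G i j z) * dx j phi z
                    + p z * dx i phi z + f i z * phi z) t).
Proof.
move=> t0.
pose d j : R := (i == j)%:R.
pose X j z := ((r z * w i z * w j z - G i j z) + d j * p z) * phi z.
have XG j : C1dir (0, unit_vec R j) (fun z => r z * w i z * w j z - G i j z).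
  exact: (C1dir_sub (C1per_x (Crww i j) j) (fl_Gx fl i j)).
have Xp j : C1dir (0, unit_vec R j) (fun z => d j * p z).
  exact: (C1dir_scal (d j) (fl_px fl j)).
have XA j := C1dir_add (XG j) (Xp j).
have cG j : cont_open (fun z => r z * w i z * w j z - G i j z + d j * p z).
  move=> z z0; apply: cont_add; first apply: cont_sub.
  - exact: (C1per_cont (Crww i j)).
  - exact: (fl_Gc fl).
  - by apply: cont_mul; [exact: cont_cst|exact: (fl_pc fl)].
apply: (@balance_law _ _ _ X _ _ _ _ _ _ t0).
- exact: (C1per_cont (C1per_mul (Crw i) Cphi)).
- exact: (C1per_t (C1per_mul (Crw i) Cphi)).
- move=> j s x l s0; rewrite /X (C1per_per (Crww i j))// (fl_Gp fl)// (fl_pp fl)//.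
  by rewrite (C1per_per Cphi).
- by move=> j; exact: (C1dir_mul (cG j) (C1per_cont Cphi) (XA j) (C1per_x Cphi j)).
move=> z z0; rewrite dt_mul// phit mulr0 add0r.
have E j : dx j (X j) z = (r z * w i z * w j z - G i j z) * dx j phi z
    + d j * p z * dx j phi z
    + phi z * (dx j (fun y => r y * w i y * w j y) z - dx j (G i j) z + d j * dx j p z).
  rewrite (dx_mul (XA j) (C1per_x Cphi j) z0) (dx_add (XG j) (Xp j) z0).
  rewrite (dx_sub (C1per_x (Crww i j) j) (fl_Gx fl i j) z0) (dx_scal (d j) (fl_px fl j) z0).
  ring.
under eq_bigr do rewrite E.
have dsum (h : 'I_3 -> R) : \sum_j d j * h j = h i.
  rewrite (bigD1 i)//= /d eqxx mul1r big1 ?addr0// => j ji.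
  by rewrite eq_sym (negbTE ji) mul0r.
rewrite !big_split/= -mulr_sumr !big_split/= sumrN dsum.
under [X in _ + (_ + X + _)]eq_bigr do rewrite -mulrA.
rewrite dsum -(fl_mom fl i z0); ring.
Qed.

End fluid.

(** * The corrector: algebra of one mode *)

Section mode_algebra.
Context {R : realType}.

(** The coefficient [be] is absorbed in the square that is completed. *)
Lemma young (be e x y : R) : be ^+ 2 <= 1 -> 0 < e ->
  be * (x * y) <= (2 * e)^-1 * x ^+ 2 + e / 2 * y ^+ 2.
Proof.
move=> b1 e0; have h : 0 <= (2 * e)^-1 * (x - be * e * y) ^+ 2.
  by rewrite mulr_ge0 ?sqr_ge0// invr_ge0 mulr_ge0// ltW.
have h2 : be ^+ 2 * (e / 2 * y ^+ 2) <= e / 2 * y ^+ 2.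
  by rewrite ler_piMl// mulr_ge0 ?sqr_ge0// divr_ge0// ltW.
suff E : (2 * e)^-1 * (x - be * e * y) ^+ 2 =
    (2 * e)^-1 * x ^+ 2 - be * (x * y) + be ^+ 2 * (e / 2 * y ^+ 2) by lra.
by field; rewrite gt_eqF.
Qed.

Variables (c b : 'I_3 -> R) (n : R).
Hypothesis nE : n = \sum_j c j ^+ 2.
Hypothesis bE : forall i, b i = c i / n.

(** Galilean invariance: the drift [m] drops out of the evolution of the
    corrector, so only fluctuations of the velocity matter. *)
Lemma corrector_galilean (m Cq Sq Cf Sf : 'I_3 -> R) (CP SP : 'I_3 -> 'I_3 -> R)
    (Cr Sr Cp Sp : R) :
  let CT i j := CP i j + m i * Cq j + m i * m j * Cr + m j * Cq i in
  let ST i j := SP i j + m i * Sq j + m i * m j * Sr + m j * Sq i in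
  \sum_i b i * ((- (\sum_j c j * ST i j) - c i * Sp + Cf i) * Sr
     + (Cq i + m i * Cr) * (\sum_j c j * (Cq j + m j * Cr))
     - ((\sum_j c j * CT i j + c i * Cp + Sf i) * Cr
     + (Sq i + m i * Sr) * (- (\sum_j c j * (Sq j + m j * Sr)))))
  = \sum_i b i * (\sum_j c j * (Cq i * Cq j + Sq i * Sq j)
     - \sum_j c j * (SP i j * Sr + CP i j * Cr)
     - c i * (Cp * Cr + Sp * Sr) + (Cf i * Sr - Sf i * Cr)).
Proof.
move=> CT ST; apply: eq_bigr => i _; congr (_ * _).
rewrite !big_ord_recl !big_ord0 /CT /ST; ring.
Qed.

(** With [b_i = c_i / |c|^2] and [|c| >= 1], the factors [b_i] and [b_i c_j] are
    bounded by one, Young's inequality handles every product with the density, and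
    [\sum_i b_i c_i = 1] leaves the pressure term intact.  The constant [6] is
    [e/2] times the twelve products of the stress and the force. *)
Lemma corrector_mode_bound (Cq Sq Cf Sf : 'I_3 -> R) (CP SP : 'I_3 -> 'I_3 -> R)
    (Cr Sr Cp Sp e : R) : n = 0 \/ 1 <= n -> 0 < e ->
  \sum_i b i * (\sum_j c j * (Cq i * Cq j + Sq i * Sq j)
     - \sum_j c j * (SP i j * Sr + CP i j * Cr)
     - c i * (Cp * Cr + Sp * Sr) + (Cf i * Sr - Sf i * Cr))
  <= - (n != 0)%:R * (Cp * Cr + Sp * Sr) + \sum_i (Cq i * Cq i + Sq i * Sq i)
     + (2 * e)^-1 * (\sum_i \sum_j (CP i j * CP i j + SP i j * SP i j)
                     + \sum_i (Cf i * Cf i + Sf i * Sf i))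
     + 6 * e * ((n != 0)%:R * (Cr * Cr + Sr * Sr)).
Proof.
move=> n01 e0.
have sq2 (x y : R) : 0 <= x * x + y * y by rewrite addr_ge0// -expr2 sqr_ge0.
have [n0|n0] := eqVneq n 0.
  rewrite big1 => [|i _]; last by rewrite bE n0 invr0 mulr0 mul0r.
  rewrite mulr0n !mul0r mulr0 oppr0 mul0r add0r addr0.
  rewrite addr_ge0 ?sumr_ge0// mulr_ge0 ?invr_ge0 ?mulr_ge0 ?(ltW e0)//.
  by rewrite addr_ge0 ?sumr_ge0// => i _; exact: sumr_ge0.
have n1 : 1 <= n by case: n01 => // /eqP; rewrite (negbTE n0).
have np : 0 < n by exact: lt_le_trans n1.
rewrite mulr1n mul1r.
have c2n i : c i ^+ 2 <= n.
  by rewrite nE (bigD1 i)//= lerDl sumr_ge0// => j _; exact: sqr_ge0.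
have bc1 i j : (b i * c j) ^+ 2 <= 1.
  rewrite bE exprMn expr_div_n mulrAC ler_pdivrMr ?exprn_gt0// mul1r [leRHS]expr2.
  by rewrite ler_pM ?sqr_ge0.
have b1 i : (b i) ^+ 2 <= 1.
  rewrite bE expr_div_n ler_pdivrMr ?exprn_gt0// mul1r (le_trans (c2n i))//.
  by rewrite expr2 ler_peMr// ltW.
have T1 : \sum_i b i * (\sum_j c j * (Cq i * Cq j + Sq i * Sq j)) <=
    \sum_i (Cq i * Cq i + Sq i * Sq i).
  have cs (a : 'I_3 -> R) : (\sum_i c i * a i) ^+ 2 <= n * \sum_i a i * a i.
    rewrite nE !big_ord_recl !big_ord0/= !addr0.
    move: (c _) (c _) (c _) (a _) (a _) (a _) => c0 c1 c2 a0 a1 a2.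
    have := sqr_ge0 (c0 * a1 - c1 * a0); have := sqr_ge0 (c0 * a2 - c2 * a0).
    have := sqr_ge0 (c1 * a2 - c2 * a1); lra.
  have -> : \sum_i b i * (\sum_j c j * (Cq i * Cq j + Sq i * Sq j)) =
      n^-1 * ((\sum_i c i * Cq i) ^+ 2 + (\sum_i c i * Sq i) ^+ 2).
    under eq_bigr do rewrite bE.
    by rewrite !big_ord_recl !big_ord0; field.
  rewrite ler_pdivrMl// big_split/= mulrDr; exact: lerD.
have T2 i j : - (b i * (c j * (SP i j * Sr + CP i j * Cr))) <=
    (2 * e)^-1 * (CP i j * CP i j + SP i j * SP i j) + e / 2 * (Cr * Cr + Sr * Sr).
  have bc1' : (- (b i * c j)) ^+ 2 <= 1 by rewrite sqrrN.
  have := young (SP i j) Sr bc1' e0; have := young (CP i j) Cr bc1' e0.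
  by rewrite !expr2; lra.
have T3 i : b i * (Cf i * Sr - Sf i * Cr) <=
    (2 * e)^-1 * (Cf i * Cf i + Sf i * Sf i) + e / 2 * (Cr * Cr + Sr * Sr).
  have b1' : (- b i) ^+ 2 <= 1 by rewrite sqrrN.
  have := young (Cf i) Sr (b1 i) e0; have := young (Sf i) Cr b1' e0.
  by rewrite !expr2; lra.
have T4 : \sum_i b i * c i = 1.
  under eq_bigr do rewrite bE.
  rewrite -[RHS](divff n0) [X in _ = X / _]nE mulr_suml; apply: eq_bigr => i _.
  by rewrite expr2 mulrAC.
pose X := Cr * Cr + Sr * Sr; pose Y := Cp * Cr + Sp * Sr.
apply: (@le_trans _ _ (\sum_i b i * (\sum_j c j * (Cq i * Cq j + Sq i * Sq j))
  + \sum_i \sum_j ((2 * e)^-1 * (CP i j * CP i j + SP i j * SP i j) + e / 2 * X)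
  - (\sum_i b i * c i) * Y
  + \sum_i ((2 * e)^-1 * (Cf i * Cf i + Sf i * Sf i) + e / 2 * X))).
  rewrite mulr_suml -sumrN -!big_split/=; apply: ler_sum => i _.
  have := T3 i; rewrite -/X => h3.
  have h2 : - (b i * \sum_j c j * (SP i j * Sr + CP i j * Cr)) <=
      \sum_j ((2 * e)^-1 * (CP i j * CP i j + SP i j * SP i j) + e / 2 * X).
    rewrite mulr_sumr -sumrN; apply: ler_sum => j _; exact: T2.
  by rewrite /Y; lra.
rewrite T4 mul1r [X in _ + _ - _ + X]big_split/= sumr_const card_ord -mulr_sumr.
under [X in _ + X - _ + _]eq_bigr do rewrite big_split/= sumr_const card_ord -mulr_sumr.
rewrite big_split/= sumr_const card_ord -mulr_sumr -/X -/Y.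
have key (x y z q d f1 X' : R) : x <= y ->
    x + (q * d + (e / 2 * X' *+ 3) *+ 3) - z + (q * f1 + e / 2 * X' *+ 3) <=
    - 1 * z + y + q * (d + f1) + 6 * e * X'.
  move=> xy; rewrite -subr_ge0 (_ : _ - _ = y - x); first by rewrite subr_ge0.
  by field.
exact: key T1.
Qed.

End mode_algebra.

(** * The corrector: evolution in time *)

Section corrector.
Context {R : realType}.

Lemma is_derive_bigsum (V : normedModType R) (I : Type) (s : seq I) (F : I -> V -> R)
    (x v : V) (dF : I -> R) :
  (forall i, is_derive x v (F i) (dF i)) ->
  is_derive x v (fun y => \sum_(i <- s) F i y) (\sum_(i <- s) dF i).
Proof.
move=> h; elim: s => [|i s ih].
  rewrite big_nil (_ : (fun y => _) = fun=> 0); first exact: (@is_derive_const _ _ _ _ _).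
  by apply/funext => y; rewrite big_nil.
rewrite big_cons (_ : (fun y => _) = fun y => F i y + \sum_(j <- s) F j y).
  exact: (is_derive_add (h i) ih).
by apply/funext => y; rewrite big_cons.
Qed.

Lemma is_derive_fejer N (F : ('I_3 -> int) -> R -> R) (t : R) (dF : ('I_3 -> int) -> R) :
  (forall k, is_derive t 1 (F k) (dF k)) ->
  is_derive t 1 (fun s => fejer N (F ^~ s)) (fejer N dF).
Proof.
move=> h; apply: (is_derive_scal (N.+1%:R ^+ 3)^-1).
apply: is_derive_bigsum => b; apply: is_derive_bigsum => a; exact: h.
Qed.

Variables (r : spacetime R -> R) (w : 'I_3 -> spacetime R -> R) (p : spacetime R -> R).
Variables (G : 'I_3 -> 'I_3 -> spacetime R -> R) (f : 'I_3 -> spacetime R -> R).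

Definition slice (g : spacetime R -> R) (t : R) : point3 R -> R := fun x => g (t, x).

Lemma slice_cont g (t : R) : cont_open g -> 0 < t -> continuous (slice g t).
Proof. exact: slice_continuous. Qed.

Definition wave (k : 'I_3 -> int) (j : 'I_3) : R := 2 * pi * (k j)%:~R.
(** Vanishes on the zero mode, where the quotients by it below are therefore zero. *)
Definition wave2 k : R := \sum_j wave k j ^+ 2.

(** The functional [\int r w . grad Lap^-1 r], truncated and smoothed by the
    Fejer mean; its derivative controls the density fluctuations. *)
Definition corrector_mode k (t : R) : R :=
  \sum_i wave k i / wave2 k *
    (fcos k (slice (fun z => r z * w i z) t) * fsin k (slice r t)
     - fsin k (slice (fun z => r z * w i z) t) * fcos k (slice r t)).

Definition corrector N t : R := fejer N (corrector_mode ^~ t).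

Hypothesis fl : fluid r w p G f.

Let Crw i : C1per (fun y => r y * w i y) := C1per_mul (fl_r fl) (fl_w fl i).
Let Crww i j : C1per (fun y => r y * w i y * w j y) := C1per_mul (Crw i) (fl_w fl j).

Let T i j (z : spacetime R) := r z * w i z * w j z - G i j z.

Let cT i j : cont_open (T i j).
Proof.
by move=> z z0; apply: cont_sub; [exact: (C1per_cont (Crww i j))|exact: (fl_Gc fl)].
Qed.

Let cdcos k i : continuous (fun x => - (2 * pi * (k i)%:~R * sinm k x) : R).
Proof. by move=> x; apply: cont_opp; apply: cont_mul; [exact: cont_cst|exact: sinm_cont]. Qed.

Let cdsin k i : continuous (fun x => 2 * pi * (k i)%:~R * cosm k x : R).
Proof. by move=> x; apply: cont_mul; [exact: cont_cst|exact: cosm_cont]. Qed.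

Let Ccos k := C1per_space (@cosm_periodic R k) (@cosm_cont R k) (@cdcos k)
  (fun i x => is_derive_cosm k x i).

Let Csin k := C1per_space (@sinm_periodic R k) (@sinm_cont R k) (@cdsin k)
  (fun i x => is_derive_sinm k x i).

Let sums k (X : 'I_3 -> spacetime R -> R) t : (forall j, cont_open (X j)) -> 0 < t ->
  torus_int (fun x => \sum_j X j (t, x) * - (wave k j * sinm k x)) =
    - (\sum_j wave k j * fsin k (slice (X j) t)).
Proof.
move=> cX t0; rewrite -sumrN torus_int_sum => [|j x].
  apply: eq_bigr => j _; rewrite -mulNr -torus_intZ.
    by apply: eq_torus_int => x _; rewrite /slice; ring.
  by move=> x; apply: cont_mul; [exact: (slice_continuous (cX j) t0)|exact: sinm_cont].
apply: cont_mul; first exact: (slice_continuous (cX j) t0).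
by apply: cont_opp; apply: cont_mul; [exact: cont_cst|exact: sinm_cont].
Qed.

Let sumc k (X : 'I_3 -> spacetime R -> R) t : (forall j, cont_open (X j)) -> 0 < t ->
  torus_int (fun x => \sum_j X j (t, x) * (wave k j * cosm k x)) =
    \sum_j wave k j * fcos k (slice (X j) t).
Proof.
move=> cX t0; rewrite torus_int_sum => [|j x].
  apply: eq_bigr => j _; rewrite -torus_intZ.
    by apply: eq_torus_int => x _; rewrite /slice; ring.
  by move=> x; apply: cont_mul; [exact: (slice_continuous (cX j) t0)|exact: cosm_cont].
apply: cont_mul; first exact: (slice_continuous (cX j) t0).
by apply: cont_mul; [exact: cont_cst|exact: cosm_cont].
Qed.

Lemma derive_fcos_density k (t : R) : 0 < t ->
  is_derive t 1 (fun s => fcos k (slice r s))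
    (- (\sum_j wave k j * fsin k (slice (fun z => r z * w j z) t))).
Proof.
move=> t0; have [Cphi phit phix] := Ccos k.
apply: (is_derive_eq (fluid_mass_weak fl Cphi phit t0)).
rewrite -(sums k (fun j => C1per_cont (Crw j)) t0); apply: eq_torus_int => x _.
by apply: eq_bigr => j _; rewrite phix.
Qed.

Lemma derive_fsin_density k (t : R) : 0 < t ->
  is_derive t 1 (fun s => fsin k (slice r s))
    (\sum_j wave k j * fcos k (slice (fun z => r z * w j z) t)).
Proof.
move=> t0; have [Cphi phit phix] := Csin k.
apply: (is_derive_eq (fluid_mass_weak fl Cphi phit t0)).
rewrite -(sumc k (fun j => C1per_cont (Crw j)) t0); apply: eq_torus_int => x _.
by apply: eq_bigr => j _; rewrite phix.
Qed.

Lemma derive_fcos_momentum k i (t : R) : 0 < t ->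
  is_derive t 1 (fun s => fcos k (slice (fun z => r z * w i z) s))
    (- (\sum_j wave k j * fsin k (slice (T i j) t)) - wave k i * fsin k (slice p t)
     + fcos k (slice (f i) t)).
Proof.
move=> t0; have [Cphi phit phix] := Ccos k.
have cps : continuous (fun x => p (t, x) * sinm k x).
  by move=> x; apply: cont_mul; [exact: (slice_continuous (fl_pc fl) t0)|exact: sinm_cont].
apply: (is_derive_eq (fluid_momentum_weak fl Cphi phit i t0)).
rewrite -(sums k (@cT i) t0) -torus_intZ// -torus_intB; last 2 first.
- move=> x; apply: cont_sum => j; apply: cont_mul; first exact: (slice_continuous (@cT i j) t0).
  by apply: cont_opp; apply: cont_mul; [exact: cont_cst|exact: sinm_cont].
- by move=> x; apply: cont_mul; [exact: cont_cst|exact: cps].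
rewrite -torus_intD; last 2 first.
- move=> x; apply: cont_sub.
    apply: cont_sum => j; apply: cont_mul; first exact: (slice_continuous (@cT i j) t0).
    by apply: cont_opp; apply: cont_mul; [exact: cont_cst|exact: sinm_cont].
  by apply: cont_mul; [exact: cont_cst|exact: cps].
- by move=> x; apply: cont_mul; [exact: (slice_cont (fl_f fl (i:=i)) t0)|exact: cosm_cont].
apply: eq_torus_int => x _; congr (_ + _); rewrite phix /=; congr (_ + _); last first.
  by rewrite /wave /slice; ring.
by apply: eq_bigr => j _; rewrite phix.
Qed.

Lemma derive_fsin_momentum k i (t : R) : 0 < t ->
  is_derive t 1 (fun s => fsin k (slice (fun z => r z * w i z) s))
    (\sum_j wave k j * fcos k (slice (T i j) t) + wave k i * fcos k (slice p t)
     + fsin k (slice (f i) t)).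
Proof.
move=> t0; have [Cphi phit phix] := Csin k.
have cps : continuous (fun x => p (t, x) * cosm k x).
  by move=> x; apply: cont_mul; [exact: (slice_continuous (fl_pc fl) t0)|exact: cosm_cont].
apply: (is_derive_eq (fluid_momentum_weak fl Cphi phit i t0)).
rewrite -(sumc k (@cT i) t0) -torus_intZ// -torus_intD; last 2 first.
- move=> x; apply: cont_sum => j; apply: cont_mul; first exact: (slice_continuous (@cT i j) t0).
  by apply: cont_mul; [exact: cont_cst|exact: cosm_cont].
- by move=> x; apply: cont_mul; [exact: cont_cst|exact: cps].
rewrite -torus_intD; last 2 first.
- move=> x; apply: cont_add.
    apply: cont_sum => j; apply: cont_mul; first exact: (slice_continuous (@cT i j) t0).
    by apply: cont_mul; [exact: cont_cst|exact: cosm_cont].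
  by apply: cont_mul; [exact: cont_cst|exact: cps].
- by move=> x; apply: cont_mul; [exact: (slice_cont (fl_f fl (i:=i)) t0)|exact: sinm_cont].
apply: eq_torus_int => x _; congr (_ + _); rewrite phix /=; congr (_ + _); last first.
  by rewrite /wave /slice; ring.
by apply: eq_bigr => j _; rewrite phix.
Qed.

End corrector.

(** * The corrector: estimates *)

Section corrector_estimates.
Context {R : realType}.
Variables (r : spacetime R -> R) (w : 'I_3 -> spacetime R -> R) (p : spacetime R -> R).
Variables (G : 'I_3 -> 'I_3 -> spacetime R -> R) (f : 'I_3 -> spacetime R -> R).
Hypothesis fl : fluid r w p G f.

Let cr := C1per_cont (fl_r fl).
Let cw i := C1per_cont (fl_w fl i).

Lemma fcos_lin k (g1 g2 : point3 R -> R) (a : R) : continuous g1 -> continuous g2 ->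
  fcos k (fun x => g1 x + a * g2 x) = fcos k g1 + a * fcos k g2 /\
  fsin k (fun x => g1 x + a * g2 x) = fsin k g1 + a * fsin k g2.
Proof.
move=> c1 c2; have C (g : point3 R -> R) : continuous g -> continuous (fun x => g x * cosm k x).
  by move=> cg x; apply: cont_mul; [exact: cg|exact: cosm_cont].
have S (g : point3 R -> R) : continuous g -> continuous (fun x => g x * sinm k x).
  by move=> cg x; apply: cont_mul; [exact: cg|exact: sinm_cont].
split.
  rewrite /fcos -torus_intZ; last exact: C.
  rewrite -torus_intD; last 2 first.
  - exact: C.
  - by move=> x; apply: cont_mul; [exact: cont_cst|exact: C].
  by apply: eq_torus_int => x _; ring.
rewrite /fsin -torus_intZ; last exact: S.
rewrite -torus_intD; last 2 first.
- exact: S.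
- by move=> x; apply: cont_mul; [exact: cont_cst|exact: S].
by apply: eq_torus_int => x _; ring.
Qed.

Lemma wave2_mode0 k : wave2 k = 0 :> R <-> mode0 k.
Proof.
split=> [|k0]; last first.
  rewrite /wave2 big1// => j _.
  by rewrite /wave (eqP (forallP k0 j)) mulr0 expr0n.
move=> /eqP; rewrite psumr_eq0 => [/allP h|j _]; last exact: sqr_ge0.
apply/forallP => j; have := h j; rewrite mem_index_enum => /(_ isT).
by rewrite sqrf_eq0 mulf_eq0 gt_eqF ?twopi_gt0//= intr_eq0.
Qed.

Lemma wave2_ge1 k : wave2 k = 0 :> R \/ 1 <= wave2 k :> R.
Proof.
have [k0|k0] := boolP (mode0 k); first by left; apply/wave2_mode0.
right; apply: (le_trans (sqr_phase_ge1 k0)).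
rewrite /wave2 mulr_sumr le_eqVlt; apply/orP; left; apply/eqP.
by apply: eq_bigr => j _; rewrite /wave [RHS]exprMn.
Qed.

(** Subtracting the mean removes exactly the zero mode. *)
Lemma fprod_fluctuation k (g h : point3 R -> R) : continuous g -> continuous h ->
  (wave2 k != 0 :> R)%:R * fprod g h k = fprod g (fun x => h x - torus_int h) k.
Proof.
move=> cg ch; have cc : continuous (fun _ : point3 R => torus_int h).
  by move=> x; exact: cont_cst.
rewrite /fprod fcosB// fsinB// fcos_cst fsin_cst subr0.
have [k0|k0] := boolP (mode0 k).
  have -> : wave2 k = 0 :> R by apply/wave2_mode0.
  by rewrite eqxx mul0r mulr1 (fcos_mode0 h k0) (fsin_mode0 h k0) subrr !mulr0 addr0.
have -> : (wave2 k != 0 :> R) by apply/eqP => /wave2_mode0; exact/negP.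
by rewrite mul1r mulr0 subr0.
Qed.

Lemma fejer_lin5 N (x y : R) (a b c d g : ('I_3 -> int) -> R) :
  fejer N (fun k => - 1 * a k + b k + x * (c k + d k) + y * g k) =
  - fejer N a + fejer N b + x * (fejer N c + fejer N d) + y * fejer N g.
Proof. by rewrite !fejerD !fejerZ fejerD mulN1r. Qed.

Let T i j (z : spacetime R) := r z * w i z * w j z - G i j z.

(** The derivative of [corrector_mode] according to the weak formulations. *)
Definition corrector_rate k (t : R) : R :=
  let C g := fcos k (slice g t) in let S g := fsin k (slice g t) in
  let M i (z : spacetime R) := r z * w i z in
  \sum_i wave k i / wave2 k *
    ((- (\sum_j wave k j * S (T i j)) - wave k i * S p + C (f i)) * S r
     + C (M i) * (\sum_j wave k j * C (M j))
     - ((\sum_j wave k j * C (T i j) + wave k i * C p + S (f i)) * C r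
     + S (M i) * (- (\sum_j wave k j * S (M j))))).

Lemma is_derive_corrector N (t : R) : 0 < t ->
  is_derive t 1 (corrector r w N) (fejer N (corrector_rate ^~ t)).
Proof.
move=> t0; apply: is_derive_fejer => k; apply: is_derive_bigsum => i.
apply: is_derive_scal.
have dCr := derive_fcos_density fl k t0; have dSr := derive_fsin_density fl k t0.
have dCw := derive_fcos_momentum fl k i t0; have dSw := derive_fsin_momentum fl k i t0.
apply: (is_derive_eq (is_derive_sub (is_derive_prod dCw dSr) (is_derive_prod dSw dCr))).
rewrite /T /=; ring.
Qed.

Variables (m : 'I_3 -> R) (t : R).
Hypothesis t0 : 0 < t.

Let q i (z : spacetime R) := r z * (w i z - m i).
Let P i j (z : spacetime R) := r z * (w i z - m i) * (w j z - m j) - G i j z.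

Let cq i : continuous (slice (q i) t).
Proof.
apply: slice_cont => // z z0; apply: cont_mul; first exact: cr.
by apply: cont_sub; [exact: cw|exact: cont_cst].
Qed.

Let cP i j : continuous (slice (P i j) t).
Proof.
apply: slice_cont => // z z0; apply: cont_sub; last exact: (fl_Gc fl).
by do 2?apply: cont_mul; [exact: cr|apply: cont_sub; [exact: cw|exact: cont_cst]..].
Qed.

Let crt : continuous (slice r t). Proof. exact: (slice_cont cr t0). Qed.

Let momentum_split k i :
  fcos k (slice (fun z => r z * w i z) t) = fcos k (slice (q i) t) + m i * fcos k (slice r t) /\
  fsin k (slice (fun z => r z * w i z) t) = fsin k (slice (q i) t) + m i * fsin k (slice r t).
Proof.
have [<- <-] := fcos_lin k (m i) (@cq i) crt.
by split; apply: eq_torus_int => x _; rewrite /slice /q; ring.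
Qed.

Let flux_split k i j :
  fcos k (slice (T i j) t) = fcos k (slice (P i j) t) + m i * fcos k (slice (q j) t)
    + m i * m j * fcos k (slice r t) + m j * fcos k (slice (q i) t) /\
  fsin k (slice (T i j) t) = fsin k (slice (P i j) t) + m i * fsin k (slice (q j) t)
    + m i * m j * fsin k (slice r t) + m j * fsin k (slice (q i) t).
Proof.
have c1 : continuous (fun x => slice (P i j) t x + m i * slice (q j) t x).
  by move=> x; apply: cont_add; [exact: cP|apply: cont_mul; [exact: cont_cst|exact: cq]].
have c2 : continuous (fun x => slice (P i j) t x + m i * slice (q j) t x
    + m i * m j * slice r t x).
  by move=> x; apply: cont_add; [exact: c1|apply: cont_mul; [exact: cont_cst|exact: crt]].
have [<- <-] := fcos_lin k (m i) (@cP i j) (@cq j).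
have [<- <-] := fcos_lin k (m i * m j) c1 crt.
have [<- <-] := fcos_lin k (m j) c2 (@cq i).
by split; apply: eq_torus_int => x _; rewrite /slice /T /P /q; ring.
Qed.

Let fluct : continuous (fun x => slice r t x - torus_int (slice r t)).
Proof. by move=> x; apply: cont_sub; [exact: crt|exact: cont_cst]. Qed.

Let rt x := slice r t x - torus_int (slice r t).

Let fprod_fluct k :
  fprod rt rt k = (wave2 k != 0 :> R)%:R * fprod (slice r t) (slice r t) k.
Proof.
have sym : fprod rt (slice r t) k = fprod (slice r t) rt k.
  by rewrite /fprod [X in X + _]mulrC [X in _ + X]mulrC.
rewrite -(fprod_fluctuation k fluct crt) sym -(fprod_fluctuation k crt crt).
by case: (_ != 0); rewrite ?mul1r ?mul0r.
Qed.

(** The inequality for one mode is averaged with the Fejer weights, and Bessel's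
    inequality turns every sum of squares into an integral.  The drift [m] is
    arbitrary; it will be the mean velocity. *)
Lemma corrector_rate_le N e : 0 < e ->
  fejer N (corrector_rate ^~ t) <=
    - fejer N (fprod (slice p t) (fun x => slice r t x - torus_int (slice r t)))
    + \sum_i torus_int (fun x => slice (q i) t x ^+ 2)
    + (2 * e)^-1 * (\sum_i \sum_j torus_int (fun x => slice (P i j) t x ^+ 2)
                    + \sum_i torus_int (fun x => slice (f i) t x ^+ 2))
    + 6 * e * torus_int (fun x => (slice r t x - torus_int (slice r t)) ^+ 2).
Proof.
move=> e0.
have cp : continuous (slice p t) by exact: (slice_cont (fl_pc fl) t0).
have cf i : continuous (slice (f i) t) by exact: (slice_cont (fl_f fl (i:=i)) t0).
apply: (@le_trans _ _ (fejer N (fun k => - 1 * fprod (slice p t) rt k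
    + \sum_i fprod (slice (q i) t) (slice (q i) t) k
    + (2 * e)^-1 * (\sum_i \sum_j fprod (slice (P i j) t) (slice (P i j) t) k
                     + \sum_i fprod (slice (f i) t) (slice (f i) t) k)
    + 6 * e * fprod rt rt k))).
  apply: le_fejer => k.
  rewrite fprod_fluct -fprod_fluctuation//.
  have b := corrector_mode_bound (erefl : wave2 k = _) (fun i => erefl (wave k i / wave2 k))
    (fun i => fcos k (slice (q i) t)) (fun i => fsin k (slice (q i) t))
    (fun i => fcos k (slice (f i) t)) (fun i => fsin k (slice (f i) t))
    (fun i j => fcos k (slice (P i j) t)) (fun i j => fsin k (slice (P i j) t))
    (fcos k (slice r t)) (fsin k (slice r t)) (fcos k (slice p t)) (fsin k (slice p t))
    (wave2_ge1 k) e0.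
  have g := corrector_galilean (wave k) (fun i => wave k i / wave2 k) m
    (fun i => fcos k (slice (q i) t)) (fun i => fsin k (slice (q i) t))
    (fun i => fcos k (slice (f i) t)) (fun i => fsin k (slice (f i) t))
    (fun i j => fcos k (slice (P i j) t)) (fun i j => fsin k (slice (P i j) t))
    (fcos k (slice r t)) (fsin k (slice r t)) (fcos k (slice p t)) (fsin k (slice p t)).
  rewrite -g in b; move: b => /(le_trans _); rewrite mulN1r mulNr; apply.
  rewrite le_eqVlt; apply/orP; left; apply/eqP; apply: eq_bigr => i _; congr (_ * _).
  have Ec : \sum_j wave k j * fcos k (slice (T i j) t) = \sum_j wave k j *
      (fcos k (slice (P i j) t) + m i * fcos k (slice (q j) t)
       + m i * m j * fcos k (slice r t) + m j * fcos k (slice (q i) t)).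
    by apply: eq_bigr => j _; have [-> _] := flux_split k i j.
  have Es : \sum_j wave k j * fsin k (slice (T i j) t) = \sum_j wave k j *
      (fsin k (slice (P i j) t) + m i * fsin k (slice (q j) t)
       + m i * m j * fsin k (slice r t) + m j * fsin k (slice (q i) t)).
    by apply: eq_bigr => j _; have [_ ->] := flux_split k i j.
  have Mc : \sum_j wave k j * fcos k (slice (fun z => r z * w j z) t) = \sum_j wave k j *
      (fcos k (slice (q j) t) + m j * fcos k (slice r t)).
    by apply: eq_bigr => j _; have [-> _] := momentum_split k j.
  have Ms : \sum_j wave k j * fsin k (slice (fun z => r z * w j z) t) = \sum_j wave k j *
      (fsin k (slice (q j) t) + m j * fsin k (slice r t)).
    by apply: eq_bigr => j _; have [_ ->] := momentum_split k j.
  by have [-> ->] := momentum_split k i; rewrite Ec Es Mc Ms.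
rewrite (fejer_lin5 N _ _ (fprod (slice p t) rt)
  (fun k => \sum_i fprod (slice (q i) t) (slice (q i) t) k)
  (fun k => \sum_i \sum_j fprod (slice (P i j) t) (slice (P i j) t) k)
  (fun k => \sum_i fprod (slice (f i) t) (slice (f i) t) k) (fprod rt rt)).
rewrite !fejer_sum; apply: lerD; first apply: lerD; first apply: lerD => //.
- by apply: ler_sum => i _; exact: fejer_bessel.
- apply: ler_wpM2l; first by rewrite invr_ge0 mulr_ge0// ltW.
  apply: lerD.
    apply: ler_sum => i _; rewrite fejer_sum; apply: ler_sum => j _; exact: fejer_bessel.
  by apply: ler_sum => i _; exact: fejer_bessel.
- apply: ler_wpM2l; first by rewrite mulr_ge0// ltW.
  exact: (fejer_bessel N fluct).
Qed.

(** On nonzero modes [wave k i / wave2 k] is at most one in size, so the corrector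
    is no larger than the fluctuations of the momentum and of the density. *)
Lemma corrector_le N :
  `|corrector r w N t| <= 2^-1 * \sum_i torus_int (fun x => slice (q i) t x ^+ 2)
    + 3 / 2 * torus_int (fun x => (slice r t x - torus_int (slice r t)) ^+ 2).
Proof.
pose B k := 2^-1 * (\sum_i fprod (slice (q i) t) (slice (q i) t) k) + 3 / 2 * fprod rt rt k.
have BE : fejer N B <= 2^-1 * \sum_i torus_int (fun x => slice (q i) t x ^+ 2)
    + 3 / 2 * torus_int (fun x => rt x ^+ 2).
  rewrite (fejerD N (fun k => 2^-1 * \sum_i fprod (slice (q i) t) (slice (q i) t) k)
    (fun k => 3 / 2 * fprod rt rt k)).
  rewrite (fejerZ N _ (fun k => \sum_i fprod (slice (q i) t) (slice (q i) t) k)).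
  rewrite (fejerZ N _ (fprod rt rt)) fejer_sum; apply: lerD; apply: ler_wpM2l => //.
    by apply: ler_sum => i _; exact: fejer_bessel.
  exact: (fejer_bessel N fluct).
have absE (x y : R) : - y <= x <= y -> `|x| <= y by rewrite ler_norml.
apply: absE.
have mode k : - B k <= corrector_mode r w k t <= B k.
  have nonneg (g : point3 R -> R) : 0 <= fprod g g k.
    by rewrite /fprod addr_ge0// -expr2 sqr_ge0.
  have E : corrector_mode r w k t = \sum_i wave k i / wave2 k *
      (fcos k (slice (q i) t) * fsin k (slice r t) - fsin k (slice (q i) t) * fcos k (slice r t)).
    apply: eq_bigr => i _; have [-> ->] := momentum_split k i; congr (_ * _); ring.
  have [n0|n1] := wave2_ge1 k.
    rewrite E big1 => [|i _]; last by rewrite n0 invr0 mulr0 mul0r.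
    have B0 : 0 <= B k.
      by rewrite /B addr_ge0// mulr_ge0// ?sumr_ge0// divr_ge0.
    by rewrite oppr_le0 B0.
  have np : 0 < wave2 k :> R by exact: lt_le_trans n1.
  have bi1 i : (wave k i / wave2 k) ^+ 2 <= 1 :> R.
    rewrite expr_div_n ler_pdivrMr ?exprn_gt0// mul1r.
    have h : wave k i ^+ 2 <= wave2 k :> R.
      by rewrite /wave2 (bigD1 i)//= lerDl sumr_ge0// => j _; exact: sqr_ge0.
    by rewrite (le_trans h)// expr2 ler_peMr// ltW.
  have BE' : B k = \sum_i 2^-1 * (fprod (slice (q i) t) (slice (q i) t) k
      + fprod (slice r t) (slice r t) k).
    have key (a : 'I_3 -> R) (b : R) : \sum_i 2^-1 * (a i + b) = 2^-1 * \sum_i a i + 3 / 2 * b.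
      by rewrite -mulr_sumr big_split/= sumr_const card_ord -mulr_natr; field.
    by rewrite /B fprod_fluct gt_eqF// mul1r (key (fun i => fprod (slice (q i) t) (slice (q i) t) k)).
  have Ti i : - (2^-1 * (fprod (slice (q i) t) (slice (q i) t) k + fprod (slice r t) (slice r t) k))
      <= wave k i / wave2 k * (fcos k (slice (q i) t) * fsin k (slice r t)
          - fsin k (slice (q i) t) * fcos k (slice r t))
      <= 2^-1 * (fprod (slice (q i) t) (slice (q i) t) k + fprod (slice r t) (slice r t) k).
    have bi1' : (- (wave k i / wave2 k : R)) ^+ 2 <= 1 by rewrite sqrrN.
    have h1 := young (fcos k (slice (q i) t)) (fsin k (slice r t)) (bi1 i) ltr01.
    have h2 := young (fsin k (slice (q i) t)) (fcos k (slice r t)) bi1' ltr01.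
    have h3 := young (fcos k (slice (q i) t)) (fsin k (slice r t)) bi1' ltr01.
    have h4 := young (fsin k (slice (q i) t)) (fcos k (slice r t)) (bi1 i) ltr01.
    by move: h1 h2 h3 h4; rewrite /fprod !expr2 mulr1; lra.
  rewrite E BE' -sumrN; apply/andP; split; apply: ler_sum => i _.
    by have /andP[] := Ti i.
  by have /andP[] := Ti i.
have up : corrector r w N t <= fejer N B by apply: le_fejer => k; have /andP[] := mode k.
have low : - fejer N B <= corrector r w N t.
  rewrite -mulN1r -fejerZ; apply: le_fejer => k; rewrite mulN1r.
  by have /andP[] := mode k.
by rewrite (le_trans up BE) (le_trans _ low)// lerN2.
Qed.

End corrector_estimates.

(** * The energy law *)

Section energy_algebra.
Context {R : realType}.

Let sum3 (h : 'I_3 -> R) : \sum_i h i = h ord0 + h (lift ord0 ord0) + h (lift ord0 (lift ord0 ord0)).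
Proof. by rewrite !big_ord_recl big_ord0 addr0 addrA. Qed.

Lemma energy_algebra (r p P P1 : R) (w wt px rx : 'I_3 -> R) (wx G Gx : 'I_3 -> 'I_3 -> R) :
  let mass := - \sum_j (r * wx j j + w j * rx j) in
  let e := 2^-1 * (\sum_i r * w i * w i) + P in
  2^-1 * (\sum_i (2 * r * w i * wt i + w i ^+ 2 * mass)) + P1 * mass
  + \sum_j ((e + p) * wx j j
     + w j * (2^-1 * (\sum_i (2 * r * w i * wx i j + w i ^+ 2 * rx j)) + P1 * rx j + px j)
     - \sum_i (w i * Gx i j + G i j * wx i j))
  = \sum_i (r * wt i + w i * mass
      + \sum_j (r * w i * wx j j + w j * (r * wx i j + w i * rx j)) + px i - \sum_j Gx i j) * w i
    - \sum_i \sum_j G i j * wx i j + (P + p - P1 * r) * \sum_j wx j j.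
Proof. by move=> mass e; rewrite /e /mass !sum3; field. Qed.

End energy_algebra.

Section fluid_balance.
Context {R : realType}.
Variables (r : spacetime R -> R) (w : 'I_3 -> spacetime R -> R) (p : spacetime R -> R).
Variables (G : 'I_3 -> 'I_3 -> spacetime R -> R) (f : 'I_3 -> spacetime R -> R).
Hypothesis fl : fluid r w p G f.

Let Cr := fl_r fl.
Let Cw := fl_w fl.

Lemma tint_mass (t : R) : 0 < t -> is_derive t 1 (tint r) 0.
Proof.
move=> t0; have C1 := @C1per_cst R 1.
have dt1 (z : spacetime R) : dt (fun=> 1 : R) z = 0.
  by apply: deriveE_is; exact: (@is_derive_const _ _ _ _ _).
have h := fluid_mass_weak fl C1 dt1 t0.
rewrite (_ : tint r = tint (fun z => r z * 1)); last first.
  by apply/funext => s; apply: eq_torus_int => x _; rewrite mulr1.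
apply: (is_derive_eq h); rewrite -[RHS](torus_int_cst 0); apply: eq_torus_int => x _.
rewrite big1// => j _; rewrite (_ : dx j _ _ = 0) ?mulr0//.
by apply: deriveE_is; exact: (@is_derive_const _ _ _ _ _).
Qed.

Lemma tint_momentum i (t : R) : 0 < t ->
  is_derive t 1 (tint (fun z => r z * w i z)) (tint (f i) t).
Proof.
move=> t0; have C1 := @C1per_cst R 1.
have dt1 (z : spacetime R) : dt (fun=> 1 : R) z = 0.
  by apply: deriveE_is; exact: (@is_derive_const _ _ _ _ _).
have h := fluid_momentum_weak fl C1 dt1 i t0.
rewrite (_ : tint (fun z => r z * w i z) = tint (fun z => r z * w i z * 1)); last first.
  by apply/funext => s; apply: eq_torus_int => x _; rewrite mulr1.
have dx1 j (z : spacetime R) : dx j (fun=> 1 : R) z = 0.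
  by apply: deriveE_is; exact: (@is_derive_const _ _ _ _ _).
apply: (is_derive_eq h); apply: eq_torus_int => x _.
by rewrite big1 => [|j _]; rewrite dx1 mulr0// mulr1 !add0r.
Qed.

Variables (Pi dPi : R -> R).
Hypothesis dPiE : forall z, 0 < z.1 -> is_derive (r z) 1 Pi (dPi (r z)).
Hypothesis dPic : forall z, 0 < z.1 -> continuous_at (r z) dPi.

Let energy (z : spacetime R) := 2^-1 * (\sum_i r z * w i z * w i z) + Pi (r z).

Let flux j (z : spacetime R) :=
  (energy z + p z) * w j z - \sum_i w i z * G i j z.

Let CPi : C1per (fun z => Pi (r z)) := C1per_comp Cr dPiE dPic.
Let Cww i : C1per (fun z => r z * w i z * w i z) := C1per_mul (C1per_mul Cr (Cw i)) (Cw i).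
Let Csum : C1per (fun z => \sum_i r z * w i z * w i z) := C1per_sum _ Cww.
Let Ce : C1per energy := C1per_add (C1per_scal 2^-1 Csum) CPi.

(** The energy law of one fluid.  No second derivative of [Pi] enters, so the
    potential may be merely [C^1] at vacuum. *)
Lemma fluid_energy (t : R) : 0 < t ->
  is_derive t 1 (tint energy)
    (tint (fun z => \sum_i f i z * w i z - \sum_i \sum_j G i j z * dx j (w i) z
       + (Pi (r z) + p z - dPi (r z) * r z) * \sum_j dx j (w j) z) t).
Proof.
move=> t0.
have pX j : C1dir (0, unit_vec R j) (fun z => energy z + p z).
  exact: (C1dir_add (C1per_x Ce j) (fl_px fl j)).
have cX : cont_open (fun z => energy z + p z).
  by move=> z z0; apply: cont_add; [exact: (C1per_cont Ce)|exact: (fl_pc fl)].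
have wG i j : C1dir (0, unit_vec R j) (fun z => w i z * G i j z).
  exact: (C1dir_mul (C1per_cont (Cw i)) (fl_Gc fl (i:=i) (j:=j)) (C1per_x (Cw i) j) (fl_Gx fl i j)).
have sG j : C1dir (0, unit_vec R j) (fun z => \sum_i w i z * G i j z).
  exact: (C1dir_sum (index_enum _) (fun i => wG i j)).
have eX j : C1dir (0, unit_vec R j) (fun z => (energy z + p z) * w j z).
  exact: (C1dir_mul cX (C1per_cont (Cw j)) (pX j) (C1per_x (Cw j) j)).
apply: (@balance_law _ _ _ flux _ _ _ _ _ _ t0).
- exact: (C1per_cont Ce).
- exact: (C1per_t Ce).
- move=> j s x l s0; rewrite /flux (C1per_per Ce)// (fl_pp fl)// (C1per_per (Cw j))//.
  congr (_ - _); apply: eq_bigr => i _.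
  by rewrite (C1per_per (Cw i))// (fl_Gp fl).
- by move=> j; exact: (C1dir_sub (eX j) (sG j)).
move=> z z0.
have D (v : spacetime R) (dv : forall g, C1per g -> C1dir v g) :
    'D_v energy z = 2^-1 * (\sum_i (2 * r z * w i z * 'D_v (w i) z + w i z ^+ 2 * 'D_v r z))
      + dPi (r z) * 'D_v r z.
  have hr := C1dir_is_derive (dv _ Cr) z0.
  have hw i := C1dir_is_derive (dv _ (Cw i)) z0.
  have h1 := is_derive_compR hr (dPiE z0).
  have h2 := is_derive_bigsum (index_enum _) (fun i =>
    is_derive_prod (is_derive_prod hr (hw i)) (hw i)).
  rewrite (deriveE_is (is_derive_add (is_derive_scal 2^-1 h2) h1)).
  by congr (_ * _ + _); apply: eq_bigr => i _; ring.
have Dt : dt energy z =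
    2^-1 * (\sum_i (2 * r z * w i z * dt (w i) z + w i z ^+ 2 * dt r z))
      + dPi (r z) * dt r z := D (1, 0) (fun g h => C1per_t h).
pose ex j := 2^-1 * (\sum_i (2 * r z * w i z * dx j (w i) z + w i z ^+ 2 * dx j r z))
  + dPi (r z) * dx j r z.
have Dx j : dx j energy z = ex j := D (0, unit_vec R j) (fun g h => C1per_x h j).
have Df j : dx j (flux j) z = (energy z + p z) * dx j (w j) z
    + w j z * (ex j + dx j p z)
    - \sum_i (w i z * dx j (G i j) z + G i j z * dx j (w i) z).
  have h1 := is_derive_prod (is_derive_add (C1dir_is_derive (C1per_x Ce j) z0)
    (C1dir_is_derive (fl_px fl j) z0)) (C1dir_is_derive (C1per_x (Cw j) j) z0).
  have h2 := is_derive_bigsum (index_enum _) (fun i =>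
    is_derive_prod (C1dir_is_derive (C1per_x (Cw i) j) z0) (C1dir_is_derive (fl_Gx fl i j) z0)).
  by rewrite -(Dx j) /dx (deriveE_is (is_derive_sub h1 h2)).
have mass : dt r z = - \sum_j (r z * dx j (w j) z + w j z * dx j r z).
  apply/eqP; rewrite -addr_eq0; apply/eqP; rewrite -[RHS](fl_mass fl z0); congr (_ + _).
  apply: eq_bigr => j _; apply: esym.
  exact: (dx_mul (C1per_x Cr j) (C1per_x (Cw j) j) z0).
have mom i : f i z = r z * dt (w i) z + w i z * dt r z
    + \sum_j (r z * w i z * dx j (w j) z + w j z * (r z * dx j (w i) z + w i z * dx j r z))
    + dx i p z - \sum_j dx j (G i j) z.
  rewrite -(fl_mom fl i z0) dt_mul//; congr (_ + _ + _ - _).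
  apply: eq_bigr => j _.
  have Crw : C1per (fun y => r y * w i y) := C1per_mul Cr (Cw i).
  rewrite (dx_mul (C1per_x Crw j) (C1per_x (Cw j) j) z0).
  by rewrite (dx_mul (C1per_x Cr j) (C1per_x (Cw i) j) z0).
rewrite Dt (eq_bigr _ (fun j _ => Df j)).
have fE : \sum_i f i z * w i z = \sum_i (r z * dt (w i) z + w i z * dt r z
    + \sum_j (r z * w i z * dx j (w j) z + w j z * (r z * dx j (w i) z + w i z * dx j r z))
    + dx i p z - \sum_j dx j (G i j) z) * w i z.
  by apply: eq_bigr => i _; rewrite mom.
rewrite fE mass; exact: (energy_algebra (r z) (p z) (Pi (r z)) (dPi (r z)) (fun i => w i z)
  (fun i => dt (w i) z) (fun i => dx i p z) (fun i => dx i r z) (fun i j => dx j (w i) z)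
  (fun i j => G i j z) (fun i j => dx j (G i j) z)).
Qed.

End fluid_balance.

(** * Continuity up to the initial time *)

Section closed_continuity.
Context {R : realType}.
Implicit Types f g : spacetime R -> R.

Lemma cont_closedP f : cont_closed f <->
  forall z : spacetime R, 0 <= z.1 ->
    f y @[y --> within (fun z : spacetime R => 0 <= z.1) (nbhs z)] --> f z.
Proof. by split=> [/subspace_continuousP//|h]; apply/subspace_continuousP. Qed.

Lemma closed_cst (a : R) : cont_closed (fun=> a).
Proof. by apply/cont_closedP => z _; exact: cvg_cst. Qed.

Lemma closed_add f g : cont_closed f -> cont_closed g -> cont_closed (fun z => f z + g z).
Proof.
by move=> /cont_closedP cf /cont_closedP cg; apply/cont_closedP => z z0;
  apply: cvgD; [exact: cf|exact: cg].
Qed.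

Lemma closed_sub f g : cont_closed f -> cont_closed g -> cont_closed (fun z => f z - g z).
Proof.
by move=> /cont_closedP cf /cont_closedP cg; apply/cont_closedP => z z0;
  apply: cvgB; [exact: cf|exact: cg].
Qed.

Lemma closed_mul f g : cont_closed f -> cont_closed g -> cont_closed (fun z => f z * g z).
Proof.
by move=> /cont_closedP cf /cont_closedP cg; apply/cont_closedP => z z0;
  apply: cvgM; [exact: cf|exact: cg].
Qed.

Lemma closed_sqr f : cont_closed f -> cont_closed (fun z => f z ^+ 2).
Proof.
move=> cf; rewrite (_ : (fun z => _) = fun z => f z * f z); first exact: closed_mul.
by apply/funext => z; rewrite expr2.
Qed.

Lemma closed_sum (I : Type) (s : seq I) (f : I -> spacetime R -> R) :
  (forall i, cont_closed (f i)) -> cont_closed (fun z => \sum_(i <- s) f i z).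
Proof.
move=> cf; elim: s => [|i s ih].
  by rewrite (_ : (fun z => _) = fun=> 0); [exact: closed_cst|apply/funext => z; rewrite big_nil].
rewrite (_ : (fun z => _) = fun z => f i z + \sum_(j <- s) f j z).
  exact: closed_add.
by apply/funext => z; rewrite big_cons.
Qed.

Lemma closed_comp1 f (phi : R -> R) : cont_closed f -> continuous phi ->
  cont_closed (fun z => phi (f z)).
Proof.
move=> /cont_closedP cf cp; apply/cont_closedP => z z0.
by apply: (cvg_comp _ _ (cf z z0)); exact: cp.
Qed.

(** An essential bound of a continuous field holds everywhere: the cylinder
    contains a box of positive measure next to each of its points. *)
Lemma Linfty_pointwise (w : spacetime R -> 'rV[R]_3) (M t : R) (x : point3 R) :
  (forall i, cont_closed (fun z => w z 0 i)) -> (Linfty_norm w <= M%:E)%E ->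
  0 <= t -> cube x -> Num.sqrt (sqnorm (w (t, x))) <= M.
Proof.
move=> cw.
pose box (a b c d l : R) : set (spacetime R) :=
  `[a, a + l] `*` (`[b, b + l] `*` `[c, c + l] `*` `[d, d + l]).
have box_measurable (a b c d l : R) : measurable (box a b c d l : set
    (measurableTypeR R * (measurableTypeR R * measurableTypeR R * measurableTypeR R))).
  by do 3?apply: measurableX; exact: measurable_itv.
have box_measure (a b c d l : R) : 0 < l -> (0 < @lebesgue4 R (box a b c d l))%E.
  move=> l0; have mI (y : R) : measurable (`[y, y + l] : set (measurableTypeR R)).
    exact: measurable_itv.
  have lI (y : R) : @lebesgue_measure R `[y, y + l] = l%:E.
    rewrite lebesgue_measure_itv/= lte_fin ltrDl l0 -EFinB; congr EFin; ring.
  have mS : measurable (`[b, b + l] `*` `[c, c + l] : set (measurableTypeR R * measurableTypeR R)).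
    exact: measurableX.
  rewrite /lebesgue4 product_measure1E//; last exact: measurableX.
  have h2 : @lebesgue2 R (`[b, b + l] `*` `[c, c + l]) = (l * l)%:E.
    by rewrite /lebesgue2 product_measure1E// EFinM; congr (_ * _)%E; exact: lI.
  have h3 : @lebesgue3 R (`[b, b + l] `*` `[c, c + l] `*` `[d, d + l]) = (l * l * l)%:E.
    by rewrite /lebesgue3 product_measure1E// EFinM; congr (_ * _)%E; [exact: h2|exact: lI].
  apply: (@lt_le_trans _ _ (l%:E * (l * l * l)%:E)%E); first by rewrite -EFinM lte_fin !mulr_gt0.
  rewrite le_eqVlt; apply/orP; left; apply/eqP.
  by congr (_ * _)%E; apply: esym; [exact: lI|exact: h3].
have mu0 : (0 < @lebesgue4 R setT)%E.
  apply: (lt_le_trans (box_measure 0 0 0 0 1 ltr01)); apply: le_measure => //.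
  - by rewrite inE.
  - by rewrite inE; exact: measurableT.
rewrite /Linfty_norm unlock mu0 => /ess_sup_inf.ess_supP [A [mA A0 subA]] t0 cx.
rewrite leNgt; apply/negP => Mlt.
have cg : cont_closed (fun z => Num.sqrt (sqnorm (w z))).
  apply: (@closed_comp1 (fun z => sqnorm (w z)) Num.sqrt); last exact: sqrt_continuous.
  by apply: closed_sum => i; exact: closed_sqr.
have /cvgrPdist_lt := (cont_closedP _).1 cg (t, x) t0.
move=> /(_ (Num.sqrt (sqnorm (w (t, x))) - M)); rewrite subr_gt0 => /(_ Mlt).
rewrite /within/= => /nbhs_ballP[e /= e0 he].
pose l := Num.min (e / 2) (1 / 2).
have l0 : 0 < l by rewrite lt_min !divr_gt0.
have le' : l < e by rewrite gt_min; apply/orP; left; lra.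
have l2 : l <= 1 / 2 by rewrite ge_min lexx orbT.
pose st (y : R) := if y <= 1 / 2 then y else y - l.
have stP (y s : R) : 0 <= y <= 1 -> st y <= s <= st y + l -> 0 <= s <= 1 /\ `|y - s| < e.
  move=> /andP[y0 y1]; rewrite /st; case: ifPn => [y2|]; last rewrite -ltNge => y2.
    move=> /andP[h1 h2]; split; first (apply/andP; split; lra).
    rewrite ltr_norml; apply/andP; split; lra.
  move=> /andP[h1 h2]; split; first (apply/andP; split; lra).
  rewrite ltr_norml; apply/andP; split; lra.
move: x cx Mlt he => [[x0 x1] x2] [[/= cx0 cx1] cx2] Mlt he.
move: cx0 cx1 cx2; rewrite !in_itv/= => cx0 cx1 cx2.
have BA : box t (st x0) (st x1) (st x2) l `<=` A.
  move=> [s [[y0 y1] y2]] [/= hs [[/= h0 h1] h2]].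
  move: hs h0 h1 h2; rewrite !in_itv/= => /andP[ts st'] h0 h1 h2.
  have [i0 d0] := stP _ _ cx0 h0; have [i1 d1] := stP _ _ cx1 h1.
  have [i2 d2] := stP _ _ cx2 h2.
  apply: subA => /=; apply/negP; rewrite -ltNge.
  have cyl : cylinder (s, ((y0, y1), y2)).
    split => /=; first by rewrite in_itv/= andbT (le_trans t0).
    by split; first split; rewrite /= in_itv/=.
  rewrite /= patchT ?inE// gee0_abs ?lee_fin ?sqrtr_ge0// lte_fin.
  have s0 : 0 <= s by exact: le_trans ts.
  have dts : `|t - s| < e by rewrite ltr_norml; apply/andP; split; lra.
  have := he (s, ((y0, y1), y2)); rewrite /ball/= /prod_ball/= => /(_ _ s0) h.
  have /h : ball t e s /\ ball ((x0, x1), x2) e ((y0, y1), y2) by [].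
  by rewrite ltr_norml => /andP[_]; lra.
have : (0 < @lebesgue4 R A)%E.
  apply: (lt_le_trans (box_measure t (st x0) (st x1) (st x2) l l0)).
  by apply: le_measure => //; rewrite inE.
by rewrite A0 ltxx.
Qed.

End closed_continuity.

(** * Weighted means and fluctuations *)

Ltac slice_cont :=
  let x := fresh "x" in move=> x;
  repeat match goal with
    | |- continuous_at _ (fun=> ?a) => apply: cont_cst
    | |- continuous_at _ (fun y => @?f y - @?g y) => apply: (@cont_sub _ _ f g)
    | |- continuous_at _ (fun y => @?f y + @?g y) => apply: (@cont_add _ _ f g)
    | |- continuous_at _ (fun y => @?f y * @?g y) => apply: (@cont_mul _ _ f g)
    | |- continuous_at _ (fun y => @?f y ^+ ?k) => apply: (@cont_exp _ _ f k)
    | |- continuous_at _ (fun y => - @?f y) => apply: (@cont_opp _ _ f)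
    | |- continuous_at _ (fun y => \sum_(i <- _ | _) _) => apply: cont_sum => ?
    | H : _ |- continuous_at _ _ => exact: H
    end.

Section weighted_means.
Context {R : realType}.
Variables (r : point3 R -> R) (w : 'I_3 -> point3 R -> R) (rc R0 M : R).
Hypotheses (cr : continuous r) (cw : forall i, continuous (w i)).
Hypotheses (rcE : torus_int r = rc) (rc0 : 0 < rc).
Hypothesis (rb : forall x, cube x -> 0 <= r x <= R0).
Hypothesis (wb : forall i x, cube x -> `|w i x| <= M).

Definition wmean i : R := torus_int (fun x => r x * w i x) / rc.

Definition wvar : R := \sum_i torus_int (fun x => r x * (w i x - wmean i) ^+ 2).

(** The weighted mean minimizes the weighted quadratic distance to constants. *)
Lemma wmean_variance i (a : R) : torus_int (fun x => r x * (w i x - a) ^+ 2) =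
  torus_int (fun x => r x * (w i x - wmean i) ^+ 2) + rc * (wmean i - a) ^+ 2.
Proof.
have crw : continuous (fun x => r x * w i x) by slice_cont.
have E (b : R) : torus_int (fun x => r x * (w i x - b) ^+ 2) =
    torus_int (fun x => r x * w i x ^+ 2) - 2 * b * (wmean i * rc) + b ^+ 2 * rc.
  rewrite /wmean divfK ?gt_eqF// -rcE -!torus_intZ// -torus_intB; [|slice_cont..].
  rewrite -torus_intD; [|slice_cont..].
  by apply: eq_torus_int => x _; ring.
rewrite !E; ring.
Qed.

Lemma wvar_le i (a : R) : torus_int (fun x => r x * (w i x - wmean i) ^+ 2) <=
  torus_int (fun x => r x * (w i x - a) ^+ 2).
Proof. by rewrite (wmean_variance i a) lerDl mulr_ge0 ?(ltW rc0)// sqr_ge0. Qed.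

Lemma wmean_dist i (a : R) : rc * (wmean i - a) ^+ 2 <=
  torus_int (fun x => r x * (w i x - a) ^+ 2).
Proof.
rewrite (wmean_variance i a) lerDr torus_int_ge0// => x /rb /andP[r0 _].
by rewrite mulr_ge0// sqr_ge0.
Qed.

Lemma wmean_bound i : `|wmean i| <= M.
Proof.
have h x : cube x -> - M * r x <= r x * w i x <= M * r x.
  move=> cx; have /andP[r0 _] := rb cx; have := wb i cx.
  rewrite ler_norml => /andP[h1 h2].
  by rewrite [- M * _]mulrC [M * _]mulrC !ler_wpM2l.
rewrite ler_norml /wmean ler_pdivlMr// ler_pdivrMr// -rcE -!torus_intZ//.
by apply/andP; split; apply: le_torus_int => [||x /h /andP[]//]; slice_cont.
Qed.

Lemma wfluct_bound i x : cube x -> (w i x - wmean i) ^+ 2 <= 4 * M ^+ 2.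
Proof.
move=> cx; have := wb i cx; have := wmean_bound i.
rewrite !ler_norml => /andP[h1 h2] /andP[h3 h4].
rewrite -subr_ge0 (_ : _ - _ = (2 * M - (w i x - wmean i)) * (2 * M + (w i x - wmean i))); last by ring.
by rewrite mulr_ge0//; lra.
Qed.

Lemma wvar_ge0 : 0 <= wvar.
Proof.
apply: sumr_ge0 => i _; apply: torus_int_ge0 => x /rb /andP[r0 _].
by rewrite mulr_ge0// sqr_ge0.
Qed.

Lemma momentum_fluct_le :
  \sum_i torus_int (fun x => (r x * (w i x - wmean i)) ^+ 2) <= R0 * wvar.
Proof.
rewrite /wvar mulr_sumr; apply: ler_sum => i _; rewrite -torus_intZ; last by slice_cont.
apply: le_torus_int => [||x /rb /andP[r0 rR]]; [slice_cont|slice_cont|].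
rewrite exprMn expr2 -mulrA; apply: ler_wpM2r => //.
by rewrite mulr_ge0// sqr_ge0.
Qed.

Lemma stress_le (G : 'I_3 -> 'I_3 -> point3 R -> R) : (forall i j, continuous (G i j)) ->
  \sum_i \sum_j torus_int (fun x => (r x * (w i x - wmean i) * (w j x - wmean j) - G i j x) ^+ 2)
  <= 24 * M ^+ 2 * R0 * wvar + 2 * \sum_i \sum_j torus_int (fun x => G i j x ^+ 2).
Proof.
move=> cG.
have h i j : torus_int (fun x => (r x * (w i x - wmean i) * (w j x - wmean j) - G i j x) ^+ 2)
    <= 8 * M ^+ 2 * R0 * torus_int (fun x => r x * (w i x - wmean i) ^+ 2)
      + 2 * torus_int (fun x => G i j x ^+ 2).
  rewrite -!torus_intZ; [|slice_cont..]; rewrite -torus_intD; [|slice_cont..].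
  apply: le_torus_int => [||x cx]; [slice_cont|slice_cont|].
  have /andP[r0 rR] := rb cx; have fb := wfluct_bound j cx.
  set a := w i x - _ in fb *; set b := w j x - _ in fb *.
  have h1 : (r x * a * b - G i j x) ^+ 2 <= 2 * (r x * a * b) ^+ 2 + 2 * G i j x ^+ 2.
    by have := sqr_ge0 (r x * a * b + G i j x); lra.
  apply: (le_trans h1); rewrite lerD2r.
  have -> : 2 * (r x * a * b) ^+ 2 = 2 * (r x * (r x * a ^+ 2) * b ^+ 2) by ring.
  have -> : 8 * M ^+ 2 * R0 * (r x * a ^+ 2) = 2 * (R0 * (r x * a ^+ 2) * (4 * M ^+ 2)) by ring.
  rewrite ler_pM2l//.
  have k0 : 0 <= r x * a ^+ 2 by rewrite mulr_ge0// sqr_ge0.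
  apply: ler_pM; [exact: mulr_ge0|exact: sqr_ge0| |exact: fb].
  exact: ler_wpM2r.
apply: (@le_trans _ _ (\sum_i \sum_(j < 3) (8 * M ^+ 2 * R0 *
    torus_int (fun x => r x * (w i x - wmean i) ^+ 2) + 2 * torus_int (fun x => G i j x ^+ 2)))).
  by apply: ler_sum => i _; apply: ler_sum => j _; exact: h.
rewrite le_eqVlt; apply/orP; left; apply/eqP.
rewrite /wvar !mulr_sumr -big_split/=; apply: eq_bigr => i _.
rewrite big_split/= sumr_const card_ord -mulr_sumr -mulr_natr; ring.
Qed.

End weighted_means.

Section corrector_bounds.
Context {R : realType}.
Variables (r : spacetime R -> R) (w : 'I_3 -> spacetime R -> R) (p : spacetime R -> R).
Variables (G : 'I_3 -> 'I_3 -> spacetime R -> R) (f : 'I_3 -> spacetime R -> R).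
Hypothesis fl : fluid r w p G f.
Variables (rc R0 M t : R).
Hypotheses (t0 : 0 < t) (rc0 : 0 < rc) (rcE : tint r t = rc).
Hypothesis rb : forall x, cube x -> 0 <= r (t, x) <= R0.
Hypothesis wb : forall i x, cube x -> `|w i (t, x)| <= M.

Let cr : continuous (slice r t) := slice_cont (C1per_cont (fl_r fl)) t0.
Let cw i : continuous (slice (w i) t) := slice_cont (C1per_cont (fl_w fl i)) t0.
Let cG i j : continuous (slice (G i j) t) := slice_cont (fl_Gc fl (i:=i) (j:=j)) t0.

Let A : R := wvar (slice r t) (fun i => slice (w i) t) rc.
Let fluct : R := torus_int (fun x => (r (t, x) - rc) ^+ 2).

Lemma corrector_bound N : `|corrector r w N t| <= 2^-1 * (R0 * A) + 3 / 2 * fluct.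
Proof.
pose m := wmean (slice r t) (fun i => slice (w i) t) rc.
have h := corrector_le fl m t0 N.
apply: (le_trans h); apply: lerD.
  rewrite ler_wpM2l//.
  exact: (momentum_fluct_le rc cr cw rb).
by rewrite (_ : torus_int (slice r t) = rc).
Qed.

Lemma corrector_decay N e : 0 < e ->
  fejer N (corrector_rate r w p G f ^~ t) <=
    - fejer N (fprod (slice p t) (fun x => r (t, x) - rc)) + R0 * A
    + (2 * e)^-1 * (24 * M ^+ 2 * R0 * A
        + 2 * (\sum_i \sum_j torus_int (fun x => G i j (t, x) ^+ 2))
        + \sum_i torus_int (fun x => f i (t, x) ^+ 2))
    + 6 * e * fluct.
Proof.
move=> e0; pose m := wmean (slice r t) (fun i => slice (w i) t) rc.
have h := corrector_rate_le fl m t0 N e0; apply: (le_trans h).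
rewrite (_ : torus_int (slice r t) = rc)//; apply: lerD => //.
apply: lerD; first apply: lerD => //.
  exact: (momentum_fluct_le rc cr cw rb).
apply: ler_wpM2l; first by rewrite invr_ge0 mulr_ge0// ltW.
apply: lerD => //.
exact: (stress_le cr cw rcE rc0 rb wb cG).
Qed.

End corrector_bounds.

(** * From the coupled system to two fluids *)

Section two_phase.
Context {R : realType}.

(** The viscous stress whose divergence is [- L v]. *)
Definition viscous (mu la : R) (v : 'I_3 -> spacetime R -> R) (i j : 'I_3) (z : spacetime R) : R :=
  mu * dx j (v i) z + (mu + la) * (i == j)%:R * \sum_l dx l (v l) z.

(** The coupled system in components, together with the a priori bounds and the
    conservation of both masses. *)
Record two_phase (gamma mu la rhobar nbar M rc nc : R) (rho : spacetime R -> R)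
    (u : 'I_3 -> spacetime R -> R) (n : spacetime R -> R) (v : 'I_3 -> spacetime R -> R) : Prop := {
  tp1 : fluid rho u rho (fun _ _ _ => 0) (fun i z => - (rho z * (u i z - v i z)));
  tp2 : fluid n v (fun z => pospow gamma (n z)) (viscous mu la v)
          (fun i z => rho z * (u i z - v i z));
  tp_crho : cont_closed rho;
  tp_cu : forall i, cont_closed (u i);
  tp_cn : cont_closed n;
  tp_cv : forall i, cont_closed (v i);
  tp_prho : Defs.periodic rho;
  tp_pn : Defs.periodic n;
  tp_brho : forall t x, 0 <= t -> 0 <= rho (t, x) <= rhobar;
  tp_bn : forall t x, 0 <= t -> 0 <= n (t, x) <= nbar;
  tp_bu : forall i t x, 0 <= t -> cube x -> `|u i (t, x)| <= M;
  tp_bv : forall i t x, 0 <= t -> cube x -> `|v i (t, x)| <= M;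
  tp_rc : forall t, 0 <= t -> tint rho t = rc;
  tp_nc : forall t, 0 <= t -> tint n t = nc }.

Lemma classical1_C1per (f : spacetime R -> R) : classical1 f -> C1per f.
Proof.
move=> [pf cf tf xf]; split; [exact: closed_open| |exact: tf|exact: xf].
by move=> t x i t0; apply: pf; exact: ltW.
Qed.

Lemma classical1_closed (f : spacetime R -> R) : classical1 f -> cont_closed f.
Proof. by case. Qed.

Lemma eq_dx (f g : spacetime R -> R) (t : R) (x : point3 R) (i : 'I_3) :
  (forall y, f (t, y) = g (t, y)) -> dx i f (t, x) = dx i g (t, x).
Proof.
move=> fg; pose e : spacetime R := (0, unit_vec R i).
have E : (fun s : R => s^-1 *: (f (s *: e + (t, x)) - f (t, x))) =
         (fun s : R => s^-1 *: (g (s *: e + (t, x)) - g (t, x))).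
  apply/funext => s.
  have -> : s *: e + (t, x) = (t, s *: (unit_vec R i : point3 R) + x).
    by congr (_, _); rewrite /= ?scaler0 ?add0r.
  by rewrite !fg.
by rewrite /dx /derive /comp /= E.
Qed.

(** The conservation laws hold at positive times; continuity carries them to the
    initial time. *)
Lemma constant_of_derive0 (h : R -> R) : (forall t : R, 0 < t -> is_derive t 1 h 0) ->
  h s @[s --> 0^'+] --> h 0 -> forall t : R, 0 <= t -> h t = h 0.
Proof.
move=> dh ch t; rewrite le_eqVlt => /predU1P[<-//|t0].
have hs s : 0 < s -> s < t -> h s = h t.
  move=> s0 st.
  have dI x : x \in `]s, t[%R -> is_derive x 1 h ((fun=> 0 : R) x).
    by rewrite in_itv/= => /andP[sx _]; apply: dh; exact: lt_trans sx.
  have cI : {within `[s, t], continuous h}.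
    apply: derivable_within_continuous => x; rewrite in_itv/= => /andP[sx _].
    by have [] := dh x (lt_le_trans s0 sx).
  have [x _] := MVT st dI cI.
  by rewrite mul0r => /eqP; rewrite subr_eq0 eq_sym => /eqP.
have h2 : h s @[s --> 0^'+] --> h t.
  apply: cvg_near_cst; near=> s.
  by apply: hs; near: s; [exact: nbhs_right_gt|exact: nbhs_right_lt].
exact: (cvg_unique _ h2 ch).
Unshelve. all: by end_near. Qed.

Lemma divx_scale (r : spacetime R -> R) (w : spacetime R -> 'rV[R]_3) z :
  divx (fun y => r y *: w y) z = \sum_j dx j (fun y => r y * w y 0 j) z.
Proof.
apply: eq_bigr => j _; congr dx; apply/funext => y.
by rewrite mxE.
Qed.

Lemma solution_two_phase (gamma mu la rhobar nbar M rc nc : R)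
    (rho : spacetime R -> R) (u : spacetime R -> 'rV[R]_3)
    (n : spacetime R -> R) (v : spacetime R -> 'rV[R]_3) :
  1 < gamma -> global_classical_solution gamma mu la rho u n v ->
  (forall t x, 0 <= t -> 0 <= rho (t, x) <= rhobar /\ 0 <= n (t, x) <= nbar) ->
  density_mean rho 0 = rc -> density_mean n 0 = nc ->
  (Linfty_norm u <= M%:E)%E -> (Linfty_norm v <= M%:E)%E ->
  two_phase gamma mu la rhobar nbar M rc nc
    rho (fun i z => u z 0 i) n (fun i z => v z 0 i).
Proof.
move=> g1 S bd rc0 nc0 uM vM.
have Cr := classical1_C1per (regular_rho S).
have Cu i := classical1_C1per (regular_u S i).
have Cn := classical1_C1per (regular_n S).
have Cv i := classical1_C1per (regular_v S i).1.
have C2v i j := (regular_v S i).2 j.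
have cu i : cont_closed (fun z => u z 0 i) := classical1_closed (regular_u S i).
have cv i : cont_closed (fun z => v z 0 i) := classical1_closed (regular_v S i).1.
have n0 t x : 0 <= t -> 0 <= n (t, x) by move=> t0; have [_ /andP[]] := bd t x t0.
have cdv i j : cont_open (dx j (fun z => v z 0 i)) := (C1per_x (Cv i) j).2.
have pdv i j : periodic_open (dx j (fun z => v z 0 i)) := periodic_dx j (C1per_per (Cv i)).
have ddv i j l : C1dir (0, unit_vec R l) (dx j (fun z => v z 0 i)) := C2v i j l.
have cdrag : forall i, cont_open (fun z => rho z * (u z 0 i - v z 0 i)).
  move=> i z z0; apply: cont_mul; first exact: (C1per_cont Cr).
  by apply: cont_sub; [exact: (C1per_cont (Cu i))|exact: (C1per_cont (Cv i))].
have f1 : fluid rho (fun i z => u z 0 i) rho (fun _ _ _ => 0)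
    (fun i z => - (rho z * (u z 0 i - v z 0 i))).
  split => //.
  - exact: (C1per_cont Cr).
  - exact: (C1per_per Cr).
  - exact: (C1per_x Cr).
  - by move=> _ _ z _; exact: cont_cst.
  - by move=> i j; exact: (C1dir_cst (0, unit_vec R j) 0).
  - by move=> i z z0; apply: cont_opp; exact: cdrag.
  - by move=> z z0; rewrite -divx_scale; exact: (euler_mass S).
  - move=> z i z0; rewrite [X in _ - X]big1 ?subr0 => [|j _]; last first.
      by apply: deriveE_is; exact: (@is_derive_const _ _ _ _ _).
    by rewrite -(euler_momentum S i z0) divx_scale.
have cdiv : cont_open (fun z => \sum_l dx l (fun y => v y 0 l) z).
  by move=> z z0; apply: cont_sum => l; exact: cdv.
have ddiv j : C1dir (0, unit_vec R j) (fun z => \sum_l dx l (fun y => v y 0 l) z).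
  exact: (C1dir_sum (index_enum _) (fun l => ddv l l j)).
have Gx i j : C1dir (0, unit_vec R j) (viscous mu la (fun i z => v z 0 i) i j).
  exact: (C1dir_add (C1dir_scal mu (ddv i j j)) (C1dir_scal ((mu + la) * (i == j)%:R) (ddiv j))).
have px i : C1dir (0, unit_vec R i) (fun z => pospow gamma (n z)).
  apply: (C1dir_comp (dphi := fun s => gamma * pospow (gamma - 1) s) (C1per_cont Cn) (C1per_x Cn i)).
    by move=> z _; exact: is_derive_pospow.
  move=> z _; apply: cont_mul; first exact: cont_cst.
  by apply: pospow_continuous; rewrite subr_gt0.
have f2 : fluid n (fun i z => v z 0 i) (fun z => pospow gamma (n z))
    (viscous mu la (fun i z => v z 0 i)) (fun i z => rho z * (u z 0 i - v z 0 i)).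
  split => //.
  - move=> z z0; apply: cont_comp; first exact: (C1per_cont Cn).
    by apply: pospow_continuous; rewrite (lt_trans _ g1).
  - by move=> t x i t0; rewrite (C1per_per Cn).
  - move=> i j z z0; apply: cont_add; apply: cont_mul; try exact: cont_cst.
      exact: cdv.
    exact: cdiv.
  - move=> i j t x l t0; rewrite /viscous pdv//; congr (_ + _ * _).
    by apply: eq_bigr => k _; rewrite pdv.
  - by move=> z z0; rewrite -divx_scale; exact: (ns_mass S).
  - move=> z i z0; rewrite -(ns_momentum S i z0) divx_scale -!addrA; congr (_ + (_ + _)).
    case: z z0 => t x /= t0.
    rewrite (@eq_dx (fun z => pospow gamma (n z)) (fun y => n y `^ gamma)); last first.
      by move=> y; rewrite pospowE// n0// ltW.
    congr (_ + _); rewrite /lame.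
    have E j : dx j (viscous mu la (fun i z => v z 0 i) i j) (t, x) =
        mu * dx j (dx j (fun z => v z 0 i)) (t, x)
        + (mu + la) * (i == j)%:R * dx j (divx v) (t, x).
      have h1 := C1dir_scal mu (ddv i j j).
      have h2 := C1dir_scal ((mu + la) * (i == j)%:R) (ddiv j).
      rewrite /viscous (dx_add h1 h2)// (dx_scal mu (ddv i j j))//.
      by rewrite (dx_scal ((mu + la) * (i == j)%:R) (ddiv j)).
    rewrite (eq_bigr _ (fun j _ => E j)) big_split/= -mulr_sumr opprD mulNr; congr (_ - _).
    rewrite (bigD1 i)//= eqxx mulr1 big1 ?addr0// => j ji.
    by rewrite eq_sym (negbTE ji) mulr0 mul0r.
have sq w i t x : Num.sqrt (sqnorm (w (t, x) : 'rV[R]_3)) <= M -> `|w (t, x) 0 i| <= M.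
  apply: le_trans; rewrite -sqrtr_sqr ler_wsqrtr// /sqnorm (bigD1 i)//= lerDl.
  by rewrite sumr_ge0// => j _; exact: sqr_ge0.
split => //.
- exact: classical1_closed (regular_rho S).
- exact: classical1_closed (regular_n S).
- by case: (regular_rho S).
- by case: (regular_n S).
- by move=> t x t0; case: (bd t x t0).
- by move=> t x t0; case: (bd t x t0).
- by move=> i t x t0 cx; apply: sq; exact: (Linfty_pointwise cu uM t0 cx).
- by move=> i t x t0 cx; apply: sq; exact: (Linfty_pointwise cv vM t0 cx).
- move=> t t0; rewrite -rc0; apply: (constant_of_derive0 _ _ t0).
    by move=> s s0; exact: (tint_mass f1 s0).
  exact: (cvg_tint0 (classical1_closed (regular_rho S))).
- move=> t t0; rewrite -nc0; apply: (constant_of_derive0 _ _ t0).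
    by move=> s s0; exact: (tint_mass f2 s0).
  exact: (cvg_tint0 (classical1_closed (regular_n S))).
Qed.

End two_phase.

(** * Friction and viscosity control the velocities *)

Section dissipation.
Context {R : realType}.
Variables (gamma mu la rhobar nbar M rc nc : R).
Variables (rho : spacetime R -> R) (u : 'I_3 -> spacetime R -> R).
Variables (n : spacetime R -> R) (v : 'I_3 -> spacetime R -> R).
Hypothesis tp : two_phase gamma mu la rhobar nbar M rc nc rho u n v.
Hypotheses (rhobar0 : 0 < rhobar) (nbar0 : 0 < nbar) (rc0 : 0 < rc) (nc0 : 0 < nc).

(** Twice the kinetic energy relative to the mean velocity [m_c] or [j_c]. *)
Definition kinetic (r : spacetime R -> R) (w : 'I_3 -> spacetime R -> R) (c t : R) : R :=
  wvar (slice r t) (fun i => slice (w i) t) c.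

Definition fluct (r : spacetime R -> R) (c t : R) : R := torus_int (fun x => (r (t, x) - c) ^+ 2).

(** The term [|m_c - j_c|^2]. *)
Definition drift (t : R) : R :=
  \sum_i (wmean (slice rho t) (fun i => slice (u i) t) rc i -
          wmean (slice n t) (fun i => slice (v i) t) nc i) ^+ 2.

Definition friction (t : R) : R :=
  \sum_i torus_int (fun x => rho (t, x) * (u i (t, x) - v i (t, x)) ^+ 2).

Definition gradient (t : R) : R :=
  \sum_i \sum_j torus_int (fun x => dx j (v i) (t, x) ^+ 2).

Definition divergence (t : R) : R :=
  torus_int (fun x => (\sum_i dx i (v i) (t, x)) ^+ 2).

Section at_time.
Variable t : R.
Hypothesis t0 : 0 < t.

Let cr : continuous (fun x => rho (t, x)) := slice_cont (C1per_cont (fl_r (tp1 tp))) t0.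
Let cn : continuous (fun x => n (t, x)) := slice_cont (C1per_cont (fl_r (tp2 tp))) t0.
Let cu i : continuous (fun x => u i (t, x)) := slice_cont (C1per_cont (fl_w (tp1 tp) i)) t0.
Let cv i : continuous (fun x => v i (t, x)) := slice_cont (C1per_cont (fl_w (tp2 tp) i)) t0.
Let cdv i j : continuous (fun x => dx j (v i) (t, x)) :=
  slice_cont (C1per_x (fl_w (tp2 tp) i) j).2 t0.
Let pv i : periodic3 (fun x => v i (t, x)).
Proof. by move=> x j; have h : periodic_open (v i) := C1per_per (fl_w (tp2 tp) i); exact: h. Qed.
Let pdv i j : periodic3 (fun x => dx j (v i) (t, x)).
Proof. by move=> x k; have h := periodic_dx j (C1per_per (fl_w (tp2 tp) i)); exact: h. Qed.
Let ddv i j (x : point3 R) : is_derive x (unit_vec R j) (fun x => v i (t, x)) (dx j (v i) (t, x)).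
Proof.
apply: is_derive_space.
exact: (@C1dir_is_derive _ _ _ (t, x) (C1per_x (fl_w (tp2 tp) i) j) t0).
Qed.
Let rb x : cube x -> 0 <= rho (t, x) <= rhobar.
Proof. by move=> _; exact: (tp_brho tp x (ltW t0)). Qed.
Let nb x : cube x -> 0 <= n (t, x) <= nbar.
Proof. by move=> _; exact: (tp_bn tp x (ltW t0)). Qed.
Let rcE : torus_int (fun x => rho (t, x)) = rc := tp_rc tp (ltW t0).
Let ncE : torus_int (fun x => n (t, x)) = nc := tp_nc tp (ltW t0).

Let a i : R := torus_int (fun x => v i (t, x)).

Lemma divergence_le : divergence t <= gradient t.
Proof. exact: (div_le_grad cv cdv pv pdv ddv). Qed.

Lemma divergence_ge0 : 0 <= divergence t.
Proof. by apply: torus_int_ge0 => x _; exact: sqr_ge0. Qed.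

Lemma gradient_ge0 : 0 <= gradient t.
Proof. exact: le_trans divergence_ge0 divergence_le. Qed.

Lemma friction_ge0 : 0 <= friction t.
Proof.
apply: sumr_ge0 => i _; apply: torus_int_ge0 => x /rb /andP[r0 _].
by rewrite mulr_ge0// sqr_ge0.
Qed.

Lemma poincare_sum : \sum_i torus_int (fun x => (v i (t, x) - a i) ^+ 2) <= gradient t.
Proof. by apply: ler_sum => i _; have h := poincare (@cv i) (@cdv i) (@pv i) (@ddv i); exact: h. Qed.

Lemma n_spread : \sum_i torus_int (fun x => n (t, x) * (v i (t, x) - a i) ^+ 2) <= nbar * gradient t.
Proof.
apply: (@le_trans _ _ (nbar * \sum_i torus_int (fun x => (v i (t, x) - a i) ^+ 2))); last first.
  by rewrite ler_pM2l//; exact: poincare_sum.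
rewrite mulr_sumr; apply: ler_sum => i _; rewrite -torus_intZ; last by slice_cont.
apply: le_torus_int => [||x /nb /andP[_ h]]; [slice_cont|slice_cont|].
by rewrite ler_wpM2r// sqr_ge0.
Qed.

Lemma rho_spread : \sum_i torus_int (fun x => rho (t, x) * (u i (t, x) - a i) ^+ 2) <=
  2 * friction t + 2 * rhobar * gradient t.
Proof.
apply: (@le_trans _ _ (2 * friction t + 2 * rhobar *
    \sum_i torus_int (fun x => (v i (t, x) - a i) ^+ 2))); last first.
  by rewrite lerD2l ler_pM2l ?mulr_gt0//; exact: poincare_sum.
rewrite /friction !mulr_sumr -big_split/=; apply: ler_sum => i _.
rewrite -!torus_intZ; [|slice_cont..]; rewrite -torus_intD; [|slice_cont..].
apply: le_torus_int => [||x /rb /andP[r0 rR]]; [slice_cont|slice_cont|].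
have h : (u i (t, x) - a i) ^+ 2 <= 2 * (u i (t, x) - v i (t, x)) ^+ 2 + 2 * (v i (t, x) - a i) ^+ 2.
  have := sqr_ge0 ((u i (t, x) - v i (t, x)) - (v i (t, x) - a i)); lra.
apply: (le_trans (ler_wpM2l r0 h)); move: rR; set s := (u i _ - _) ^+ 2; set q := (v i _ - _) ^+ 2 => rR.
have : 0 <= (rhobar - rho (t, x)) * q by rewrite mulr_ge0 ?sqr_ge0 ?subr_ge0.
lra.
Qed.

Lemma kinetic_n_le : kinetic n v nc t <= nbar * gradient t.
Proof. by apply: le_trans n_spread; apply: ler_sum => i _; exact: (wvar_le cn cv ncE nc0). Qed.

(** The phase [rho] has no viscosity: its velocity is tied to [v] by the friction,
    and [v] to its mean by the viscosity. *)
Lemma kinetic_rho_le : kinetic rho u rc t <= 2 * friction t + 2 * rhobar * gradient t.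
Proof. by apply: le_trans rho_spread; apply: ler_sum => i _; exact: (wvar_le cr cu rcE rc0). Qed.

(** Both mean velocities are compared with the unweighted mean of [v]. *)
Lemma drift_le : drift t <=
  2 / rc * (2 * friction t + 2 * rhobar * gradient t) + 2 / nc * (nbar * gradient t).
Proof.
have h1 : 2 / rc * \sum_i torus_int (fun x => rho (t, x) * (u i (t, x) - a i) ^+ 2) <=
    2 / rc * (2 * friction t + 2 * rhobar * gradient t).
  by rewrite ler_pM2l ?divr_gt0//; exact: rho_spread.
have h2 : 2 / nc * \sum_i torus_int (fun x => n (t, x) * (v i (t, x) - a i) ^+ 2) <=
    2 / nc * (nbar * gradient t).
  by rewrite ler_pM2l ?divr_gt0//; exact: n_spread.
apply: le_trans (lerD h1 h2); rewrite !mulr_sumr -big_split/=; apply: ler_sum => i _.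
have k1 := wmean_dist cr cu rcE rc0 rb i (a i).
have k2 := wmean_dist cn cv ncE nc0 nb i (a i).
set m1 := wmean _ _ _ _; set m2 := wmean _ _ _ _.
have h : (m1 - m2) ^+ 2 <= 2 * (m1 - a i) ^+ 2 + 2 * (m2 - a i) ^+ 2.
  have := sqr_ge0 ((m1 - a i) + (m2 - a i)); lra.
apply: (le_trans h); rewrite -!mulrA; apply: lerD; rewrite ler_pM2l//.
  by rewrite ler_pdivlMl//.
by rewrite ler_pdivlMl//.
Qed.

Lemma friction_force : \sum_i torus_int (fun x => (rho (t, x) * (u i (t, x) - v i (t, x))) ^+ 2)
  <= rhobar * friction t.
Proof.
rewrite /friction mulr_sumr; apply: ler_sum => i _; rewrite -torus_intZ; last by slice_cont.
apply: le_torus_int => [||x /rb /andP[r0 rR]]; [slice_cont|slice_cont|].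
rewrite exprMn expr2 -mulrA; apply: ler_wpM2r => //.
by rewrite mulr_ge0// sqr_ge0.
Qed.

Lemma viscous_sqr_le : \sum_i \sum_j torus_int (fun x => viscous mu la v i j (t, x) ^+ 2)
  <= (2 * mu ^+ 2 + 6 * (mu + la) ^+ 2) * gradient t.
Proof.
have h i j : torus_int (fun x => viscous mu la v i j (t, x) ^+ 2) <=
    2 * mu ^+ 2 * torus_int (fun x => dx j (v i) (t, x) ^+ 2)
    + 2 * (mu + la) ^+ 2 * (i == j)%:R * divergence t.
  rewrite /divergence -!torus_intZ; [|slice_cont..]; rewrite -torus_intD; [|slice_cont..].
  apply: le_torus_int => [||x _]; [rewrite /viscous; slice_cont|slice_cont|].
  rewrite /viscous; set p := dx j _ _; set q := \sum_l _.
  case: eqP => _; rewrite /= ?(mulr1, mulr0, mul0r, addr0).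
    by have := sqr_ge0 (mu * p - (mu + la) * q); lra.
  by have := sqr_ge0 (mu * p); lra.
apply: (@le_trans _ _ (2 * mu ^+ 2 * gradient t + 6 * (mu + la) ^+ 2 * divergence t)).
  apply: (@le_trans _ _ (\sum_i \sum_j (2 * mu ^+ 2 * torus_int (fun x => dx j (v i) (t, x) ^+ 2)
    + 2 * (mu + la) ^+ 2 * (i == j)%:R * divergence t))).
    by apply: ler_sum => i _; apply: ler_sum => j _; exact: h.
  rewrite le_eqVlt; apply/orP; left; apply/eqP.
  have diag i : \sum_j (i == j)%:R = 1 :> R.
    by rewrite (bigD1 i)//= eqxx big1 ?addr0// => j; rewrite eq_sym => /negbTE ->.
  have key (X : 'I_3 -> 'I_3 -> R) (c d D : R) : \sum_i \sum_j (c * X i j + d * (i == j)%:R * D)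
      = c * (\sum_i \sum_j X i j) + d * 3 * D.
    rewrite mulr_sumr (eq_bigr (fun i => c * (\sum_j X i j) + d * D)) => [|i _].
      by rewrite big_split/= sumr_const card_ord -[_ *+ 3]mulr_natr; congr (_ + _); ring.
    by rewrite big_split/= -mulr_sumr -mulr_suml -mulr_sumr diag mulr1.
  by rewrite key /gradient; congr (_ + _ * _); ring.
rewrite [leRHS]mulrDl lerD2l; apply: ler_wpM2l; last exact: divergence_le.
by rewrite mulr_ge0 ?sqr_ge0.
Qed.

(** When [mu + la] is negative the divergence term is absorbed by the gradient,
    since [divergence t <= gradient t]. *)
Lemma viscous_dissipation : 0 < mu -> 0 < la + 2 * mu ->
  Num.min mu (la + 2 * mu) * gradient t <= mu * gradient t + (mu + la) * divergence t.
Proof.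
move=> mu0 la0; have := divergence_le; have := divergence_ge0.
move: (divergence t) (gradient t) => D V D0 DV.
have [h|h] := leP 0 (mu + la).
  apply: (@le_trans _ _ (mu * V)); last by rewrite lerDl mulr_ge0.
  by apply: ler_wpM2r; [exact: le_trans DV|rewrite ge_min lexx].
apply: (@le_trans _ _ ((la + 2 * mu) * V)).
  by apply: ler_wpM2r; [exact: le_trans DV|rewrite ge_min lexx orbT].
have : 0 <= - (mu + la) * (V - D) by rewrite mulr_ge0 ?oppr_ge0 ?subr_ge0// ltW.
lra.
Qed.

End at_time.

End dissipation.

(** * The correctors control the densities *)

Section rates.
Context {R : realType}.
Variables (gamma mu la rhobar nbar M rc nc : R).
Variables (rho : spacetime R -> R) (u : 'I_3 -> spacetime R -> R).
Variables (n : spacetime R -> R) (v : 'I_3 -> spacetime R -> R).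
Hypothesis tp : two_phase gamma mu la rhobar nbar M rc nc rho u n v.
Hypotheses (gamma1 : 1 < gamma) (mu0 : 0 < mu) (la0 : 0 < la + 2 * mu).
Hypotheses (rhobar0 : 0 < rhobar) (nbar0 : 0 < nbar) (rc0 : 0 < rc) (nc0 : 0 < nc).

Let W t := friction rho u v t.
Let V t := gradient v t.

Let drag i (z : spacetime R) : R := rho z * (u i z - v i z).

Let sum_ge0 (a b : R) : 0 <= a -> 0 <= b -> forall c, 0 <= c -> 0 <= a + c * M ^+ 2 * b.
Proof.
move=> a0 b0 c c0; apply: addr_ge0 => //; apply: mulr_ge0 => //; apply: mulr_ge0 => //.
exact: sqr_ge0.
Qed.

Lemma mean_zero_pairing (r h : point3 R -> R) (c k : R) : continuous r -> continuous h ->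
  torus_int r = c -> torus_int (fun x => h x * (r x - c)) = torus_int (fun x => (h x - k) * (r x - c)).
Proof.
move=> cr ch rE; have z : torus_int (fun x => r x - c) = 0.
  by rewrite torus_intB//; [rewrite torus_int_cst rE subrr|slice_cont].
rewrite -[LHS]subr0 -(mulr0 k) -z -torus_intZ; last by slice_cont.
rewrite -torus_intB; [|slice_cont..].
by apply: eq_torus_int => x _; rewrite mulrBl.
Qed.

Lemma mass_le (r : spacetime R -> R) (b c t : R) : continuous (fun x => r (t, x)) ->
  (forall x, r (t, x) <= b) -> tint r t = c -> c <= b.
Proof.
move=> cr rb <-; rewrite -[leRHS]torus_int_cst; apply: le_torus_int => // x; exact: cvg_cst.
Qed.

Lemma rc_le : rc <= rhobar.
Proof.
apply: (@mass_le rho rhobar rc 0); last exact: (tp_rc tp (lexx 0)).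
  exact: (slice_continuous_closed (tp_crho tp) (lexx 0)).
by move=> x; have /andP[] := tp_brho tp x (lexx 0).
Qed.

Lemma nc_le : nc <= nbar.
Proof.
apply: (@mass_le n nbar nc 0); last exact: (tp_nc tp (lexx 0)).
  exact: (slice_continuous_closed (tp_cn tp) (lexx 0)).
by move=> x; have /andP[] := tp_bn tp x (lexx 0).
Qed.

(** The linear pressure of [rho] pairs with the fluctuation to its square; the other
    terms are bounded by the dissipation. *)
Lemma corrector_rho_decay : exists g : R, 0 <= g /\ forall T eta : R, 0 < eta ->
  exists N0, forall N, (N0 <= N)%N -> forall t, 0 < t <= T ->
    fejer N (corrector_rate rho u rho (fun _ _ _ => 0) (fun i z => - drag i z) ^~ t) <=
    - (2^-1 * fluct rho rc t) + g * (W t + V t) + eta.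
Proof.
pose h := (rhobar + 144 * M ^+ 2 * rhobar) * (2 + 2 * rhobar).
have rb0 := ltW rhobar0.
have k0 : 0 <= rhobar + 144 * M ^+ 2 * rhobar by exact: sum_ge0.
have h0 : 0 <= h by rewrite mulr_ge0// addr_ge0// mulr_ge0.
exists (h + 6 * rhobar); split; first by rewrite addr_ge0// mulr_ge0// ltW.
move=> T eta eta0.
have cg : cont_closed (fun z => rho z - rc).
  by apply: closed_sub; [exact: (tp_crho tp)|exact: closed_cst].
have pg : Defs.periodic (fun z => rho z - rc) by move=> t x i t0; rewrite (tp_prho tp).
have rB t x : 0 <= t <= T -> cube x -> `|rho (t, x)| <= rhobar.
  by move=> /andP[t0 _] _; have /andP[r0 r1] := tp_brho tp x t0; rewrite ger0_norm.
have [N0 hN] := fejer_uniform (tp_crho tp) cg pg rB eta0.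
exists N0 => N N0N t /andP[t0 tT].
have := hN N N0N t; rewrite (ltW t0) tT => /(_ isT); rewrite ler_norml => /andP[+ _].
have cr : continuous (fun x => rho (t, x)) := slice_cont (C1per_cont (fl_r (tp1 tp))) t0.
have rcE : torus_int (fun x => rho (t, x)) = rc := tp_rc tp (ltW t0).
have -> : torus_int (fun x => rho (t, x) * (rho (t, x) - rc)) = fluct rho rc t.
  by rewrite (mean_zero_pairing rc cr cr rcE); apply: eq_torus_int => x _; rewrite expr2.
have rb x : cube x -> 0 <= rho (t, x) <= rhobar by move=> _; exact: (tp_brho tp x (ltW t0)).
have ub i x : cube x -> `|u i (t, x)| <= M by exact: (tp_bu tp i (ltW t0)).
(* With [e = 1/12] the factor [6 e] is one half, so that half of the fluctuation
   gained from the pressure survives. *)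
have e0 : 0 < 12^-1 :> R by rewrite invr_gt0.
have := corrector_decay (tp1 tp) t0 rc0 rcE rb ub N e0.
have -> : \sum_(i < 3) \sum_(j < 3) torus_int (fun=> (0 : R) ^+ 2 : R) = 0 :> R.
  by apply: big1 => i _; apply: big1 => j _; rewrite expr0n/= torus_int_cst.
have -> : \sum_i torus_int (fun x => (- drag i (t, x)) ^+ 2) =
    \sum_i torus_int (fun x => (rho (t, x) * (u i (t, x) - v i (t, x))) ^+ 2).
  by apply: eq_bigr => i _; apply: eq_torus_int => x _; rewrite sqrrN.
have f1 := friction_force tp t0.
have f2 := kinetic_rho_le tp rhobar0 rc0 t0.
have W0 : 0 <= W t := friction_ge0 tp t0.
have V0 : 0 <= V t := gradient_ge0 tp t0.
rewrite -/(kinetic rho u rc t) -/(fluct rho rc t).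
have h1 : (rhobar + 144 * M ^+ 2 * rhobar) * kinetic rho u rc t <= h * (W t + V t).
  rewrite /h -[leRHS]mulrA; apply: ler_wpM2l => //.
  have : 0 <= rhobar * W t by rewrite mulr_ge0// ltW.
  by move: f2 W0 V0; rewrite /W /V; lra.
have h2 : 0 <= rhobar * V t by rewrite mulr_ge0// ltW.
move: f1 h1; rewrite -/(W t) -/(V t).
move: (fejer _ _) (fejer _ _) (\sum_i _) => F1 F2 S.
rewrite (_ : (2 * 12^-1)^-1 = 6 :> R); last by field.
lra.
Qed.

(** As for [rho], with the monotonicity of the pressure law in place of its
    linearity. *)
Lemma corrector_n_decay : exists q g : R, [/\ 0 < q, 0 <= g & forall T eta : R, 0 < eta ->
  exists N0, forall N, (N0 <= N)%N -> forall t, 0 < t <= T ->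
    fejer N (corrector_rate n v (fun z => pospow gamma (n z)) (viscous mu la v) drag ^~ t) <=
    - (q * fluct n nc t) + g * (W t + V t) + eta].
Proof.
have gamma0 : 0 < gamma by rewrite (lt_trans _ gamma1).
have [q [Q [q0 Q0 hq]]] := powR_slope gamma0 nc0 nc_le.
(* Again [6 e = q / 2]: half of the gain from the pressure survives. *)
pose e : R := q / 12.
have e0 : 0 < e by rewrite divr_gt0.
have eE : (2 * e)^-1 = 6 / q by rewrite /e; field; rewrite gt_eqF.
pose mv := 2 * mu ^+ 2 + 6 * (mu + la) ^+ 2.
have mv0 : 0 <= mv by apply: addr_ge0; apply: mulr_ge0 => //; exact: sqr_ge0.
pose h := (nbar + 6 / q * (24 * M ^+ 2 * nbar)) * nbar + 6 / q * (2 * mv) + 6 / q * rhobar.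
have q6 : 0 <= 6 / q by rewrite divr_ge0// ltW.
have nb0 := ltW nbar0; have rb0 := ltW rhobar0.
have h1 : 0 <= nbar + 6 / q * (24 * M ^+ 2 * nbar).
  by apply: addr_ge0 => //; apply: mulr_ge0 => //; apply: mulr_ge0 => //; apply: mulr_ge0 => //; exact: sqr_ge0.
have h0 : 0 <= h by rewrite /h; apply: addr_ge0; [apply: addr_ge0|]; apply: mulr_ge0 => //; exact: mulr_ge0.
exists (q / 2), h; split => //; first by rewrite divr_gt0.
move=> T eta eta0.
have cp : cont_closed (fun z => pospow gamma (n z)).
  by apply: closed_comp1; [exact: (tp_cn tp)|exact: pospow_continuous].
have cg : cont_closed (fun z => n z - nc).
  by apply: closed_sub; [exact: (tp_cn tp)|exact: closed_cst].
have pg : Defs.periodic (fun z => n z - nc) by move=> t x i t0; rewrite (tp_pn tp).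
have rB t x : 0 <= t <= T -> cube x -> `|pospow gamma (n (t, x))| <= nbar `^ gamma.
  move=> /andP[t0 _] _; have /andP[r0 r1] := tp_bn tp x t0.
  rewrite ger0_norm ?pospow_ge0// pospowE//.
  by apply: (ge0_ler_powR (ltW gamma0)); rewrite ?nnegrE.
have [N0 hN] := fejer_uniform cp cg pg rB eta0.
exists N0 => N N0N t /andP[t0 tT].
have := hN N N0N t; rewrite (ltW t0) tT => /(_ isT); rewrite ler_norml => /andP[+ _].
have cn : continuous (fun x => n (t, x)) := slice_cont (C1per_cont (fl_r (tp2 tp))) t0.
have cpt : continuous (fun x => pospow gamma (n (t, x))) := slice_cont (fl_pc (tp2 tp)) t0.
have ncE : torus_int (fun x => n (t, x)) = nc := tp_nc tp (ltW t0).
have pair : q * fluct n nc t <= torus_int (fun x => pospow gamma (n (t, x)) * (n (t, x) - nc)).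
  rewrite (mean_zero_pairing (pospow gamma nc) cn cpt ncE) /fluct -torus_intZ; last by slice_cont.
  apply: le_torus_int => [||x _]; [slice_cont|slice_cont|].
  by have /andP[] := hq _ (tp_bn tp x (ltW t0)).
have nb x : cube x -> 0 <= n (t, x) <= nbar by move=> _; exact: (tp_bn tp x (ltW t0)).
have vb i x : cube x -> `|v i (t, x)| <= M by exact: (tp_bv tp i (ltW t0)).
have := corrector_decay (tp2 tp) t0 nc0 ncE nb vb N e0.
have f1 := friction_force tp t0.
have f2 := kinetic_n_le tp nbar0 nc0 t0.
have f3 := viscous_sqr_le tp t0.
have W0 : 0 <= W t := friction_ge0 tp t0.
have V0 : 0 <= V t := gradient_ge0 tp t0.
rewrite -/(kinetic n v nc t) -/(fluct n nc t) eE.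
have k1 : (nbar + 6 / q * (24 * M ^+ 2 * nbar)) * kinetic n v nc t <=
    (nbar + 6 / q * (24 * M ^+ 2 * nbar)) * (nbar * V t) by exact: ler_wpM2l.
have k2 := ler_wpM2l q6 f1; have k3 := ler_wpM2l q6 f3.
have k4 : 6 * e * fluct n nc t = q / 2 * fluct n nc t by rewrite /e; field.
have m1 : 0 <= (nbar + 6 / q * (24 * M ^+ 2 * nbar)) * nbar * W t by rewrite !mulr_ge0.
have m2 : 0 <= 6 / q * (2 * mv) * W t by do 2!apply: mulr_ge0 => //; exact: mulr_ge0.
have m3 : 0 <= 6 / q * rhobar * V t by do 2!apply: mulr_ge0 => //.
rewrite k4 /h.
move: pair k1 k2 k3 m1 m2 m3; rewrite -/(W t) -/(V t) -/mv.
move: (fejer _ _) (fejer _ _) (\sum_i _) (\sum_i _) (torus_int _) (kinetic n v nc t) => F1 F2 S1 S2 P K.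
move: (fluct n nc t) (6 / q) => fl q'.
lra.
Qed.

End rates.

(** * Dissipation of the total energy *)

Section energy_dissipation.
Context {R : realType}.
Variables (gamma mu la rhobar nbar M rc nc : R).
Variables (rho : spacetime R -> R) (u : 'I_3 -> spacetime R -> R).
Variables (n : spacetime R -> R) (v : 'I_3 -> spacetime R -> R).
Hypothesis tp : two_phase gamma mu la rhobar nbar M rc nc rho u n v.
Hypotheses (gamma1 : 1 < gamma) (mu0 : 0 < mu) (la0 : 0 < la + 2 * mu).
Hypotheses (rhobar0 : 0 < rhobar).

(** The entropy of the isothermal gas, shifted away from vacuum where its
    derivative is singular. *)
Definition entropy (d s : R) : R := (s + d ^+ 2) * ln (s + d ^+ 2).

(** The internal energy of the pressure law: [Pi' s - Pi = s^gamma]. *)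
Definition potential (s : R) : R := (gamma - 1)^-1 * pospow gamma s.

Definition fluid_energy_density (r : spacetime R -> R) (w : 'I_3 -> spacetime R -> R)
    (Pi : R -> R) (z : spacetime R) : R :=
  2^-1 * (\sum_i r z * w i z * w i z) + Pi (r z).

Definition total_energy (d t : R) : R :=
  tint (fluid_energy_density rho u (entropy d)) t + tint (fluid_energy_density n v potential) t.

Lemma is_derive_entropy (d s : R) : 0 < s + d ^+ 2 ->
  is_derive s 1 (entropy d) (ln (s + d ^+ 2) + 1).
Proof.
move=> s0; have h : is_derive s 1 (fun y : R => y + d ^+ 2) 1.
  by apply: (is_derive_eq (is_derive_add (is_derive_id _ _) (@is_derive_const _ _ (d ^+ 2) s _)));
    rewrite addr0.
have hl := is_derive_compR h (is_derive1_ln s0).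
apply: (is_derive_eq (is_derive_prod h hl)) => /=.
by field; rewrite gt_eqF.
Qed.

Lemma is_derive_potential (s : R) :
  is_derive s 1 potential ((gamma - 1)^-1 * (gamma * pospow (gamma - 1) s)).
Proof. exact: (is_derive_scal _ (is_derive_pospow s gamma1)). Qed.

Lemma potential_pressure (s : R) : 0 <= s ->
  potential s + pospow gamma s - (gamma - 1)^-1 * (gamma * pospow (gamma - 1) s) * s = 0.
Proof.
move=> s0; rewrite /potential !pospowE// -(mulr_powRB1 s0); last by rewrite (lt_trans _ gamma1).
by field; rewrite gt_eqF// subr_gt0.
Qed.

Lemma viscous_pairing (z : spacetime R) :
  \sum_i \sum_j viscous mu la v i j z * dx j (v i) z =
  mu * (\sum_i \sum_j dx j (v i) z ^+ 2) + (mu + la) * (\sum_i dx i (v i) z) ^+ 2.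
Proof.
set D := \sum_i dx i (v i) z.
have row i : \sum_j viscous mu la v i j z * dx j (v i) z =
    mu * (\sum_j dx j (v i) z ^+ 2) + (mu + la) * D * dx i (v i) z.
  rewrite (eq_bigr (fun j => mu * dx j (v i) z ^+ 2 + (mu + la) * D * ((i == j)%:R * dx j (v i) z))).
    rewrite big_split/= -!mulr_sumr; congr (_ + _ * _).
    rewrite (bigD1 i)//= eqxx mul1r big1 ?addr0// => j; rewrite eq_sym => /negbTE ->.
    by rewrite mul0r.
  by move=> j _; rewrite /viscous -/D; ring.
by rewrite (eq_bigr _ (fun i _ => row i)) big_split/= -!mulr_sumr -/D expr2 mulrA.
Qed.

Lemma dissipation_slice (r L : point3 R -> R) (u' v' : 'I_3 -> point3 R -> R)
    (dv : 'I_3 -> 'I_3 -> point3 R -> R) (eta : R) :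
  continuous r -> continuous L -> (forall i, continuous (u' i)) -> (forall i, continuous (v' i)) ->
  (forall i j, continuous (dv i j)) -> (forall x, cube x -> L x <= eta) ->
  torus_int (fun x => L x - \sum_i r x * (u' i x - v' i x) * u' i x) +
  torus_int (fun x => \sum_i r x * (u' i x - v' i x) * v' i x
      - (mu * (\sum_i \sum_j dv i j x ^+ 2) + (mu + la) * (\sum_i dv i i x) ^+ 2)) <=
  - (\sum_i torus_int (fun x => r x * (u' i x - v' i x) ^+ 2))
  - (mu * (\sum_i \sum_j torus_int (fun x => dv i j x ^+ 2))
     + (mu + la) * torus_int (fun x => (\sum_i dv i i x) ^+ 2)) + eta.
Proof.
move=> cr cL cu cv cdv err.
have fE : \sum_i torus_int (fun x => r x * (u' i x - v' i x) ^+ 2) =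
    torus_int (fun x => \sum_i r x * (u' i x - v' i x) ^+ 2).
  by rewrite torus_int_sum => [//|i]; slice_cont.
have gE : \sum_i \sum_j torus_int (fun x => dv i j x ^+ 2) =
    torus_int (fun x => \sum_i \sum_j dv i j x ^+ 2).
  rewrite torus_int_sum => [|i]; last by slice_cont.
  by apply: eq_bigr => i _; rewrite torus_int_sum => [//|j]; slice_cont.
rewrite fE gE -(torus_int_cst eta).
have cst : continuous (fun _ : point3 R => eta) by slice_cont.
have c1 : continuous (fun x => \sum_i r x * (u' i x - v' i x) ^+ 2) by slice_cont.
have c2 : continuous (fun x => \sum_i \sum_j dv i j x ^+ 2) by slice_cont.
have c3 : continuous (fun x => (\sum_i dv i i x) ^+ 2) by slice_cont.
have c4 : continuous (fun x => \sum_i r x * (u' i x - v' i x) * u' i x) by slice_cont.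
have c5 : continuous (fun x => \sum_i r x * (u' i x - v' i x) * v' i x) by slice_cont.
have key x : \sum_i r x * (u' i x - v' i x) * v' i x - \sum_i r x * (u' i x - v' i x) * u' i x =
    - \sum_i r x * (u' i x - v' i x) ^+ 2.
  by rewrite -sumrB -sumrN; apply: eq_bigr => i _; ring.
move: key c1 c2 c3 c4 c5; set f1 := fun x => \sum_i r x * (u' i x - v' i x) ^+ 2.
set f2 := fun x => \sum_i \sum_j dv i j x ^+ 2; set f3 := fun x => (\sum_i dv i i x) ^+ 2.
set f4 := fun x => \sum_i r x * (u' i x - v' i x) * u' i x.
set f5 := fun x => \sum_i r x * (u' i x - v' i x) * v' i x => key c1 c2 c3 c4 c5.
have -> : - torus_int f1 - (mu * torus_int f2 + (mu + la) * torus_int f3) + torus_int (fun=> eta) =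
    torus_int (fun x => eta - f1 x - (mu * f2 x + (mu + la) * f3 x)).
  rewrite !torus_intB; [|slice_cont..]; rewrite torus_intD; [|slice_cont..].
  by rewrite !torus_intZ//; ring.
rewrite -torus_intD; [|slice_cont..].
apply: le_torus_int => [||x cx]; [slice_cont|slice_cont|].
have := key x; have := err x cx.
rewrite -/(f1 x) -/(f2 x) -/(f3 x) -/(f4 x) -/(f5 x).
move: (f1 x) (f2 x) (f3 x) (f4 x) (f5 x) (L x) => a1 a2 a3 a4 a5 l; lra.
Qed.

(** The shift of the entropy produces the error [d^2 ln (rho + d^2) div u], which is
    small for small [d] as long as [div u] is bounded, that is away from the initial
    time. *)
Lemma energy_decay (tau T eta : R) : 0 < tau -> 0 < eta ->
  exists d : R, 0 < d <= 1 /\ forall t : R, tau <= t <= T ->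
    exists2 D, is_derive t 1 (total_energy d) D &
      D <= - (friction rho u v t + Num.min mu (la + 2 * mu) * gradient v t) + eta.
Proof.
move=> tau0 eta0.
have cdu i j : cont_open (dx j (u i)) := (C1per_x (fl_w (tp1 tp) i) j).2.
have cdv i j : cont_open (dx j (v i)) := (C1per_x (fl_w (tp2 tp) i) j).2.
have cdiv : cont_open (fun z => \sum_j dx j (u j) z).
  by move=> z z0; apply: cont_sum => j; exact: cdu.
have [B B0 hB] := bounded_slab T cdiv tau0.
(* [d * K] bounds the error: [d * (rhobar + 3)] bounds [d^2 ln (rho + d^2)] by
   [small_log_bound], and [B] bounds [div u]. *)
pose K := (rhobar + 3) * (B + 1).
have K0 : 0 < K by apply: mulr_gt0; apply: ltr_wpDl => //; exact: ltW.
pose d := Num.min 1 (eta / K).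
have d0 : 0 < d by rewrite lt_min ltr01 divr_gt0.
have d1 : d <= 1 by rewrite ge_min lexx.
have dK : d * K <= eta by rewrite -ler_pdivlMr// ge_min lexx orbT.
have d20 : 0 < d ^+ 2 by rewrite exprn_gt0.
have d21 : d ^+ 2 <= 1 by rewrite expr_le1// ltW.
exists d; split; first by rewrite d0.
move=> t /andP[taut tT]; have t0 : 0 < t by exact: lt_le_trans taut.
have pos (z : spacetime R) : 0 < z.1 -> 0 < rho z + d ^+ 2.
  case: z => s x /= s0; have /andP[h _] := tp_brho tp x (ltW s0).
  by rewrite ltr_wpDl.
have dE (z : spacetime R) : 0 < z.1 -> is_derive (rho z) 1 (entropy d) (ln (rho z + d ^+ 2) + 1).
  by move=> z0; apply: is_derive_entropy; exact: pos.
have cln (z : spacetime R) : 0 < z.1 -> continuous_at (rho z) (fun s => ln (s + d ^+ 2)).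
  move=> z0; apply: (@cont_comp _ _ (fun s : R => s + d ^+ 2) (@ln R)).
    by apply: cont_add; [exact: cvg_id|exact: cont_cst].
  by apply: continuous_ln; exact: pos.
have cE (z : spacetime R) : 0 < z.1 -> continuous_at (rho z) (fun s => ln (s + d ^+ 2) + 1).
  by move=> z0; apply: cont_add; [exact: cln|exact: cont_cst].
have dP (z : spacetime R) : 0 < z.1 -> is_derive (n z) 1 potential
    ((gamma - 1)^-1 * (gamma * pospow (gamma - 1) (n z))).
  by move=> _; exact: is_derive_potential.
have cP (z : spacetime R) : 0 < z.1 ->
    continuous_at (n z) (fun s => (gamma - 1)^-1 * (gamma * pospow (gamma - 1) s)).
  move=> _; apply: cont_mul; first exact: cont_cst.
  apply: cont_mul; first exact: cont_cst.
  by apply: pospow_continuous; rewrite subr_gt0.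
have E1 := fluid_energy (tp1 tp) dE cE t0.
have E2 := fluid_energy (tp2 tp) dP cP t0.
eexists; first exact: (is_derive_add E1 E2).
have cr : continuous (fun x => rho (t, x)) := slice_cont (C1per_cont (fl_r (tp1 tp))) t0.
have cu i : continuous (fun x => u i (t, x)) := slice_cont (C1per_cont (fl_w (tp1 tp) i)) t0.
have cv i : continuous (fun x => v i (t, x)) := slice_cont (C1per_cont (fl_w (tp2 tp) i)) t0.
have cdu' i j : continuous (fun x => dx j (u i) (t, x)) := slice_cont (@cdu i j) t0.
have cdv' i j : continuous (fun x => dx j (v i) (t, x)) := slice_cont (@cdv i j) t0.
have cl : continuous (fun x => ln (rho (t, x) + d ^+ 2)).
  by move=> x; exact: (cont_comp (cr x) (cln (t, x) t0)).
have -> : tint (fun z => \sum_i - (rho z * (u i z - v i z)) * u i z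
      - \sum_i \sum_j 0 * dx j (u i) z
      + (entropy d (rho z) + rho z - (ln (rho z + d ^+ 2) + 1) * rho z) * \sum_j dx j (u j) z) t =
    torus_int (fun x => d ^+ 2 * ln (rho (t, x) + d ^+ 2) * (\sum_j dx j (u j) (t, x))
      - \sum_i rho (t, x) * (u i (t, x) - v i (t, x)) * u i (t, x)).
  apply: eq_torus_int => x _; rewrite [X in _ - X]big1 ?subr0 => [|i _]; last first.
    by apply: big1 => j _; rewrite mul0r.
  rewrite addrC; congr (_ * _ + _); first by rewrite /entropy; ring.
  by rewrite -sumrN; apply: eq_bigr => i _; rewrite mulNr.
have -> : tint (fun z => \sum_i rho z * (u i z - v i z) * v i z
      - \sum_i \sum_j viscous mu la v i j z * dx j (v i) z
      + (potential (n z) + pospow gamma (n z)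
         - (gamma - 1)^-1 * (gamma * pospow (gamma - 1) (n z)) * n z) * \sum_j dx j (v j) z) t =
    torus_int (fun x => \sum_i rho (t, x) * (u i (t, x) - v i (t, x)) * v i (t, x)
      - (mu * (\sum_i \sum_j dx j (v i) (t, x) ^+ 2)
         + (mu + la) * (\sum_i dx i (v i) (t, x)) ^+ 2)).
  apply: eq_torus_int => x _; rewrite viscous_pairing potential_pressure ?mul0r ?addr0//.
  by have /andP[] := tp_bn tp x (ltW t0).
have h := viscous_dissipation tp t0 mu0 la0.
have err x : cube x -> d ^+ 2 * ln (rho (t, x) + d ^+ 2) * (\sum_j dx j (u j) (t, x)) <= eta.
  move=> cx; have /andP[r0 r1] := tp_brho tp x (ltW t0).
  have l1 : `|d ^+ 2 * ln (rho (t, x) + d ^+ 2)| <= d * (rhobar + 1 + 2).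
    by apply: small_log_bound => //; [rewrite lerDr|exact: lerD|rewrite lerDr ltW].
  have l2 : `|\sum_j dx j (u j) (t, x)| <= B + 1.
    by apply: (@le_trans _ _ B); [apply: hB => //; rewrite taut|rewrite lerDl].
  apply: (le_trans (ler_norm _)); rewrite normrM; apply: le_trans dK.
  apply: (le_trans (ler_pM (normr_ge0 _) (normr_ge0 _) l1 l2)).
  by rewrite /K le_eqVlt; apply/orP; left; apply/eqP; ring.
have cL : continuous (fun x => d ^+ 2 * ln (rho (t, x) + d ^+ 2) * (\sum_j dx j (u j) (t, x))).
  move=> x; apply: cont_mul; first by apply: cont_mul; [exact: cont_cst|exact: cl].
  by apply: cont_sum => j; exact: (cdu' j j).
have k := dissipation_slice cr cL cu cv cdv' err.
apply: (le_trans k); move: h; rewrite -/(friction rho u v t) -/(gradient v t) -/(divergence v t).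
lra.
Qed.

End energy_dissipation.

(** * The Lyapunov functional *)

Section lyapunov_functional.
Context {R : realType}.

(** The energy [E] loses only the dissipation [D], which controls the velocities
    [X] but not the density fluctuations [Z]; the corrector [F] loses [Z] at the
    price of [D].  A small multiple [sigma] of [F] keeps [E] in charge of the size
    and of [D], and makes the sum lose everything. *)
Lemma combine_estimates (k h g q e1 e2 f : R) : 0 < k -> 0 < h -> 0 <= g -> 0 < q ->
  0 < e1 -> 0 < e2 -> 0 < f ->
  exists sigma a b c : R, [/\ 0 < a, 0 < b, 0 < c &
    forall X Z D E F dE dF eta : R, 0 <= X -> 0 <= Z -> 0 <= D -> 0 <= eta ->
      X <= h * D -> e1 * (X + Z) <= E <= e2 * (X + Z) -> `|F| <= f * (X + Z) ->
      dE <= - (k * D) + eta -> dF <= - (q * Z) + g * D + 2 * eta ->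
      a * (X + Z) <= E + sigma * F <= b * (X + Z) /\
      dE + sigma * dF <= - c * (E + sigma * F) + 3 * eta].
Proof.
move=> k0 h0 g0 q0 e10 e20 f0.
have g1 : 0 < g + 1 by rewrite ltr_wpDl.
pose sigma := Num.min 1 (Num.min (k / (2 * (g + 1))) (e1 / (2 * f))).
have s0 : 0 < sigma by rewrite !lt_min ltr01 !divr_gt0// mulr_gt0.
have s1 : sigma <= 1 by rewrite ge_min lexx.
have sg : sigma * (2 * (g + 1)) <= k.
  by rewrite -ler_pdivlMr ?mulr_gt0// !ge_min lexx !orbT.
have sf : sigma * (2 * f) <= e1.
  by rewrite -ler_pdivlMr ?mulr_gt0// !ge_min lexx !orbT.
pose c0 := Num.min (k / (2 * h)) (sigma * q).
have c00 : 0 < c0 by rewrite lt_min divr_gt0 ?mulr_gt0.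
have ck : c0 * (2 * h) <= k by rewrite -ler_pdivlMr ?mulr_gt0// ge_min lexx.
have cs : c0 <= sigma * q by rewrite ge_min lexx orbT.
pose b := e2 + f; have b0 : 0 < b by rewrite addr_gt0.
exists sigma, (e1 / 2), b, (c0 / b); split; [exact: divr_gt0|by []|exact: divr_gt0|].
move=> X Z D E F dE dF eta X0 Z0 D0 eta0 XD /andP[E1 E2] FL hE hF.
have L0 : 0 <= X + Z by rewrite addr_ge0.
have sFn : `|sigma * F| <= sigma * f * (X + Z).
  by rewrite normrM (gtr0_norm s0) -mulrA ler_pM2l.
have p1 : sigma * (2 * f) * (X + Z) <= e1 * (X + Z) by rewrite ler_wpM2r.
have p2 : sigma * (f * (X + Z)) <= f * (X + Z).
  by rewrite ler_piMl// mulr_ge0// ltW.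
move: sFn; rewrite ler_norml => /andP[l1 l2].
have up : E + sigma * F <= b * (X + Z) by rewrite /b; lra.
split; first by apply/andP; split => //; lra.
have p3 : c0 / b * (E + sigma * F) <= c0 * (X + Z).
  rewrite -mulrA ler_pM2l// mulrC ler_pdivrMr// [leRHS]mulrC; exact: up.
have p4 : sigma * dF <= sigma * (- (q * Z) + g * D + 2 * eta) by rewrite ler_pM2l.
have p5 : sigma * (2 * (g + 1)) * D <= k * D by rewrite ler_wpM2r.
have p6 : c0 * X <= c0 * (h * D) by rewrite ler_pM2l.
have p7 : c0 * (2 * h) * D <= k * D by rewrite ler_wpM2r.
have p8 : c0 * Z <= sigma * q * Z by rewrite ler_wpM2r.
have p9 : sigma * eta <= eta by rewrite ler_piMl.
have p10 : 0 <= sigma * D by rewrite mulr_ge0// ltW.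
lra.
Qed.

(** The linear term of the Bregman divergence integrates to zero. *)
Lemma bregman_integral (r : point3 R -> R) (Pi : R -> R) (c k a b : R) :
  continuous r -> continuous (fun x => Pi (r x)) -> torus_int r = c ->
  (forall x, cube x -> a * (r x - c) ^+ 2 <= Pi (r x) - Pi c - k * (r x - c) <= b * (r x - c) ^+ 2) ->
  a * torus_int (fun x => (r x - c) ^+ 2) <= torus_int (fun x => Pi (r x)) - Pi c
  <= b * torus_int (fun x => (r x - c) ^+ 2).
Proof.
move=> cr cP rE h.
have -> : torus_int (fun x => Pi (r x)) - Pi c =
    torus_int (fun x => Pi (r x) - Pi c - k * (r x - c)).
  rewrite !torus_intB; [|slice_cont..]; rewrite torus_intZ; last by slice_cont.
  by rewrite torus_intB; [rewrite !torus_int_cst rE subrr mulr0 subr0|slice_cont..].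
rewrite -!torus_intZ; [|slice_cont..].
by apply/andP; split; apply: le_torus_int => [||x /h /andP[]//]; slice_cont.
Qed.

Lemma energy_split (r : point3 R -> R) (w : 'I_3 -> point3 R -> R) (Pi : R -> R) (c : R) :
  continuous r -> (forall i, continuous (w i)) -> continuous (fun x => Pi (r x)) ->
  torus_int r = c -> 0 < c ->
  torus_int (fun x => 2^-1 * (\sum_i r x * w i x * w i x) + Pi (r x)) =
  2^-1 * wvar r w c + 2^-1 * c * (\sum_i wmean r w c i ^+ 2) + torus_int (fun x => Pi (r x)).
Proof.
move=> cr cw cP rE c0.
rewrite torus_intD; [|slice_cont..]; rewrite torus_intZ; last by slice_cont.
rewrite torus_int_sum => [|i]; last by slice_cont.
congr (_ + _); rewrite -mulrA -mulrDr; congr (_ * _).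
rewrite mulr_sumr -big_split/=; apply: eq_bigr => i _.
have := wmean_variance cr cw rE c0 i 0; rewrite subr0 => <-.
by apply: eq_torus_int => x _; ring.
Qed.

(** The energy of two bodies is the energy of their centre of mass plus that of
    their relative motion. *)
Lemma momentum_split (a b : R) (m j : 'I_3 -> R) : 0 < a -> 0 < b ->
  2^-1 * a * (\sum_i m i ^+ 2) + 2^-1 * b * (\sum_i j i ^+ 2)
  - (2 * (a + b))^-1 * (\sum_i (m i * a + j i * b) ^+ 2) =
  a * b / (2 * (a + b)) * (\sum_i (m i - j i) ^+ 2).
Proof.
move=> a0 b0; rewrite !mulr_sumr -big_split/= -sumrB; apply: eq_bigr => i _.
by field; rewrite gt_eqF// addr_gt0.
Qed.

End lyapunov_functional.

Section functional.
Context {R : realType}.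
Variables (gamma mu la rhobar nbar M rc nc : R).
Variables (rho : spacetime R -> R) (u : 'I_3 -> spacetime R -> R).
Variables (n : spacetime R -> R) (v : 'I_3 -> spacetime R -> R).
Hypothesis tp : two_phase gamma mu la rhobar nbar M rc nc rho u n v.
Hypotheses (gamma1 : 1 < gamma) (mu0 : 0 < mu) (la0 : 0 < la + 2 * mu).
Hypotheses (rhobar0 : 0 < rhobar) (nbar0 : 0 < nbar) (rc0 : 0 < rc) (nc0 : 0 < nc).

Definition momentum (i : 'I_3) (t : R) : R :=
  tint (fun z => rho z * u i z) t + tint (fun z => n z * v i z) t.

(** The excess of the total energy over its least value for the given masses and
    total momentum. *)
Definition relative_energy (d t : R) : R :=
  total_energy gamma rho u n v d t - (2 * (rc + nc))^-1 * (\sum_i momentum i t ^+ 2)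
  - (entropy d rc + potential gamma nc).

(** Together with [density_part] this is the Lyapunov function. *)
Definition velocity_part (t : R) : R :=
  kinetic rho u rc t + kinetic n v nc t + drift rc nc rho u n v t.

Definition density_part (t : R) : R := fluct rho rc t + fluct n nc t.

Lemma velocity_part_le : exists2 h : R, 0 < h & forall t, 0 < t ->
  velocity_part t <= h * (friction rho u v t + gradient v t).
Proof.
pose b := 2 / rc; pose b' := 2 / nc.
have b0 : 0 < b by rewrite divr_gt0.
have b'0 : 0 < b' by rewrite divr_gt0.
exists (2 + 2 * rhobar + nbar + b * (2 + 2 * rhobar) + b' * nbar).
  have k : 0 < 2 + 2 * rhobar by rewrite addr_gt0// mulr_gt0.
  have k' := mulr_gt0 b0 k; have k'' := mulr_gt0 b'0 nbar0.
  exact: (addr_gt0 (addr_gt0 (addr_gt0 k nbar0) k') k'').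
move=> t t0; rewrite /velocity_part.
have h1 := kinetic_n_le tp nbar0 nc0 t0.
have h2 := kinetic_rho_le tp rhobar0 rc0 t0.
have h3 := drift_le tp rhobar0 nbar0 rc0 nc0 t0.
have W0 := friction_ge0 tp t0; have V0 := gradient_ge0 tp t0.
move: h1 h2 h3; rewrite -/b -/b'; move: b b' b0 b'0 => {}b {}b' b0 b'0.
move: (friction rho u v t) (gradient v t) W0 V0 => W V W0 V0.
have k1 : 0 <= rhobar * W by rewrite mulr_ge0// ltW.
have k2 : 0 <= nbar * W by rewrite mulr_ge0// ltW.
have k3 : 0 <= b * V by rewrite mulr_ge0// ltW.
have k4 : 0 <= b * (rhobar * W) by rewrite mulr_ge0// ltW.
have k5 : 0 <= b' * (nbar * W) by rewrite mulr_ge0// ltW.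
move: (kinetic rho u rc t) (kinetic n v nc t) (drift _ _ _ _ _ _ _) => A B J.
lra.
Qed.

Lemma velocity_part_ge0 (t : R) : 0 <= t -> 0 <= velocity_part t.
Proof.
move=> t0; apply: addr_ge0; first apply: addr_ge0.
- apply: (@wvar_ge0 _ _ _ rc rhobar) => x _; exact: (tp_brho tp x t0).
- apply: (@wvar_ge0 _ _ _ nc nbar) => x _; exact: (tp_bn tp x t0).
- by apply: sumr_ge0 => i _; exact: sqr_ge0.
Qed.

Lemma density_part_ge0 (t : R) : 0 <= density_part t.
Proof. by apply: addr_ge0; apply: torus_int_ge0 => x _; exact: sqr_ge0. Qed.

Lemma correctors_bound : exists2 f : R, 0 < f & forall t N, 0 < t ->
  `|corrector rho u N t + corrector n v N t| <= f * (velocity_part t + density_part t).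
Proof.
exists (rhobar + nbar + 3 / 2); first by rewrite !addr_gt0.
move=> t N t0.
have rb x : cube x -> 0 <= rho (t, x) <= rhobar by move=> _; exact: (tp_brho tp x (ltW t0)).
have nb x : cube x -> 0 <= n (t, x) <= nbar by move=> _; exact: (tp_bn tp x (ltW t0)).
have rcE : tint rho t = rc := tp_rc tp (ltW t0).
have ncE : tint n t = nc := tp_nc tp (ltW t0).
have h1 := corrector_bound (tp1 tp) t0 rcE rb N.
have h2 := corrector_bound (tp2 tp) t0 ncE nb N.
apply: (le_trans (ler_normD _ _)); apply: (le_trans (lerD h1 h2)).
rewrite -/(kinetic rho u rc t) -/(kinetic n v nc t) -/(fluct rho rc t) -/(fluct n nc t).
have A0 : 0 <= kinetic rho u rc t by apply: (@wvar_ge0 _ _ _ rc rhobar) => x; exact: rb.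
have B0 : 0 <= kinetic n v nc t by apply: (@wvar_ge0 _ _ _ nc nbar) => x; exact: nb.
have J0 : 0 <= drift rc nc rho u n v t by apply: sumr_ge0 => i _; exact: sqr_ge0.
have F0 : 0 <= fluct rho rc t by apply: torus_int_ge0 => x _; exact: sqr_ge0.
have G0 : 0 <= fluct n nc t by apply: torus_int_ge0 => x _; exact: sqr_ge0.
rewrite /velocity_part /density_part.
move: (kinetic rho u rc t) (kinetic n v nc t) (drift _ _ _ _ _ _ _) (fluct rho rc t) (fluct n nc t)
  A0 B0 J0 F0 G0 => A B J F G A0 B0 J0 F0 G0.
have s0 : 0 <= A + B + J + (F + G) by lra.
have k1 : rhobar * A <= rhobar * (A + B + J + (F + G)) by rewrite ler_pM2l//; lra.
have k2 : nbar * B <= nbar * (A + B + J + (F + G)) by rewrite ler_pM2l//; lra.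
have k3 : 0 <= rhobar * A by rewrite mulr_ge0// ltW.
have k4 : 0 <= nbar * B by rewrite mulr_ge0// ltW.
lra.
Qed.

(** The centre of mass drops out by [momentum_split], and the potentials are
    quadratic around the means since the densities are bounded.  The constants do
    not depend on the shift [d]. *)
Lemma relative_energy_bounds : exists e1 e2 : R, [/\ 0 < e1, 0 < e2 &
  forall d t : R, 0 < d <= 1 -> 0 < t ->
    e1 * (velocity_part t + density_part t) <= relative_energy d t <= e2 * (velocity_part t + density_part t)].
Proof.
have g0 : 0 < gamma - 1 by rewrite subr_gt0.
have gamma0 : 0 < gamma by rewrite (lt_trans _ gamma1).
have [q [Q [q0 Q0 hq]]] := powR_slope g0 nc0 (nc_le tp).
pose s := (gamma - 1)^-1 * gamma.
have s0 : 0 < s by rewrite mulr_gt0// invr_gt0.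
pose ka := rc * nc / (2 * (rc + nc)).
have ka0 : 0 < ka by rewrite divr_gt0// !mulr_gt0// addr_gt0.
pose al := (2 * (rhobar + 1))^-1.
have al0 : 0 < al by rewrite invr_gt0 mulr_gt0// addr_gt0.
have be0 : 0 < rc^-1 by rewrite invr_gt0.
pose a2 := s * q / 2; pose b2 := s * Q / 2.
have a20 : 0 < a2 by rewrite divr_gt0// mulr_gt0.
have b20 : 0 < b2 by rewrite divr_gt0// mulr_gt0.
exists (Num.min 2^-1 (Num.min ka (Num.min al a2))), (2^-1 + ka + rc^-1 + b2); split.
- by rewrite !lt_min invr_gt0 ka0 al0 a20 ltr0n.
- by rewrite !addr_gt0// invr_gt0.
move=> d t /andP[d0 d1] t0.
have d20 : 0 < d ^+ 2 by rewrite exprn_gt0.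
have d21 : d ^+ 2 <= 1 by rewrite expr_le1// ltW.
have cr : continuous (fun x => rho (t, x)) := slice_cont (C1per_cont (fl_r (tp1 tp))) t0.
have cn : continuous (fun x => n (t, x)) := slice_cont (C1per_cont (fl_r (tp2 tp))) t0.
have cu i : continuous (fun x => u i (t, x)) := slice_cont (C1per_cont (fl_w (tp1 tp) i)) t0.
have cv i : continuous (fun x => v i (t, x)) := slice_cont (C1per_cont (fl_w (tp2 tp) i)) t0.
have rcE : torus_int (fun x => rho (t, x)) = rc := tp_rc tp (ltW t0).
have ncE : torus_int (fun x => n (t, x)) = nc := tp_nc tp (ltW t0).
have rb x := tp_brho tp x (ltW t0); have nb x := tp_bn tp x (ltW t0).
have cE : continuous (fun x => entropy d (rho (t, x))).
  move=> x; have /andP[r0 _] := rb x.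
  have ca : continuous_at x (fun x => rho (t, x) + d ^+ 2).
    by apply: cont_add; [exact: cr|exact: cont_cst].
  apply: cont_mul => //; apply: (@cont_comp _ _ (fun x => rho (t, x) + d ^+ 2) (@ln R)) => //.
  by apply: continuous_ln; rewrite ltr_wpDl.
have cP : continuous (fun x => potential gamma (n (t, x))).
  move=> x; apply: cont_mul; first exact: cont_cst.
  by apply: cont_comp; [exact: cn|exact: pospow_continuous].
have b1 : al * fluct rho rc t <= torus_int (fun x => entropy d (rho (t, x))) - entropy d rc
    <= rc^-1 * fluct rho rc t.
  apply: (bregman_integral (k := ln (rc + d ^+ 2) + 1) cr cE rcE) => x _.
  have /andP[r0 r1] := rb x.
  have h1 : 0 < rc + d ^+ 2 by rewrite addr_gt0.
  have h2 : 0 < rho (t, x) + d ^+ 2 by rewrite ltr_wpDl.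
  have h3 : rc + d ^+ 2 <= rhobar + 1 by rewrite lerD// (rc_le tp).
  have h4 : rho (t, x) + d ^+ 2 <= rhobar + 1 by rewrite lerD.
  have := relative_entropy_bounds h1 h2 h3 h4.
  have e : rho (t, x) + d ^+ 2 - (rc + d ^+ 2) = rho (t, x) - rc by ring.
  rewrite /entropy e => /andP[k1 k2]; apply/andP; split; first by apply: (le_trans k1).
  apply: (le_trans k2); rewrite ler_wpM2r ?sqr_ge0//.
  by rewrite lef_pV2 ?posrE// lerDl ltW.
have b2' : a2 * fluct n nc t <= torus_int (fun x => potential gamma (n (t, x))) - potential gamma nc
    <= b2 * fluct n nc t.
  pose g' (s : R) := (gamma - 1)^-1 * (gamma * pospow (gamma - 1) s).
  apply: (bregman_integral (k := g' nc) cn cP ncE) => x _.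
  have dg x0 : 0 <= x0 <= nbar -> is_derive x0 1 (potential gamma) (g' x0).
    by move=> _; exact: is_derive_potential.
  have e y : (g' y - g' nc) * (y - nc) =
      s * ((pospow (gamma - 1) y - pospow (gamma - 1) nc) * (y - nc)) by rewrite /g' /s; ring.
  have cab : 0 <= nc <= nbar by rewrite (ltW nc0) (nc_le tp).
  apply/andP; split.
    apply: (bregman_ge dg cab (q := s * q)) (nb x) => x0 /hq /andP[h _].
    by rewrite e -[leLHS]mulrA ler_pM2l.
  apply: (bregman_le dg cab (q := s * Q)) (nb x) => x0 /hq /andP[_ h].
  by rewrite e -[leRHS]mulrA ler_pM2l.
pose m := wmean (slice rho t) (fun i => slice (u i) t) rc.
pose j := wmean (slice n t) (fun i => slice (v i) t) nc.
have pE i : momentum i t = m i * rc + j i * nc.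
  by rewrite /momentum /m /j /wmean !divfK ?gt_eqF.
have E1 : tint (fluid_energy_density rho u (entropy d)) t = 2^-1 * kinetic rho u rc t
    + 2^-1 * rc * (\sum_i m i ^+ 2) + torus_int (fun x => entropy d (rho (t, x))).
  exact: (energy_split cr cu cE rcE rc0).
have E2 : tint (fluid_energy_density n v (potential gamma)) t = 2^-1 * kinetic n v nc t
    + 2^-1 * nc * (\sum_i j i ^+ 2) + torus_int (fun x => potential gamma (n (t, x))).
  exact: (energy_split cn cv cP ncE nc0).
have E3 := momentum_split m j rc0 nc0.
rewrite -/(drift rc nc rho u n v t) -/ka in E3.
have pS : \sum_i momentum i t ^+ 2 = \sum_i (m i * rc + j i * nc) ^+ 2.
  by apply: eq_bigr => i _; rewrite pE.
rewrite /relative_energy /total_energy E1 E2 pS.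
have A0 : 0 <= kinetic rho u rc t by apply: (@wvar_ge0 _ _ _ rc rhobar) => x _; exact: rb.
have B0 : 0 <= kinetic n v nc t by apply: (@wvar_ge0 _ _ _ nc nbar) => x _; exact: nb.
have J0 : 0 <= drift rc nc rho u n v t by apply: sumr_ge0 => i _; exact: sqr_ge0.
have F0 : 0 <= fluct rho rc t by apply: torus_int_ge0 => x _; exact: sqr_ge0.
have G0 : 0 <= fluct n nc t by apply: torus_int_ge0 => x _; exact: sqr_ge0.
have -> : forall x1 x2 y1 y2 z p1 p2 : R,
   x1 + y1 + p1 + (x2 + y2 + p2) - z - (entropy d rc + potential gamma nc) =
   x1 + x2 + (y1 + y2 - z) + (p1 - entropy d rc) + (p2 - potential gamma nc) by move=> *; ring.
rewrite E3 /velocity_part /density_part.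
move: b1 b2'; move: (torus_int _ - entropy _ _) (torus_int _ - potential _ _) => X1 X2.
move: (kinetic rho u rc t) (kinetic n v nc t) (drift _ _ _ _ _ _ _) (fluct rho rc t) (fluct n nc t)
  A0 B0 J0 F0 G0 => A B J F G A0 B0 J0 F0 G0 /andP[x1 x1'] /andP[x2 x2'].
set e := Num.min _ _.
have l1 : e <= 2^-1 by rewrite ge_min lexx.
have l2 : e <= ka by rewrite !ge_min lexx !orbT.
have l3 : e <= al by rewrite !ge_min lexx !orbT.
have l4 : e <= a2 by rewrite !ge_min lexx !orbT.
have p1 := ler_wpM2r A0 l1; have p2 := ler_wpM2r B0 l1; have p3 := ler_wpM2r J0 l2.
have p4 := ler_wpM2r F0 l3; have p5 := ler_wpM2r G0 l4.
apply/andP; split; first lra.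
have up (z y : R) : 0 < z -> 0 <= y -> 0 <= z * y by move=> z0 y0; rewrite mulr_ge0// ltW.
have := up _ _ ka0 A0; have := up _ _ ka0 B0; have := up _ _ ka0 F0; have := up _ _ ka0 G0.
have := up _ _ be0 A0; have := up _ _ be0 B0; have := up _ _ be0 J0; have := up _ _ be0 G0.
have := up _ _ b20 A0; have := up _ _ b20 B0; have := up _ _ b20 J0; have := up _ _ b20 F0.
move: (rc^-1) x1' => be x1'.
lra.
Qed.

End functional.

(** * Exponential decay *)

Section gronwall.
Context {R : realType}.

(** [expR (c t) * (Y t - eta / c)] does not increase. *)
Lemma gronwall (Y : R -> R) (c eta tau T : R) : 0 < c -> 0 <= eta -> tau < T ->
  (forall t : R, tau <= t <= T -> exists2 D, is_derive t 1 Y D & D <= - c * Y t + eta) ->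
  Y T <= expR (- c * (T - tau)) * Y tau + eta / c.
Proof.
move=> c0 eta0 tT dY; pose h (t : R) := expR (c * t) * (Y t - eta / c).
have dh t : tau <= t <= T -> exists2 D, is_derive t 1 h D & D <= 0.
  move=> /dY[D YD DL].
  have e1 : is_derive t 1 (fun s : R => c * s) (c * 1) := is_derive_scal c (is_derive_id t 1).
  have e2 := is_derive_compR e1 (is_derive_expR _).
  have e3 := is_derive_sub YD (@is_derive_const _ _ (eta / c) t 1).
  eexists; first exact: (is_derive_prod e2 e3).
  have -> : expR (c * t) * (D - 0) + (Y t - eta / c) * (expR (c * t) * (c * 1)) =
    expR (c * t) * (D + c * Y t - eta) by field; rewrite gt_eqF.
  by rewrite pmulr_rle0 ?expR_gt0//; lra.
have dI x : x \in `]tau, T[%R -> is_derive x 1 h ('D_1 h x).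
  rewrite in_itv/= => /andP[h1 h2]; apply/derivableP.
  by have [|D [? _] _] := dh x; first by rewrite !ltW.
have cI : {within `[tau, T], continuous h}.
  apply: derivable_within_continuous => x; rewrite in_itv/= => h1.
  by have [D []] := dh x h1.
have [x xI E] := MVT tT dI cI.
have hT : h T <= h tau.
  rewrite -subr_le0 E; have [|D] := dh x.
    by move: xI; rewrite in_itv/= => /andP[h1 h2]; rewrite !ltW.
  by move=> [_ ->] D0; apply: mulr_le0_ge0 => //; rewrite subr_ge0 ltW.
have eT : 0 < expR (- (c * T)) by exact: expR_gt0.
have := ler_wpM2l (ltW eT) hT; rewrite /h !mulrA -!expRD addNr expR0 mul1r.
rewrite (_ : - (c * T) + c * tau = - c * (T - tau)); last by ring.
have : 0 <= expR (- c * (T - tau)) * (eta / c) by rewrite mulr_ge0 ?expR_ge0// divr_ge0// ltW.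
move: (expR _) (eta / c) => e z; lra.
Qed.

End gronwall.

Section decay.
Context {R : realType}.
Variables (gamma mu la rhobar nbar M rc nc : R).
Variables (rho : spacetime R -> R) (u : 'I_3 -> spacetime R -> R).
Variables (n : spacetime R -> R) (v : 'I_3 -> spacetime R -> R).
Hypothesis tp : two_phase gamma mu la rhobar nbar M rc nc rho u n v.
Hypotheses (gamma1 : 1 < gamma) (mu0 : 0 < mu) (la0 : 0 < la + 2 * mu).
Hypotheses (rhobar0 : 0 < rhobar) (nbar0 : 0 < nbar) (rc0 : 0 < rc) (nc0 : 0 < nc).

Let L (t : R) : R := velocity_part rc nc rho u n v t + density_part rc nc rho n t.

Lemma is_derive_momentum i (t : R) : 0 < t -> is_derive t 1 (momentum rho u n v i) 0.
Proof.
move=> t0.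
have h := is_derive_add (tint_momentum (tp1 tp) i t0) (tint_momentum (tp2 tp) i t0).
apply: (is_derive_eq h).
have cr : continuous (fun x => rho (t, x)) := slice_cont (C1per_cont (fl_r (tp1 tp))) t0.
have cu : continuous (fun x => u i (t, x)) := slice_cont (C1per_cont (fl_w (tp1 tp) i)) t0.
have cv : continuous (fun x => v i (t, x)) := slice_cont (C1per_cont (fl_w (tp2 tp) i)) t0.
rewrite /tint -torus_intD; [|slice_cont..].
rewrite -[RHS](torus_int_cst 0); apply: eq_torus_int => x _; ring.
Qed.

(** Drag is an internal force, so the total momentum is conserved. *)
Lemma is_derive_relative_energy (d t D : R) : 0 < t ->
  is_derive t 1 (total_energy gamma rho u n v d) D ->
  is_derive t 1 (relative_energy gamma rc nc rho u n v d) D.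
Proof.
move=> t0 dE.
have h := is_derive_bigsum (index_enum _) (fun i =>
  is_derive_prod (is_derive_momentum i t0) (is_derive_momentum i t0)).
have h2 := is_derive_sub (is_derive_sub dE (is_derive_scal (2 * (rc + nc))^-1 h))
  (@is_derive_const _ _ (entropy d rc + potential gamma nc) t 1).
apply: (is_derive_eq h2); rewrite big1 => [|i _]; last by rewrite !mulr0 addr0.
by rewrite mulr0 !subr0.
Qed.

(** The constants [a], [b], [c] are chosen before [tau], [T] and [eta]; only the
    functional depends on the latter, through the truncation and the entropy shift. *)
Lemma functional_decay : exists a b c : R, [/\ 0 < a, 0 < b, 0 < c &
  forall tau T eta : R, 0 < tau -> 0 < eta -> exists Y : R -> R, forall t : R, tau <= t <= T ->
    a * L t <= Y t <= b * L t /\ exists2 D, is_derive t 1 Y D & D <= - c * Y t + eta].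
Proof.
have [h h0 hI] := velocity_part_le tp rhobar0 nbar0 rc0 nc0.
have [f f0 hF] := correctors_bound tp rhobar0 nbar0.
have [e1 [e2 [e10 e20 hE]]] := relative_energy_bounds tp gamma1 rhobar0 rc0 nc0.
have [g1 [g10 h1]] := corrector_rho_decay tp rhobar0 rc0.
have [q [g2 [q0 g20 h2]]] := corrector_n_decay tp gamma1 rhobar0 nbar0 nc0.
pose k := Num.min 1 (Num.min mu (la + 2 * mu)).
have k0 : 0 < k by rewrite !lt_min ltr01 mu0.
pose q' := Num.min 2^-1 q.
have q'0 : 0 < q' by rewrite lt_min q0 invr_gt0 ltr0n.
have [s [a [b [c [a0 b0 c0 comb]]]]] :=
  combine_estimates k0 h0 (addr_ge0 g10 g20) q'0 e10 e20 f0.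
exists a, b, c; split => // tau T eta tau0 eta0.
have et0 : 0 < eta / 3 by rewrite divr_gt0.
have [d [d01 hd]] := energy_decay tp gamma1 mu0 la0 rhobar0 T tau0 et0.
have [N1 hN1] := h1 T _ et0; have [N2 hN2] := h2 T _ et0.
pose N := maxn N1 N2.
exists (fun t => relative_energy gamma rc nc rho u n v d t
  + s * (corrector rho u N t + corrector n v N t)) => t /[dup] tT /andP[taut tT'].
have t0 : 0 < t by exact: lt_le_trans taut.
have tT2 : 0 < t <= T by rewrite t0.
have [D dD DL] := hd t tT.
have b1 := hN1 N (leq_maxl _ _) t tT2; have b2 := hN2 N (leq_maxr _ _) t tT2.
have dF := is_derive_scal s (is_derive_add (is_derive_corrector (tp1 tp) N t0)
  (is_derive_corrector (tp2 tp) N t0)).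
have dE := is_derive_add (is_derive_relative_energy t0 dD) dF.
have W0 : 0 <= friction rho u v t := friction_ge0 tp t0.
have V0 : 0 <= gradient v t := gradient_ge0 tp t0.
have F0 : 0 <= fluct rho rc t by apply: torus_int_ge0 => x _; exact: sqr_ge0.
have G0 : 0 <= fluct n nc t by apply: torus_int_ge0 => x _; exact: sqr_ge0.
have DL' : D <= - (k * (friction rho u v t + gradient v t)) + eta / 3.
  apply: (le_trans DL); rewrite lerD2r lerN2.
  have l1 : k <= 1 by rewrite ge_min lexx.
  have l2 : k <= Num.min mu (la + 2 * mu) by rewrite ge_min lexx orbT.
  by rewrite mulrDr lerD// ?ler_wpM2r// ler_piMl.
have FL : fejer N (corrector_rate rho u rho (fun _ _ _ => 0)
      (fun i z => - (rho z * (u i z - v i z))) ^~ t) +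
    fejer N (corrector_rate n v (fun z => pospow gamma (n z)) (viscous mu la v)
      (fun i z => rho z * (u i z - v i z)) ^~ t) <=
    - (q' * density_part rc nc rho n t) + (g1 + g2) * (friction rho u v t + gradient v t)
    + 2 * (eta / 3).
  have l1 : q' * fluct rho rc t <= 2^-1 * fluct rho rc t by rewrite ler_wpM2r// ge_min lexx.
  have l2 : q' * fluct n nc t <= q * fluct n nc t by rewrite ler_wpM2r// ge_min lexx orbT.
  by apply: (le_trans (lerD b1 b2)); rewrite /density_part; lra.
have WV0 : 0 <= friction rho u v t + gradient v t by rewrite addr_ge0.
have [r1 r2] := comb _ _ _ _ _ _ _ _ (velocity_part_ge0 tp (ltW t0)) (density_part_ge0 rc nc rho n t) WV0
  (ltW et0) (hI t t0) (hE d t d01 t0) (hF t N t0) DL' FL.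
split; first exact: r1.
exists (D + s * (fejer N (corrector_rate rho u rho (fun _ _ _ => 0)
      (fun i z => - (rho z * (u i z - v i z))) ^~ t) +
    fejer N (corrector_rate n v (fun z => pospow gamma (n z)) (viscous mu la v)
      (fun i z => rho z * (u i z - v i z)) ^~ t))); first exact: dE.
by apply: (le_trans r2); rewrite lerD2l le_eqVlt; apply/orP; left; apply/eqP; field.
Qed.

Let kinetic_cvg (r : spacetime R -> R) (w : 'I_3 -> spacetime R -> R) (k : R) :
  cont_closed r -> (forall i, cont_closed (w i)) -> (forall t, 0 <= t -> tint r t = k) -> 0 < k ->
  kinetic r w k s @[s --> 0^'+] --> kinetic r w k 0.
Proof.
move=> cr cw rk k0.
pose K (s : R) : R := \sum_i (tint (fun z => r z * w i z ^+ 2) s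
  - k * (tint (fun z => r z * w i z) s / k) ^+ 2).
have KE s : 0 <= s -> kinetic r w k s = K s.
  move=> s0; apply: eq_bigr => i _.
  have c1 : continuous (slice r s) := slice_continuous_closed cr s0.
  have c2 j : continuous (slice (w j) s) := slice_continuous_closed (cw j) s0.
  have := wmean_variance c1 c2 (rk s s0) k0 i 0.
  rewrite (_ : torus_int _ = tint (fun z => r z * w i z ^+ 2) s); last first.
    by apply: eq_torus_int => x _; rewrite subr0.
  by move=> ->; rewrite subr0 addrK.
rewrite (KE 0)//; apply: (@cvg_trans _ (K s @[s --> 0^'+])).
  by apply: near_eq_cvg; near=> s; apply/esym/KE; rewrite ltW.
apply: cvg_big => [x y|i _]; first exact: add_continuous.
apply: cvgB.
  by apply: cvg_tint0; apply: closed_mul => //; exact: closed_sqr.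
apply: cvgM; first exact: cvg_cst.
have h : tint (fun z => r z * w i z) s / k @[s --> 0^'+] --> tint (fun z => r z * w i z) 0 / k.
  by apply: cvgM; [apply: cvg_tint0; exact: closed_mul|exact: cvg_cst].
by apply: cvgM; exact: h.
Unshelve. all: by end_near. Qed.

Lemma L_cvg : L s @[s --> 0^'+] --> L 0.
Proof.
have fl (r : spacetime R -> R) (k : R) : cont_closed r ->
    fluct r k s @[s --> 0^'+] --> fluct r k 0.
  move=> cr; apply: (@cvg_tint0 _ (fun z => (r z - k) ^+ 2)); apply: closed_sqr.
  by apply: closed_sub => //; exact: closed_cst.
apply: cvgD; last by apply: cvgD; apply: fl; [exact: (tp_crho tp)|exact: (tp_cn tp)].
apply: cvgD; first apply: cvgD.
- apply: kinetic_cvg => //; [exact: (tp_crho tp)|exact: (tp_cu tp)|exact: (tp_rc tp)].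
- apply: kinetic_cvg => //; [exact: (tp_cn tp)|exact: (tp_cv tp)|exact: (tp_nc tp)].
apply: cvg_big => [x y|i _]; first exact: add_continuous.
have m (r w : spacetime R -> R) (k : R) : cont_closed r -> cont_closed w ->
    tint (fun z => r z * w z) s / k @[s --> 0^'+] --> tint (fun z => r z * w z) 0 / k.
  by move=> cr cw; apply: cvgM; [apply: cvg_tint0; exact: closed_mul|exact: cvg_cst].
have h := cvgB (m _ _ rc (tp_crho tp) (tp_cu tp (i:=i))) (m _ _ nc (tp_cn tp) (tp_cv tp (i:=i))).
by apply: cvgM; exact: h.
Qed.

(** First [eta] tends to zero, then the starting time [tau], by continuity of the
    Lyapunov function at the initial time. *)
Theorem exponential_decay : exists C K : R, [/\ 0 < C, 0 < K &
  forall t : R, 0 <= t -> L t <= K * (L 0 * expR (- C * t))].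
Proof.
have [a [b [c [a0 b0 c0 hY]]]] := functional_decay.
have L0 t : 0 <= t -> 0 <= L t.
  by move=> t0; apply: addr_ge0; [exact: (velocity_part_ge0 tp)|exact: density_part_ge0].
exists c, (1 + b / a); split => //; first by rewrite addr_gt0// divr_gt0.
move=> T; rewrite le_eqVlt => /predU1P[<-|T0].
  by rewrite mulr0 expR0 mulr1 ler_peMl ?L0// lerDl divr_ge0// ltW.
have step tau : 0 < tau -> tau < T -> L T <= b / a * (expR (- c * (T - tau)) * L tau).
  move=> tau0 tauT; apply/ler_addgt0Pr => e e0.
  (* After division by [a] the error term [eta / c] becomes [e]. *)
  have eta0 : 0 < e * (a * c) by rewrite !mulr_gt0.
  have [Y hYt] := hY tau T _ tau0 eta0.
  have G := gronwall c0 (ltW eta0) tauT (fun t h => (hYt t h).2).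
  have [|/andP[l1 _] _] := hYt T; first by rewrite lexx ltW.
  have [|/andP[_ l2] _] := hYt tau; first by rewrite lexx ltW.
  have l3 : a * L T <= expR (- c * (T - tau)) * (b * L tau) + e * (a * c) / c.
    apply: (le_trans l1); apply: (le_trans G); rewrite lerD2r.
    by rewrite ler_wpM2l ?expR_ge0.
  rewrite -(ler_pM2l a0); apply: (le_trans l3); rewrite le_eqVlt; apply/orP; left; apply/eqP.
  by field; rewrite !gt_eqF.
have lim : b / a * (expR (- c * (T - s)) * L s) @[s --> 0^'+] -->
    b / a * (expR (- c * (T - 0)) * L 0).
  apply: cvgM; first exact: cvg_cst.
  apply: cvgM; last exact: L_cvg.
  apply: cvg_at_right_filter.
  have ce : continuous_at (0 : R) (fun s => expR (- c * (T - s))).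
    apply: (@cont_comp _ _ (fun s => - c * (T - s)) (@expR R)); last exact: continuous_expR.
    apply: cont_mul; first exact: cont_cst.
    by apply: cont_sub; [exact: cont_cst|exact: cvg_id].
  exact: ce.
have h : L T <= b / a * (expR (- c * (T - 0)) * L 0).
  apply: (cvgr_to_ge lim); near=> s.
  by apply: step; near: s; [exact: nbhs_right_gt|exact: nbhs_right_lt].
apply: (le_trans h); rewrite subr0 [L 0 * _]mulrC ler_wpM2r//.
  by rewrite mulr_ge0 ?expR_ge0 ?L0.
by rewrite lerDr.
Unshelve. all: by end_near. Qed.

End decay.

(** * The Lyapunov function of the system *)

Section lyapunov.
Context {R : realType}.
Variables (gamma mu la rhobar nbar M rc nc : R).
Variables (rho : spacetime R -> R) (u : spacetime R -> 'rV[R]_3).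
Variables (n : spacetime R -> R) (v : spacetime R -> 'rV[R]_3).
Hypothesis tp : two_phase gamma mu la rhobar nbar M rc nc
  rho (fun i z => u z 0 i) n (fun i z => v z 0 i).

Let weighted_sqnorm (r : spacetime R -> R) (w : spacetime R -> 'rV[R]_3) (k t : R) :
  cont_closed r -> (forall i, cont_closed (fun z => w z 0 i)) -> tint r t = k -> 0 <= t ->
  torus_int (fun x => r (t, x) * sqnorm (w (t, x) - mean_velocity r w t)) =
  kinetic r (fun i z => w z 0 i) k t.
Proof.
move=> cr cw rk t0.
have c1 : continuous (fun x => r (t, x)) := slice_continuous_closed cr t0.
have c2 i : continuous (fun x => w (t, x) 0 i) := slice_continuous_closed (cw i) t0.
rewrite /kinetic /wvar -torus_int_sum => [|i]; last by rewrite /slice; slice_cont.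
apply: eq_torus_int => x _; rewrite /sqnorm mulr_sumr; apply: eq_bigr => i _.
rewrite !mxE /wmean -rk; congr (_ * _).
Qed.

Lemma lyapunov_split (t : R) : 0 <= t -> lyapunov rho u n v t =
  velocity_part rc nc rho (fun i z => u z 0 i) n (fun i z => v z 0 i) t + density_part rc nc rho n t.
Proof.
move=> t0; have rcE : tint rho t = rc := tp_rc tp t0; have ncE : tint n t = nc := tp_nc tp t0.
have h1 := weighted_sqnorm (tp_crho tp) (tp_cu tp) rcE t0.
have h2 := weighted_sqnorm (tp_cn tp) (tp_cv tp) ncE t0.
have h3 : sqnorm (mean_velocity rho u t - mean_velocity n v t) =
    drift rc nc rho (fun i z => u z 0 i) n (fun i z => v z 0 i) t.
  by apply: eq_bigr => i _; rewrite !mxE /wmean -rcE -ncE.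
have e1 : density_mean rho t = rc by [].
have e2 : density_mean n t = nc by [].
rewrite /lyapunov h1 h2 h3 e1 e2 /velocity_part /density_part /fluct; ring.
Qed.

End lyapunov.

Theorem theorem1p2 (R : realType) (gamma mu lambda : R)
    (hgamma : 1 < gamma) (hmu : 0 < mu) (hlambda : 0 < lambda + 2 * mu)
    (rhobar nbar M rhoc0 nc0 : R)
    (hrhobar : 0 < rhobar) (hnbar : 0 < nbar)
    (hrhoc0 : 0 < rhoc0) (hnc0 : 0 < nc0) :
  exists2 eps : R, 0 < eps &
  forall (rho : spacetime R -> R) (u : spacetime R -> 'rV[R]_3)
         (n : spacetime R -> R) (v : spacetime R -> 'rV[R]_3)
         (rho0 : point3 R -> R) (u0 : point3 R -> 'rV[R]_3)
         (n0 : point3 R -> R) (v0 : point3 R -> 'rV[R]_3),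
    global_classical_solution gamma mu lambda rho u n v ->
    initial_data rho u n v rho0 u0 n0 v0 ->
    (forall t x, 0 <= t ->
       0 <= rho (t, x) <= rhobar /\ 0 <= n (t, x) <= nbar) ->
    density_mean rho 0 = rhoc0 ->
    density_mean n 0 = nc0 ->
    (Linfty_norm u <= M%:E)%E ->
    (Linfty_norm v <= M%:E)%E ->
    initial_energy rho0 u0 n0 v0 <= eps ->
    exists C K : R,
      [/\ 0 < C, 0 < K &
          forall t : R, 0 <= t ->
            lyapunov rho u n v t
            <= K * (lyapunov rho u n v 0 * expR (- C * t))].
Proof.
exists 1 => // rho u n v rho0 u0 n0 v0 S _ bd rc nc uM vM _.
have tp := solution_two_phase hgamma S bd rc nc uM vM.
have [C [K [C0 K0 h]]] := exponential_decay tp hgamma hmu hlambda hrhobar hnbar hrhoc0 hnc0.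
exists C, K; split => // t t0.
by rewrite !(lyapunov_split tp)//; exact: h.
Qed.
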